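(* Let $G$ be an undirected connected multigraph with vertex set $[n]$. The complex $\mathcal F_0(G)$ is a cellular resolution, i.e., it is supported on a CW complex.
   Context: $\mathbb K$ is a field, $R=\mathbb K[x_1,\dots,x_n]$. $G$ is given by a symmetric adjacency matrix $A_G=(a_{ij})$ of nonnegative integers. A connected $k$-partition is a set partition $\Pi$ of $[n]$ into $k$ nonempty parts, each inducing a connected subgraph of $G$. $G_\Pi$ is the graph on the set $\Pi$ in which distinct parts $U,W$ are joined by one edge (of weight $\sum_{u\in U,w\in W}a_{uw}$) iff $\sum_{u\in U,w\in W}a_{uw}>0$. An acyclic $k$-partition $\mathcal C$ is a connected $k$-partition $\Pi(\mathcal C)$ together with an acyclic orientation of $G_{\Pi(\mathcal C)}$, regarded as a directed graph on $\Pi(\mathcal C)$; it is $n$-acyclic if it has a unique sink, at the part containing $n$. For $u\in U\in\Pi(\mathcal C)$ put $out_{\mathcal C}(u)=\sum_{W:(U,W)\in\mathcal C}\sum_{w\in W}a_{uw}$ and $D(\mathcal C)=(out_{\mathcal C}(u))_{u\in[n]}$. An edge $e=(e^-,e^+)$ of $\mathcal C$ (directed from $e^-$ to $e^+$) is contractible if the directed graph $\mathcal C/e$ obtained by merging $e^-,e^+$ into $e^-\cup e^+$ (and deleting $e$) has no directed cycle (including 2-cycles); then $\mathcal C/e$ is an acyclic $(k-1)$-partition, $n$-acyclic if $\mathcal C$ is. Put $m_{\mathcal C}(e)=\mathbf x^{D(\mathcal C)-D(\mathcal C/e)}$. If $e\neq f$ are edges of $\mathcal C$ and $e$ is contractible,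 $f/e$ denotes the edge of $\mathcal C/e$ corresponding to $f$. Sign functions: fixed functions $\operatorname{sign}_{\mathcal C}$ from the contractible edges of $\mathcal C$ to $\{\pm1\}$, one for each $n$-acyclic partition $\mathcal C$, such that if $e$ and $f$ are distinct contractible edges of $\mathcal C$, then $\operatorname{sign}_{\mathcal C}(e)\operatorname{sign}_{\mathcal C/e}(f/e)=-\operatorname{sign}_{\mathcal C}(f)\operatorname{sign}_{\mathcal C/f}(e/f)$. $\mathcal F_0(G)$ is the complex $F_{0,n-1}\to\cdots\to F_{0,0}=R$, where $F_{0,k}=\bigoplus_{\mathcal C}R(-D(\mathcal C))$ has one basis element for each $n$-acyclic $(k+1)$-partition $\mathcal C$ and $\delta_{0,k}:F_{0,k}\to F_{0,k-1}$ is given by $\delta_{0,k}(\mathcal C)=\sum_e\operatorname{sign}_{\mathcal C}(e)m_{\mathcal C}(e)(\mathcal C/e)$, summed over contractible edges $e$ of $\mathcal C$. It is a minimal free resolution of $R/M_G$, where $M_G=\langle\prod_{i\in S}x_i^{\sum_{j\in[n]\setminus S}a_{ij}}:\emptyset\neq S\subseteq[n-1]\rangle$. Supported on a CW complex: a labeled CW complex is a finite CW complex $X$ whose cells (together with an empty cell of dimension $-1$, labeled $1$) are labeled by monomials so that the label $\mathbf x^{a_\sigma}$ of each cell $\sigma$ of positive dimension is the least common multiple of the labels of the cells in its boundary. Its cellular complex has in homological degree $k$ the free module $\bigoplus_{\dim\sigma=k-1}R(-a_\sigma)$, and differential $\sigma\mapsto\sum_\tau[\sigma:\tau]\,\mathbf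 x^{a_\sigma-a_\tau}\,\tau$, where $\tau$ runs over cells of dimension $\dim\sigma-1$ and $[\sigma:\tau]$ are the incidence numbers of the (reduced) cellular chain complex of $X$. A free resolution is supported on $X$ if it is isomorphic to the cellular complex of such a labeled CW complex $X$. *)

(* Defs.v *)
From HB Require Import structures.
From mathcomp Require Import all_boot all_order all_algebra.
From mathcomp.multinomials Require mpoly freeg.

Set Implicit Arguments.
Unset Strict Implicit.
Unset Printing Implicit Defensive.
Import GRing.Theory Num.Theory.

(* A multigraph on the vertex set [n+1] is given by its adjacency matrix of
   nonnegative integers; vertices are indexed by 'I_n.+1, and ord_max plays
   the role of the distinguished last vertex.  Diagonal entries are allowed
   and never used. *)

Section AcyclicPartitions.
Local Open Scope nat_scope.
Variable n : nat.
Local Notation V := 'I_n.+1.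
Variable A : 'M[nat]_n.+1.

Definition weight (U W : {set V}) : nat := \sum_(u in U) \sum_(w in W) A u w.

Definition connected_in (U : {set V}) : bool :=
  [forall u in U, forall v in U,
     connect [rel x y | [&& x \in U, y \in U & 0 < A x y]] u v].

Definition connected_graph : bool := connected_in [set: V].

Definition connected_partition (P : {set {set V}}) : bool :=
  partition P [set: V] && [forall U in P, connected_in U].

Definition quotient_adj (P : {set {set V}}) (U W : {set V}) : bool :=
  [&& U \in P, W \in P, U != W & 0 < weight U W].

Definition edge : finType := ({set V} * {set V})%type.

(* A directed graph on a set of parts: its vertices and its edges, an edge
   (U, W) being directed from U to W. *)
Definition pdigraph : finType := ({set {set V}} * {set edge})%type.

Definition is_orientation (C : pdigraph) : bool :=
  [forall U, forall W,
     (((U, W) \in C.2) || ((W, U) \in C.2) == quotient_adj C.1 U W) &&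
     ~~ (((U, W) \in C.2) && ((W, U) \in C.2))].

(* No edge closes up to a directed cycle (loops and 2-cycles included). *)
Definition acyclic_edges (E : {set edge}) : bool :=
  [forall f in E, ~~ connect [rel U W | (U, W) \in E] f.2 f.1].

Definition acyclic_partition (C : pdigraph) : bool :=
  [&& connected_partition C.1, is_orientation C & acyclic_edges C.2].

Definition is_sink (C : pdigraph) (U : {set V}) : bool :=
  [forall f in C.2, f.1 != U].

Definition nacyclic (C : pdigraph) : bool :=
  acyclic_partition C &&
  [forall U in C.1, is_sink C U == (ord_max \in U)].

Definition out (C : pdigraph) (u : V) : nat :=
  \sum_(f in C.2 | u \in f.1) \sum_(w in f.2) A u w.

Definition merge (e : edge) (U : {set V}) : {set V} :=
  if (U == e.1) || (U == e.2) then e.1 :|: e.2 else U.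

(* contract_edge e f is the edge f/e. *)
Definition contract_edge (e f : edge) : edge := (merge e f.1, merge e f.2).

(* contract C e is C/e. *)
Definition contract (C : pdigraph) (e : edge) : pdigraph :=
  ([set merge e U | U in C.1], [set contract_edge e f | f in C.2 :\ e]).

Definition contractible (C : pdigraph) (e : edge) : bool :=
  (e \in C.2) && acyclic_edges (contract C e).2.

(* sign is only meaningful on contractible edges of n-acyclic partitions; the
   sign relation is imposed exactly where all four signs are meaningful. *)
Definition sign_function (sign : pdigraph -> edge -> int) : Prop :=
  (forall C e, nacyclic C -> contractible C e ->
     sign C e = 1%R \/ sign C e = (-1)%R) /\
  (forall C e f, nacyclic C -> contractible C e -> contractible C f -> e <> f ->
     contractible (contract C e) (contract_edge e f) ->
     contractible (contract C f) (contract_edge f e) ->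
     (sign C e * sign (contract C e) (contract_edge e f) =
      - (sign C f * sign (contract C f) (contract_edge f e)))%R).

End AcyclicPartitions.

Section MultigradedComplexes.
Import mpoly.
Local Open Scope ring_scope.
Variables (K : fieldType) (n : nat).

(* A sequence of based multigraded free modules \bigoplus_i S(- gdeg i) over
   S = K[x_1, ..., x_n]; gcoef i j is the coefficient of the basis element j
   in the differential of the basis element i. *)
Record gcomplex := GComplex {
  gbasis : nat -> finType;
  gdeg : forall k, gbasis k -> 'X_{1..n};
  gcoef : forall k, gbasis k.+1 -> gbasis k -> {mpoly K[n]}
}.

Definition gmod (F : gcomplex) (k : nat) :=
  {ffun gbasis F k -> {mpoly K[n]}^o}.

Definition gdiff (F : gcomplex) (k : nat) (v : gmod F k.+1) : gmod F k :=
  [ffun j => \sum_i v i * gcoef i j].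

Definition ghomog (F : gcomplex) (k : nat) (a : 'X_{1..n}) (v : gmod F k) :=
  forall i m, m \in msupp (v i) -> (m + gdeg i)%MM = a.

(* Isomorphism of complexes of multigraded S-modules. *)
Definition giso (F G : gcomplex) : Prop :=
  exists psi : forall k, {linear gmod F k -> gmod G k},
    [/\ forall k, bijective (psi k),
        forall k a v, ghomog a v -> ghomog a (psi k v)
      & forall k v, psi k (gdiff v) = gdiff (psi k.+1 v)].

End MultigradedComplexes.

Section F0.
Import mpoly.
Local Open Scope ring_scope.
Variables (K : fieldType) (n : nat) (A : 'M[nat]_n.+1).
Variable sign : pdigraph n -> edge n -> int.

Definition outdeg (C : pdigraph n) : 'X_{1..n.+1} :=
  [multinom out A C u | u < n.+1].

Definition F0_basis (k : nat) : finType :=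
  {C : pdigraph n | nacyclic A C && (#|C.1| == k.+1)}.

Definition F0_coef (k : nat) (C : F0_basis k.+1) (C' : F0_basis k) :
    {mpoly K[n.+1]} :=
  \sum_(e in (val C).2 | contractible (val C) e &&
                         (contract (val C) e == val C'))
     (sign (val C) e)%:~R * 'X_[outdeg (val C) - outdeg (contract (val C) e)].

Definition F0 : gcomplex K n.+1 :=
  @GComplex K n.+1 F0_basis (fun k C => outdeg (val C)) F0_coef.

End F0.

(* The cellular complex over S = K[x_1, ..., x_n] built from the cells of each
   dimension, their labels and the incidence numbers in positive dimension. *)
Section CellularComplexes.
Import mpoly.
Local Open Scope ring_scope.
Variables (K : fieldType) (n : nat) (cell : nat -> finType).
Variable label : forall d, cell d -> 'X_{1..n}.
Variable inc : forall d, cell d.+1 -> cell d -> int.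

(* Dimensions are shifted by one, with the empty cell (labeled 1) in degree 0,
   and every vertex has incidence number 1 with the empty cell. *)
Definition acell (k : nat) : finType := if k is d.+1 then cell d else unit.

Definition alabel (k : nat) : acell k -> 'X_{1..n} :=
  match k with d.+1 => @label d | 0%N => fun=> 0%MM end.

Definition ainc (k : nat) : acell k.+1 -> acell k -> int :=
  match k with d.+1 => @inc d | 0%N => fun _ _ => 1 end.

(* The subtraction of exponents truncates, but incidence numbers of a labeled
   CW complex vanish unless the label of t divides that of s. *)
Definition cellular_complex : gcomplex K n :=
  @GComplex K n acell alabel (fun k s t =>
    (ainc s t)%:~R * 'X_[alabel s - alabel t]).

(* m is the least common multiple of the monomials in L. *)
Definition is_mlcm (L : 'X_{1..n} -> Prop) (m : 'X_{1..n}) : Prop :=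
  (forall l, L l -> (l <= m)%MM) /\
  (forall m', (forall l, L l -> (l <= m')%MM) -> (m <= m')%MM).

End CellularComplexes.

From mathcomp Require Import all_classical all_reals topology normedtype.
Import numFieldNormedType.Exports.

(* The standard simplex serves both as the domain of singular simplices and as
   the model of the closed d-ball for the cells of a CW complex. *)
Section Simplices.
Local Open Scope ring_scope.
Local Open Scope classical_set_scope.
Variable R : realType.

Definition std_simplex (d : nat) : set 'rV[R]_d.+1 :=
  [set x | (forall i, 0 <= x ord0 i) /\ \sum_i x ord0 i = 1].
Arguments std_simplex d : clear implicits.

Definition simplex_int (d : nat) : set (std_simplex d) :=
  [set x | forall i, 0 < (val x : 'rV[R]_d.+1) ord0 i].

Definition simplex_bd (d : nat) : set (std_simplex d) := ~` @simplex_int d.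

Definition face_row (d : nat) (i : 'I_d.+2) (x : 'rV[R]_d.+1) : 'rV[R]_d.+2 :=
  \row_j oapp (x ord0) 0 (unlift i j).

Lemma face_rowP (d : nat) (i : 'I_d.+2) (x : std_simplex d) :
  face_row i (val x) \in std_simplex d.+1.
Proof.
have [x0 x1] := set_valP x; apply/mem_set; split=> [j|].
  by rewrite mxE; case: (unlift i j) => [k|] /=.
rewrite (bigD1_ord i) //= mxE unlift_none /= add0r -[RHS]x1.
by apply: eq_bigr => j _; rewrite mxE liftK.
Qed.

Definition face (d : nat) (i : 'I_d.+2) (x : std_simplex d) :
  std_simplex d.+1 := exist _ (face_row i (val x)) (face_rowP i x).

End Simplices.
Arguments std_simplex R d : clear implicits.

Section SingularChains.
Import freeg.
Local Open Scope ring_scope.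
Local Open Scope classical_set_scope.
Variables (R : realType) (T : topologicalType).

(* Integral combinations of arbitrary maps; singular chains of a subspace Y are
   singled out by chain_in. *)
Definition chain (d : nat) := {freeg (std_simplex R d -> T) / int}.

Definition gen (d : nat) (s : std_simplex R d -> T) : chain d := << s >>.

Definition chain_bd (d : nat) (c : chain d.+1) : chain d :=
  fglift (fun s : std_simplex R d.+1 -> T =>
    \sum_(i < d.+2) (-1) ^+ i *: gen (s \o @face R d i)) c.

Definition chain_in (Y : set T) (d : nat) (c : chain d) : Prop :=
  forall s : std_simplex R d -> T,
    s \in dom c -> continuous s /\ range s `<=` Y.

End SingularChains.

Section CW.
Import freeg.
Local Open Scope ring_scope.
Local Open Scope classical_set_scope.
Variable R : realType.

(* A finite CW complex.  As the space is Hausdorff and there are finitely many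
   cells, the weak topology condition, and the fact that characteristic maps
   are homeomorphisms from open simplices onto open cells, are automatic. *)
Record finCW := FinCW {
  cw_space :> topologicalType;
  cell : nat -> finType;
  charmap : forall d, cell d -> std_simplex R d -> cw_space;
  open_cell := fun s : {d & cell d} =>
    charmap (projT2 s) @` @simplex_int R (projT1 s);
  _ : hausdorff_space cw_space;
  _ : exists N : nat, forall d, (N <= d)%N -> #|cell d| = 0%N;
  _ : forall d (c : cell d), continuous (charmap c);
  _ : forall d (c : cell d) x y, simplex_int x -> simplex_int y ->
        charmap c x = charmap c y -> x = y;
  _ : trivIset [set: {d & cell d}] open_cell;
  _ : \bigcup_s open_cell s = [set: cw_space];
  _ : forall d (c : cell d),
        charmap c @` @simplex_bd R d `<=`
        \bigcup_(s in [set s | (projT1 s < d)%N]) open_cell s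
}.

Definition cell_in_bd (X : finCW) (d j : nat) (t : cell X j) (s : cell X d) :=
  @open_cell X (existT _ j t) `<=` charmap s @` @simplex_bd R d.

(* The union of the cells of dimension < d, that is, the (d-1)-skeleton. *)
Definition cells_below (X : finCW) (d : nat) : set X :=
  \bigcup_(s in [set s | (projT1 s < d)%N]) @open_cell X s.

(* The cellular boundary of X in the basis of H_d(X^d, X^(d-1)) given by the
   classes of the characteristic maps: for a (d+1)-cell s,
   bd [s] = \sum_t inc s t [t] in H_d(X^d, X^(d-1)). *)
Definition incidence (X : finCW)
    (inc : forall d, cell X d.+1 -> cell X d -> int) : Prop :=
  forall d (s : cell X d.+1),
  exists (b : chain R X d.+1) (c : chain R X d),
    [/\ chain_in (@cells_below X d.+1) b,
        chain_in (@cells_below X d) c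
      & chain_bd (gen (charmap s)) =
        \sum_t inc d s t *: gen (charmap t) + chain_bd b + c].

End CW.

Definition lcm_labels (R : realType) (n : nat) (X : finCW R)
    (label : forall d, cell X d -> mpoly.multinom n) : Prop :=
  forall d (s : cell X d), (0 < d)%N ->
    is_mlcm (fun l => exists j (t : cell X j), cell_in_bd t s /\ l = label j t)
            (label d s).

Definition supported_on_CW (R : realType) (K : fieldType) (n : nat)
    (F : gcomplex K n) : Prop :=
  exists (X : finCW R) (label : forall d, cell X d -> mpoly.multinom n)
         (inc : forall d, cell X d.+1 -> cell X d -> int),
    [/\ lcm_labels label, incidence inc & giso F (cellular_complex K label inc)].

(* Main.v *)
(* Work with height functions f on the vertices, normalized by f(n) = 0 and
   sum f = 1, such that every vertex has a weakly descending path to n.  Those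
   that descend weakly along the arrows of an n-acyclic partition C form a
   polytope whose proper faces belong to the contractions of C; these polytopes
   are the cells (the bounded part of the graphical arrangement).  Positive
   weights y on the parts other than the sink are carried onto the cone of C by
   the longest path map f(U) = y_U + max_{U -> W} f(W), with inverse
   y_U = f(U) - max_{U -> W} f(W); this gives the characteristic map on the
   standard simplex.

   No homology is computed for the incidence numbers.  By cone constructions
   that respect all faces, the simplex is chain homotopic to its subdivision
   into flags of filters of C, i.e. linear extensions; on these flags the
   longest path map is linear, so they make sense independently of C.  The same
   flags, weighted by the given sign function, satisfy
   d(C) = sum_e sign_C(e) (C/e), because the contractions of a pair of edges
   occur twice with opposite signs.  The two weightings differ by one sign eps_C
   for each C; hence the incidence numbers are eps_C sign_C(e) eps_{C/e}, and
   rescaling the basis by eps identifies F_0(G) with the cellular complex. *)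
Require Import Defs.
From HB Require Import structures.
From mathcomp Require Import all_boot all_order all_algebra.
From mathcomp Require Import zify.
From mathcomp.multinomials Require mpoly freeg.

Set Implicit Arguments.
Unset Strict Implicit.
Unset Printing Implicit Defensive.
Import Order.TTheory GRing.Theory Num.Theory.

(** * Contractions of acyclic partitions *)

Section Combinatorics.
Local Open Scope nat_scope.
Variable n : nat.
Local Notation V := 'I_n.+1.
Local Notation merge := Defs.merge.
Variable A : 'M[nat]_n.+1.
Hypothesis A_sym : forall i j, A i j = A j i.

(** The obstacle is a mismatch of faces. The simplex of C has one facet for each nonsink part U,
    namely y_U = 0, while the cell of C has one facet for each contractible arrow. The longest path
    map spreads the facet y_U = 0 over the facets of the contractible arrows leaving U, and its
    restriction there is in general not the characteristic map of any C/e. So the boundary of a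
    characteristic map is in general no combination of characteristic maps, and [incidence] has to
    be witnessed by explicit correction chains in the lower skeleta; the flags of filters are the
    common refinement on which both sides agree as chains.

    Partitions are compared through height functions throughout. An n-acyclic partition is
    determined by any one strict height function on it; an arrow is shown contractible by exhibiting
    a height function that is constant along it and strict along all others; the diamond property is
    a perturbation argument on such functions. Natural heights serve for this combinatorics and real
    heights for the topology, hence the arbitrary ordered codomain. *)

Definition erel (E : {set edge n}) : rel {set V} := [rel U W | (U, W) \in E].

Lemma connect_potential d (T : orderType d) (E : {set edge n})
    (g : {set V} -> T) :
  (forall x, x \in E -> (g x.2 < g x.1)%O) ->
  forall U W, connect (erel E) U W -> (g W <= g U)%O.
Proof.
move=> gE U W /connectP[p + ->]; elim: p U => //= X p IH U /andP[UX /IH h].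
by apply: le_trans h _; apply/ltW/(gE (U, X)).
Qed.

Lemma acyclic_potential d (T : orderType d) (E : {set edge n})
    (g : {set V} -> T) :
  (forall x, x \in E -> (g x.2 < g x.1)%O) -> acyclic_edges E.
Proof.
move=> gE; apply/forall_inP => x xE; apply/negP => /(connect_potential gE).
by rewrite leNgt gE.
Qed.

(** A canonical integer potential of an acyclic edge set: it is the usual induction measure, and
    through [rank_strict] an explicit point of the open cone. *)
Definition rank (E : {set edge n}) (U : {set V}) : nat :=
  #|[set W | connect (erel E) U W]|.

Lemma rank_lt (E : {set edge n}) x :
  acyclic_edges E -> x \in E -> rank E x.2 < rank E x.1.
Proof.
move=> /forall_inP aE xE; apply: proper_card; rewrite properE.
apply/andP; split; apply/subsetP.
  move=> W; rewrite !inE; apply: connect_trans; apply: connect1.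
  by case: x xE.
by move=> /(_ x.1); rewrite !inE connect0 => /(_ isT) h; move: (aE x xE); rewrite h.
Qed.

Lemma weight_gt0 (U W : {set V}) :
  reflect (exists u w, [/\ u \in U, w \in W & 0 < A u w]) (0 < weight A U W).
Proof.
rewrite lt0n; apply: (iffP idP) => [|[u [w [uU wW Auw]]]]; last first.
  by rewrite sum_nat_eq0; apply/forall_inPn; exists u => //;
    rewrite sum_nat_eq0; apply/forall_inPn; exists w => //; rewrite -lt0n.
rewrite sum_nat_eq0 => /forall_inPn[u uU].
by rewrite sum_nat_eq0 => /forall_inPn[w wW]; rewrite -lt0n; exists u, w.
Qed.

Definition blk (C : pdigraph n) (u : V) : {set V} := pblock C.1 u.
Definition arr (C : pdigraph n) (u w : V) : bool := (blk C u, blk C w) \in C.2.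

Section Facts.
Variable C : pdigraph n.
Hypothesis hC : nacyclic A C.

Lemma nac_partition : partition C.1 [set: V].
Proof. by case/andP: hC => /and3P[/andP[]]. Qed.

Lemma nac_triv : trivIset C.1.
Proof. by case/and3P: nac_partition. Qed.

Lemma nac_connected U : U \in C.1 -> connected_in A U.
Proof. by case/andP: hC => /and3P[/andP[_ /forall_inP h] _ _] _; apply: h. Qed.

Lemma nac_acyclic : acyclic_edges C.2.
Proof. by case/andP: hC => /and3P[]. Qed.

Lemma blk_in u : blk C u \in C.1.
Proof. by apply: pblock_mem; rewrite (cover_partition nac_partition) inE. Qed.

Lemma mem_blk u : u \in blk C u.
Proof. by rewrite mem_pblock (cover_partition nac_partition) inE. Qed.
Hint Resolve blk_in mem_blk : core.

Lemma blk_def U u : U \in C.1 -> u \in U -> blk C u = U.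
Proof. by move=> UC uU; apply: def_pblock nac_triv UC uU. Qed.

Lemma part_ex U : U \in C.1 -> exists u, u \in U.
Proof.
move=> UC; apply/set0Pn/negP => /eqP U0.
by case/and3P: nac_partition => _ _; rewrite -U0 UC.
Qed.

Lemma part_blk U : U \in C.1 -> exists u, U = blk C u.
Proof. by move=> UC; have [u uU] := part_ex UC; exists u; rewrite (blk_def UC uU). Qed.

Lemma eq_part U W u : U \in C.1 -> W \in C.1 -> u \in U -> u \in W -> U = W.
Proof. by move=> UC WC uU uW; rewrite -(blk_def UC uU) (blk_def WC uW). Qed.

Lemma blk_eq u w : (blk C u == blk C w) = (w \in blk C u).
Proof.
apply/eqP/idP => [->//|wu]; exact/esym/(blk_def (blk_in u) wu).
Qed.

Lemma orient U W :
  ((U, W) \in C.2) || ((W, U) \in C.2) = quotient_adj A C.1 U W.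
Proof.
by case/andP: hC => /and3P[_ /forallP/(_ U)/forallP/(_ W)/andP[/eqP]].
Qed.

Lemma edge_anti U W : (U, W) \in C.2 -> (W, U) \notin C.2.
Proof.
case/andP: hC => /and3P[_ /forallP/(_ U)/forallP/(_ W)/andP[_ h] _] _ UW.
by move: h; rewrite UW.
Qed.

Lemma edge_adj U W : (U, W) \in C.2 -> quotient_adj A C.1 U W.
Proof. by rewrite -orient => ->. Qed.

Lemma edge_l U W : (U, W) \in C.2 -> U \in C.1.
Proof. by case/edge_adj/and4P. Qed.

Lemma edge_r U W : (U, W) \in C.2 -> W \in C.1.
Proof. by case/edge_adj/and4P. Qed.

Lemma edge_neq U W : (U, W) \in C.2 -> U != W.
Proof. by case/edge_adj/and4P. Qed.

Lemma arrP U W : (U, W) \in C.2 -> exists u w, [/\ U = blk C u, W = blk C w,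
   0 < A u w & arr C u w].
Proof.
move=> UW; case/edge_adj/and4P: (UW) => UC WC _ /weight_gt0[u [w [uU wW Auw]]].
by exists u, w; rewrite /arr (blk_def UC uU) (blk_def WC wW).
Qed.

Lemma arr_total u w : 0 < A u w -> blk C u != blk C w -> arr C u w || arr C w u.
Proof.
move=> Auw ne; rewrite /arr orient /quotient_adj !blk_in ne /=.
by apply/weight_gt0; exists u, w; rewrite !mem_blk.
Qed.

Lemma sinkE U : U \in C.1 -> is_sink C U = (ord_max \in U).
Proof. case/andP: hC => _ /forallP h UC. move: (h U); rewrite UC /=. by move/eqP. Qed.

Lemma sink_out U W : (U, W) \in C.2 -> ord_max \notin U.
Proof.
move=> UW; rewrite -sinkE ?(edge_l UW) //; apply/forall_inPn.
by exists (U, W) => //=; rewrite negbK.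
Qed.

Lemma nonsink_out U : U \in C.1 -> ord_max \notin U -> exists W, (U, W) \in C.2.
Proof.
move=> UC; rewrite -sinkE // => /forall_inPn[[X W] XW] /=.
by rewrite negbK => /eqP <-; exists W.
Qed.

Lemma rank_edge U W : (U, W) \in C.2 -> rank C.2 W < rank C.2 U.
Proof. exact: (@rank_lt _ (U, W) nac_acyclic). Qed.

Lemma reach_sink U : U \in C.1 -> connect (erel C.2) U (blk C ord_max).
Proof.
have [m] := ubnP (rank C.2 U); elim: m U => // m IH U /ltnSE rU UC.
have [nU|nU] := boolP (ord_max \in U); first by rewrite (blk_def UC nU).
have [W UW] := nonsink_out UC nU.
apply: connect_trans (connect1 _) (IH W _ (edge_r UW)); first exact: UW.
exact: leq_trans (rank_edge UW) rU.
Qed.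

End Facts.

(* The height function f lies in the relatively open cone of C. *)
Definition strict_on d (T : orderType d) (C : pdigraph n) (f : V -> T) :=
  (forall u w, blk C u = blk C w -> f u = f w) /\
  (forall u w, arr C u w -> (f w < f u)%O).

Lemma strict_arr d (T : orderType d) C (f : V -> T) u w :
  nacyclic A C -> strict_on C f -> 0 < A u w -> arr C u w = (f w < f u)%O.
Proof.
move=> hC [fc fs] Auw; apply/idP/idP => [/fs//|fwu].
have ne : blk C u != blk C w by apply: contraTneq fwu => /fc ->; rewrite ltxx.
by case/orP: (arr_total hC Auw ne) => // /fs /(lt_trans fwu); rewrite ltxx.
Qed.

(** Walk inside a part of C, which is connected and on which [f] is constant: two adjacent vertices
    of equal height cannot lie in different parts of C', since an arrow of C' would separate their
    heights. *)
Lemma strict_blk_sub d (T : orderType d) C C' (f : V -> T) u :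
  nacyclic A C -> nacyclic A C' ->
  (forall u w, blk C u = blk C w -> f u = f w) -> strict_on C' f ->
  blk C u \subset blk C' u.
Proof.
move=> hC hC' fc [fc' fs']; apply/subsetP => w wu.
have /forall_inP/(_ u (mem_blk hC u))/forall_inP/(_ w wu)/connectP[p pP ->] :=
  nac_connected hC (blk_in hC u).
rewrite -blk_eq //; elim: p u {wu w} pP => //= x p IH u /andP[/and3P[xu xb Aux] pP].
have fux : f u = f x by apply/fc/eqP; rewrite blk_eq.
have /eqP ux' : blk C' u == blk C' x.
  apply/negP => /negP ne; have := arr_total hC' Aux ne.
  by case/orP => /fs'; rewrite fux ltxx.
have /eqP bx : blk C u == blk C x by rewrite blk_eq.
by rewrite ux'; apply: IH; rewrite -bx.
Qed.

(** Different open cones are disjoint. The parts agree by two inclusions, and the arrows are then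
    read off from [f] along the edges of the graph. Equalities of partitions below are mostly
    obtained this way. *)
Lemma strict_uniq d (T : orderType d) C C' (f : V -> T) :
  nacyclic A C -> nacyclic A C' -> strict_on C f -> strict_on C' f -> C = C'.
Proof.
move=> hC hC' fC fC'.
have eb u : blk C u = blk C' u.
  apply/eqP; rewrite eqEsubset; case: (fC) (fC') => fc _ [fc' _].
  by rewrite !(@strict_blk_sub _ _ _ _ f).
have part D D' : nacyclic A D -> nacyclic A D' -> blk D =1 blk D' ->
    {subset D.1 <= D'.1}.
  by move=> hD hD' e U /(part_blk hD)[u ->]; rewrite e blk_in.
have edges D D' : nacyclic A D -> nacyclic A D' -> blk D =1 blk D' ->
    strict_on D f -> strict_on D' f -> {subset D.2 <= D'.2}.
  move=> hD hD' e fD fD' [U W] /(arrP hD)[u [w [-> -> Auw]]].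
  by rewrite (strict_arr hD fD Auw) -(strict_arr hD' fD' Auw) /arr !e.
rewrite [C]surjective_pairing [C']surjective_pairing; congr pair;
  apply/setP => x; apply/idP/idP; [exact: part|exact: part|exact: edges|exact: edges].
Qed.

Section Contraction.
Variables (C : pdigraph n) (e : edge n).
Hypothesis hC : nacyclic A C.
Hypothesis eC : e \in C.2.
Let C' := contract C e.

Let aC : e.1 \in C.1. Proof. by apply: (edge_l (W := e.2) hC); case: e eC. Qed.
Let bC : e.2 \in C.1. Proof. by apply: (edge_r (U := e.1) hC); case: e eC. Qed.
Let ab : e.1 != e.2. Proof. by apply: (edge_neq hC); case: e eC. Qed.

Definition ends (U : {set V}) := (U == e.1) || (U == e.2).

Lemma merge_ends U : ends U -> merge e U = e.1 :|: e.2.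
Proof. by rewrite /merge -/(ends U) => ->. Qed.

Lemma merge_id U : ~~ ends U -> merge e U = U.
Proof. by rewrite /merge -/(ends U) => /negbTE ->. Qed.

Lemma merge_sub (U : {set V}) : U \subset merge e U.
Proof.
rewrite /merge; case: ifP => // /orP[]/eqP ->; [exact: subsetUl|exact: subsetUr].
Qed.

Lemma mem_merge U u : U \in C.1 -> u \in merge e U ->
  blk C u = U \/ (ends (blk C u) /\ ends U).
Proof.
move=> UC; have [eU|neU] := boolP (ends U); last first.
  by rewrite merge_id // => uU; left; apply: blk_def.
rewrite merge_ends // inE => uab; right; split=> //.
by case/orP: uab => /(blk_def hC) ->; rewrite /ends ?eqxx ?orbT.
Qed.

Lemma merge_inj U W : U \in C.1 -> W \in C.1 -> merge e U = merge e W ->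
  U = W \/ (ends U /\ ends W).
Proof.
move=> UC WC eUW; have [u uU] := part_ex hC UC.
have : u \in merge e W by rewrite -eUW; apply: (subsetP (merge_sub U)).
by case/(mem_merge WC); rewrite (blk_def hC UC uU); [left|right].
Qed.

Lemma merge_mem U u : U \in C.1 -> u \in merge e U ->
  merge e (blk C u) = merge e U.
Proof. by move=> UC /(mem_merge UC)[->//|[? ?]]; rewrite !merge_ends. Qed.

Lemma contract_partition : partition C'.1 [set: V].
Proof.
have inC' U : U \in C.1 -> merge e U \in C'.1 by apply: imset_f.
apply/and3P; split.
- apply/eqP/setP => u; rewrite inE; apply/bigcupP; exists (merge e (blk C u)).
    by rewrite inC' ?blk_in.
  by rewrite (subsetP (merge_sub _)) ?mem_blk.
- apply/trivIsetP => _ _ /imsetP[U UC ->] /imsetP[W WC ->]; apply: contraR.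
  by case/pred0Pn => u /andP[/= uU uW]; rewrite -(merge_mem UC uU) (merge_mem WC uW).
- apply/imsetP => -[U UC U0]; have [u uU] := part_ex hC UC.
  by have := subsetP (merge_sub U) u uU; rewrite -U0 inE.
Qed.

Lemma contract_blk u : blk C' u = merge e (blk C u).
Proof.
case/and3P: contract_partition => _ tI _; apply: def_pblock tI _ _.
  by apply: imset_f; rewrite blk_in.
by rewrite (subsetP (merge_sub _)) ?mem_blk.
Qed.

Lemma contract_edge_in f : f \in C.2 -> f != e -> contract_edge e f \in C'.2.
Proof. by move=> fC fe; apply: imset_f; rewrite !inE fe. Qed.

Lemma contract_connected U : U \in C'.1 -> connected_in A U.
Proof.
case/imsetP => X XC ->; have [eX|neX] := boolP (ends X); last first.
  by rewrite merge_id // (nac_connected hC).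
rewrite merge_ends //; set D := _ :|: _.
have sub Y : Y \in C.1 -> Y \subset D -> {in Y &, forall u v,
    connect [rel x y | [&& x \in D, y \in D & 0 < A x y]] u v}.
  move=> YC YD u v uY vY.
  have /forall_inP/(_ u uY)/forall_inP/(_ v vY) := nac_connected hC YC.
  apply: connect_sub => x y /= /and3P[xY yY Axy].
  by apply: connect1; rewrite /= !(subsetP YD) // Axy.
have aD : e.1 \subset D by apply: subsetUl.
have bD : e.2 \subset D by apply: subsetUr.
have [/and4P[_ _ _ /weight_gt0[x [y [xa yb Axy]]]]] :
    quotient_adj A C.1 e.1 e.2 by apply: edge_adj => //; case: e eC.
have xD := subsetP aD _ xa; have yD := subsetP bD _ yb.
have xy : connect [rel x y | [&& x \in D, y \in D & 0 < A x y]] x y.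
  by apply: connect1; rewrite /= xD yD.
have yx : connect [rel x y | [&& x \in D, y \in D & 0 < A x y]] y x.
  by apply: connect1; rewrite /= xD yD A_sym.
apply/forall_inP => u; rewrite inE => uD; apply/forall_inP => v; rewrite inE.
case/orP: uD => uD /orP[] vD; try exact: (sub _ _ _ u v uD vD).
- exact: (connect_trans (sub _ aC aD u x uD xa)
           (connect_trans xy (sub _ bC bD y v yb vD))).
- exact: (connect_trans (sub _ bC bD u y uD yb)
           (connect_trans yx (sub _ aC aD x v xa vD))).
Qed.

Lemma connect_contract U W : connect (erel C.2) U W ->
  connect (erel C'.2) (merge e U) (merge e W).
Proof.
case/connectP => p + ->; elim: p U => [|X p IH] U /=; first by rewrite connect0.
case/andP=> UX /IH; apply: connect_trans.
have [/eqP E|ne] := boolP ((U, X) == e); last first.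
  by apply: connect1; apply: (@contract_edge_in (U, X)).
by rewrite !merge_ends ?connect0 // /ends -E eqxx ?orbT.
Qed.

Lemma contract_arrP P Q : (P, Q) \in C'.2 -> exists u w,
  [/\ P = blk C' u, Q = blk C' w, arr C u w & (blk C u, blk C w) != e].
Proof.
case/imsetP => -[U W]; rewrite !inE /= => /andP[ne UW] [-> ->].
have [u [w [eU eW _ uw]]] := arrP hC UW.
by exists u, w; rewrite !contract_blk -eU -eW.
Qed.

Hypothesis contr_e : contractible C e.
Let acC' : acyclic_edges C'.2. Proof. by case/andP: contr_e. Qed.

Lemma contract_nacyclic : nacyclic A C'.
Proof.
have anti f : f \in C.2 -> f != e ->
    ~~ connect (erel C'.2) (merge e f.2) (merge e f.1).
  by move=> fC fe; apply: (forall_inP acC') (contract_edge_in fC fe).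
have sinkC' P : P \in C'.1 -> is_sink C' P = (ord_max \in P).
  case/imsetP => U UC ->; apply/idP/idP => [sP|nP]; last first.
    apply/forall_inP => _ /imsetP[f + ->]; rewrite !inE => /andP[fe fC].
    apply: contra (anti f fC fe) => /= /eqP ->; rewrite -(merge_mem UC nP).
    apply/connect_contract/reach_sink => //; apply: (edge_r hC (U := f.1)).
    by case: f fC {fe}.
  apply/negPn/negP => nP.
  (* An arrow leaving [e.1] may be [e] itself, which disappears in C/e; an arrow leaving [e.2]
     always survives. *)
  pose U0 := if ends U then e.2 else U.
  have U0P : merge e U0 = merge e U.
    by rewrite /U0; case: ifP => // eU; rewrite !merge_ends // /ends eqxx orbT.
  have nU0 : ord_max \notin U0.
    by apply: contra nP; rewrite -U0P; apply: (subsetP (merge_sub _)).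
  have U0C : U0 \in C.1 by rewrite /U0; case: ifP.
  have [W UW] := nonsink_out hC U0C nU0.
  have ne : (U0, W) != e.
    apply/eqP => E; have : U0 = e.1 by rewrite -E.
    rewrite /U0; case: ifP => [_ E2|+ E1]; first by move: ab; rewrite E2 eqxx.
    by rewrite E1 /ends eqxx.
  have /forall_inP/(_ _ (contract_edge_in UW ne)) := sP.
  by rewrite /= U0P eqxx.
apply/andP; split; last by apply/forall_inP => P /sinkC' ->.
apply/and3P; split=> //.
  by rewrite /connected_partition contract_partition; apply/forall_inP/contract_connected.
apply/forallP => P; apply/forallP => Q.
have no2 X Y : (X, Y) \in C'.2 -> ~~ connect (erel C'.2) Y X.
  by move=> XY; apply: (forall_inP acC') XY.
apply/andP; split; last first.
  by apply/negP => /andP[/no2/negP h PQ]; apply/h/connect1.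
have sub X Y : (X, Y) \in C'.2 -> quotient_adj A C'.1 X Y.
  move=> XY; have ne : X != Y.
    by apply: contraTneq (no2 _ _ XY) => ->; rewrite negbK connect0.
  case/imsetP: XY ne => -[U W]; rewrite !inE => /andP[fe UW] [-> ->] ne.
  have UC := edge_l hC UW; have WC := edge_r hC UW.
  rewrite /quotient_adj ne !imset_f //=; apply/weight_gt0.
  case/edge_adj/and4P: (UW) => // _ _ _ /weight_gt0[u [w [uU wW Auw]]].
  by exists u, w; rewrite !(subsetP (merge_sub _)).
have symq X Y : quotient_adj A C'.1 X Y = quotient_adj A C'.1 Y X.
  have ws Z T : 0 < weight A Z T -> 0 < weight A T Z.
    case/weight_gt0 => u [w [uU wW Auw]]; apply/weight_gt0.
    by exists w, u; rewrite A_sym.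
  by apply/and4P/and4P => -[? ? h /ws ?]; split=> //; rewrite eq_sym.
apply/eqP; apply/idP/idP => [/orP[/sub//|/sub]|]; first by rewrite symq.
case/and4P => PC QC PQ /weight_gt0[u [w [uP wQ Auw]]].
have eP : P = merge e (blk C u).
  by case/imsetP: PC uP => U UC -> uU; rewrite (merge_mem UC).
have eQ : Q = merge e (blk C w).
  by case/imsetP: QC wQ => U UC -> uU; rewrite (merge_mem UC).
have ne : blk C u != blk C w by apply: contraNneq PQ => E; rewrite eP eQ E.
rewrite eP eQ; case/orP: (arr_total hC Auw ne) => uw; apply/orP; [left|right];
  apply: (@contract_edge_in (_, _)) => //; apply: contraNneq PQ => E;
  by rewrite eP eQ !merge_ends // /ends -E eqxx ?orbT.
Qed.

Lemma contract_card : #|C'.1| = #|C.1|.-1.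
Proof.
have -> : C'.1 = [set merge e U | U in C.1 :\ e.1].
  apply/setP => P; apply/imsetP/imsetP => -[U UC ->]; last first.
    by exists U => //; case/setD1P: UC.
  have [->|ne] := eqVneq U e.1; last by exists U; rewrite // !inE ne.
  exists e.2; first by rewrite !inE eq_sym ab bC.
  by rewrite !merge_ends // /ends eqxx ?orbT.
rewrite card_in_imset; first by rewrite [in RHS](cardsD1 e.1) aC.
move=> U W /setD1P[Ua UC] /setD1P[Wa WC] /(merge_inj UC WC)[//|[]].
by rewrite /ends (negbTE Ua) (negbTE Wa) => /eqP -> /eqP ->.
Qed.

End Contraction.

(** * Contractible arrows detected by height functions *)

Lemma rank_strict C : nacyclic A C -> strict_on C (rank C.2 \o blk C).
Proof. by move=> hC; split=> u w /= => [->//|]; apply: rank_edge. Qed.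

(** The open facet of the cone of C on which the arrow [e] becomes an equality. *)
Definition facet_on C (e : edge n) (h : V -> nat) :=
  [/\ forall u w, blk C u = blk C w -> h u = h w,
      forall u w, blk C u = e.1 -> blk C w = e.2 -> h u = h w &
      forall u w, arr C u w -> (blk C u, blk C w) != e -> h w < h u].

Lemma facet_merge C e h u w : nacyclic A C -> e \in C.2 -> facet_on C e h ->
  merge e (blk C u) = merge e (blk C w) -> h u = h w.
Proof.
move=> hC eC [hc he hs] /(merge_inj hC eC (blk_in hC u) (blk_in hC w))[/hc//|[]].
move=> /orP[]/eqP eu /orP[]/eqP ew; try by apply: hc; rewrite eu ew.
  exact: he.
by apply/esym/he.
Qed.

(** Being constant on merged parts, [h] descends to a potential on C/e, which excludes cycles
    there. *)
Lemma facet_contractible C e h : nacyclic A C -> e \in C.2 -> facet_on C e h ->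
  contractible C e.
Proof.
move=> hC eC hf; rewrite /contractible eC /=.
pose g (P : {set V}) : nat := h (odflt ord0 [pick u in P]).
have gE u : g (blk (contract C e) u) = h u.
  rewrite /g contract_blk //; case: pickP => [w /= wu|/(_ u)].
    apply: (facet_merge hC eC hf); exact: (merge_mem hC eC (blk_in hC u) wu).
  by rewrite (subsetP (merge_sub e _)) ?mem_blk.
apply: (@acyclic_potential _ nat _ g) => -[P Q] /(contract_arrP hC eC).
by case=> u [w [-> -> uw ne]]; rewrite !gE; case: hf => _ _; apply.
Qed.

Lemma facet_strict C e h : nacyclic A C -> contractible C e -> facet_on C e h ->
  strict_on (contract C e) h.
Proof.
move=> hC ce hf; have /andP[eC _] := ce.
have key u w : blk (contract C e) u = blk (contract C e) w -> h u = h w.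
  by rewrite !contract_blk // => /(facet_merge hC eC hf).
split=> // u w /(contract_arrP hC eC)[u' [w' [/key -> /key -> uw ne]]].
by case: hf => _ _; apply.
Qed.

Lemma strict_facet C e h : nacyclic A C -> contractible C e ->
  strict_on (contract C e) h -> facet_on C e h.
Proof.
move=> hC ce [hc hs]; have /andP[eC _] := ce; split.
- by move=> u w uw; apply: hc; rewrite !contract_blk // uw.
- move=> u w ue we; apply: hc; rewrite !contract_blk //.
  by rewrite !merge_ends // /ends ?ue ?we eqxx ?orbT.
move=> u w uw ne; apply: hs; rewrite /arr !contract_blk //.
exact: (contract_edge_in uw ne).
Qed.

Lemma facet_ex C e : nacyclic A C -> contractible C e ->
  exists h, facet_on C e h.
Proof.
move=> hC ce; eexists; apply: (strict_facet hC ce).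
exact: (rank_strict (contract_nacyclic hC (proj1 (andP ce)) ce)).
Qed.

(** Doubling makes room for a tie-breaking bit: strict inequalities survive the perturbation made in
    [diamond]. *)
Lemma ltn_double_bool (i j : nat) (b c : bool) : i < j -> 2 * i + b < 2 * j + c.
Proof. by case: b; case: c; lia. Qed.

(** Two arrows are identified in C/e only if they form a triangle with [e]: they share one endpoint,
    and their other endpoints are the two ends of [e]. Otherwise one of them would join the ends of
    [e], and so be a loop, the arrow [e] or its reverse. *)
Lemma lift_cases C e x f : nacyclic A C -> e \in C.2 ->
  x \in C.2 -> f \in C.2 -> x != f -> x != e -> f != e ->
  contract_edge e x = contract_edge e f ->
  [\/ x = (e.1, x.2) /\ f = (e.2, x.2), x = (e.2, x.2) /\ f = (e.1, x.2),
      x = (x.1, e.2) /\ f = (x.1, e.1) | x = (x.1, e.1) /\ f = (x.1, e.2)].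
Proof.
move=> hC; case: e x f => a b [c d] [c' d'] ab cd cd' /= xf xe fe [].
move=> /(merge_inj hC ab (edge_l hC cd) (edge_l hC cd')) Hc.
move=> /(merge_inj hC ab (edge_r hC cd) (edge_r hC cd')) Hd.
case: Hc Hd => [?|[ec ec']] [?|[ed ed']]; subst; rewrite ?eqxx // in xf *.
- move: ed ed' => /orP[]/= /eqP ? /orP[]/= /eqP ?; subst; rewrite ?eqxx // in xf *.
    by constructor 4.
  by constructor 3.
- move: ec ec' => /orP[]/= /eqP ? /orP[]/= /eqP ?; subst; rewrite ?eqxx // in xf *.
    by constructor 1.
  by constructor 2.
- have bad u v : (u, v) \in C.2 -> (u, v) != (a, b) -> ends (a, b) u ->
      ends (a, b) v -> False.
    move=> uv ne /orP[]/= /eqP ? /orP[]/= /eqP ?; subst.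
    + by have := edge_neq hC uv; rewrite eqxx.
    + by rewrite eqxx in ne.
    + by have := edge_anti hC ab; rewrite uv.
    + by have := edge_neq hC uv; rewrite eqxx.
  by case: (bad _ _ cd xe ec ed).
Qed.

Lemma mergeE (f : edge n) U : merge f U = if ends f U then f.1 :|: f.2 else U.
Proof. by []. Qed.

(* A contractible edge g of C/e lifts to C in at most two ways; the lift f
   maximizing rank f.2 - rank f.1 is the contractible one. *)
Lemma diamond C e g : nacyclic A C -> contractible C e ->
  contractible (contract C e) g ->
  exists f, [/\ contractible C f, f <> e, contract_edge e f = g,
    contractible (contract C f) (contract_edge f e) &
    contract (contract C e) g = contract (contract C f) (contract_edge f e)].
Proof.
move=> hC ce cg; have hCe := contract_nacyclic hC (proj1 (andP ce)) ce.
have /andP[eC _] := ce; have /andP[gCe _] := cg.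
have hB := contract_nacyclic hCe gCe cg.
(* The rank function of the double contraction, seen on C: it is constant along [e] and along every
   lift of [g], and strict along all other arrows. *)
have hfs := rank_strict hB; set h := _ \o _ in hfs.
have [hCc hg hs] := strict_facet hCe cg hfs.
have hc u w : merge e (blk C u) = merge e (blk C w) -> h u = h w.
  by move=> E; apply: hCc; rewrite !contract_blk.
have he u w : blk C u = e.1 -> blk C w = e.2 -> h u = h w.
  by move=> ue we; apply: hc; rewrite !merge_ends // /ends ?ue ?we eqxx ?orbT.
have hL u w : contract_edge e (blk C u, blk C w) = g -> h u = h w.
  by move=> E; apply: hg; rewrite -E contract_blk.
have hS u w : arr C u w -> (blk C u, blk C w) != e ->
    contract_edge e (blk C u, blk C w) != g -> h w < h u.
  move=> uw ne neg; apply: hs; rewrite ?/arr !contract_blk //.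
  exact: (contract_edge_in uw ne).
pose L := [set x in C.2 | (x != e) && (contract_edge e x == g)].
have /imsetP[x0] := gCe; rewrite !inE => /andP[x0e x0C] gx0.
have x0L : x0 \in L by rewrite inE x0C x0e gx0 /=.
have [N rle] : exists N, forall X, rank C.2 X <= N.
  by exists #|{set V}| => X; apply: max_card.
(* The bound [N] turns [N - rank] into an order-reversing copy of the rank, so [r] orders the lifts
   by [rank x.2 - rank x.1] while staying in [nat]. *)
pose r (x : edge n) := rank C.2 x.2 + (N - rank C.2 x.1).
case: (@arg_maxnP _ x0 (mem L) r x0L) => f; rewrite /= inE => /and3P[fC fe /eqP fg] fmax.
(* By maximality of [f], any other lift becomes parallel to [e] once [f] is contracted: in the two
   triangles where this fails, the other lift has a larger [r]. *)
have lift x : x \in L -> x != f ->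
    merge f x.1 = merge f e.1 /\ merge f x.2 = merge f e.2.
  rewrite inE => /and3P[xC xe /eqP xg] xf.
  have xL : x \in L by rewrite inE xC xe xg eqxx.
  have rx : rank C.2 x.2 < rank C.2 x.1 by apply: rank_lt => //; apply: nac_acyclic hC.
  have re : rank C.2 e.2 < rank C.2 e.1 by apply: rank_lt => //; apply: nac_acyclic hC.
  have := fmax x xL; rewrite /r; have := rle e.1; have := rle e.2; have := rle x.1.
  case: (lift_cases hC eC xC fC xf xe fe (etrans xg (esym fg))) =>
    -[-> ->] /= l1 l2 l3 l4.
  - by split=> //; rewrite !mergeE /ends /= !eqxx ?orbT.
  - exfalso; move: (rank _ e.2) (rank _ e.1) (rank _ x.2) re l2 l3 l4; clear; lia.
  - by split=> //; rewrite !mergeE /ends /= !eqxx ?orbT.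
  - exfalso; move: (rank _ e.2) (rank _ e.1) (N - _) re l4; clear; lia.
have aC : e.1 \in C.1 by apply: (edge_l (W := e.2) hC); case: (e) eC.
have bC : e.2 \in C.1 by apply: (edge_r (U := e.1) hC); case: (e) eC.
have mab : merge f e.2 != merge f e.1.
  apply/eqP => /(merge_inj hC fC bC aC); have ab : e.1 != e.2.
    by apply: (edge_neq hC); case: (e) eC.
  case=> [E|[]]; first by rewrite E eqxx in ab.
  case/orP => /eqP E2 /orP[]/eqP E1.
  - by rewrite E1 E2 eqxx in ab.
  - have := edge_anti hC (U := e.1) (W := e.2); rewrite E1 E2.
    by move: eC fC fe; case: (e) E1 E2 => /= ? ? -> ->; case: (f) => /= c d h1 h2 _ h3;
      move: (edge_anti hC h1); rewrite h2.
  - by move: fe; case: (e) E1 E2 => /= ? ? -> ->; case: (f) => /= c d; rewrite eqxx.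
  - by rewrite E1 E2 eqxx in ab.
(* Raising the part of C/f that contains [e.1] breaks the tie along [e] and along the other lifts of
   [g], but not along [f]; so [k] lies in the open facet of [f]. *)
pose k u := 2 * h u + (merge f (blk C u) == merge f e.1).
have kf : facet_on C f k.
  split=> [u w uw|u w uf wf|u w uw ne]; rewrite /k.
  - by rewrite uw (hc u w) ?uw.
  - rewrite (hL u w) ?uf ?wf -?surjective_pairing //.
    by rewrite !mergeE /ends !eqxx ?orbT.
  have [xe|xe] := eqVneq (blk C u, blk C w) e.
    have E1 : blk C u = e.1 by rewrite -xe.
    have E2 : blk C w = e.2 by rewrite -xe.
    by rewrite (he u w) // E1 E2 eqxx (negbTE mab) addn0 addn1.
  have [xg|xg] := eqVneq (contract_edge e (blk C u, blk C w)) g; last first.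
    exact/ltn_double_bool/hS.
  have xL : (blk C u, blk C w) \in L by rewrite inE xe xg eqxx !andbT.
  case: (lift _ xL ne) => /= -> ->.
  by rewrite (hL u w xg) eqxx (negbTE mab) addn0 addn1.
have cf := facet_contractible hC fC kf.
have hCf := contract_nacyclic hC fC cf.
have efC : contract_edge f e \in (contract C f).2.
  by apply: contract_edge_in => //; rewrite eq_sym.
have hf u w : blk (contract C f) u = blk (contract C f) w -> h u = h w.
  rewrite !contract_blk // => /(merge_inj hC fC (blk_in hC u) (blk_in hC w)).
  case=> [E|[]]; first by apply: hc; rewrite E.
  have fm : merge e f.1 = g.1 /\ merge e f.2 = g.2 by rewrite -fg.
  case: fm => f1 f2; move=> /orP[]/eqP E1 /orP[]/eqP E2.
  - by apply: hc; rewrite E1 E2.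
  - by apply: hL; rewrite E1 E2 -fg.
  - by apply/esym/hL; rewrite E1 E2 -fg.
  - by apply: hc; rewrite E1 E2.
have hB' : facet_on (contract C f) (contract_edge f e) h.
  split=> [//|u w|u w].
    have [a aa] := part_ex hC aC; have [b bb] := part_ex hC bC.
    rewrite !contract_blk //= => Eu Ew.
    have -> : h u = h a by apply: hf; rewrite !contract_blk // Eu (blk_def hC aC aa).
    have -> : h w = h b by apply: hf; rewrite !contract_blk // Ew (blk_def hC bC bb).
    by apply: he; [exact: blk_def aa|exact: blk_def bb].
  case/(contract_arrP hC fC) => u' [w' [eu ew uw ne]].
  rewrite eu ew (hf _ _ eu) (hf _ _ ew) => ne'.
  have xe : (blk C u', blk C w') != e.
    by apply: contraNneq ne' => <-; rewrite !contract_blk.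
  apply: hS => //; apply/eqP => xg.
  have xL : (blk C u', blk C w') \in L by rewrite inE xe xg eqxx !andbT.
  case: (lift _ xL ne) => /= E1 E2; move: ne'.
  by rewrite !contract_blk // E1 E2 eqxx.
have cef := facet_contractible hCf efC hB'.
exists f; split=> //; first exact/eqP.
(* Both double contractions admit [h] as a strict height function, hence coincide. *)
apply: (strict_uniq hB (contract_nacyclic hCf efC cef) hfs).
exact: facet_strict hB'.
Qed.

(** Two distinct such arrows would form a triangle with [e] whose long side is [f] or [f']. The long
    side cannot be contractible: a height function in its open facet is constant along it but
    strictly decreases along the two short sides. *)
Lemma contractible_lift_uniq C e f f' : nacyclic A C -> contractible C e ->
  contractible C f -> contractible C f' -> f <> e -> f' <> e ->
  contract_edge e f = contract_edge e f' -> f = f'.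
Proof.
move=> hC ce cf cf' /eqP fe /eqP fe' ff'; apply/eqP/negPn/negP => ne.
have /andP[eC _] := ce; have /andP[fC _] := cf; have /andP[fC' _] := cf'.
have aC : e.1 \in C.1 by apply: (edge_l (W := e.2) hC); case: (e) eC.
have bC : e.2 \in C.1 by apply: (edge_r (U := e.1) hC); case: (e) eC.
have cC : f.1 \in C.1 by apply: (edge_l (W := f.2) hC); case: (f) fC.
have dC : f.2 \in C.1 by apply: (edge_r (U := f.1) hC); case: (f) fC.
have [[a Ea] [b Eb] [c Ec] [d Ed]] :=
  And4 (part_blk hC aC) (part_blk hC bC) (part_blk hC cC) (part_blk hC dC).
have [h [hc1 hc2 hc3]] := facet_ex hC cf.
have [k [kc1 kc2 kc3]] := facet_ex hC cf'.
have eP : e = (blk C a, blk C b) by rewrite -Ea -Eb -surjective_pairing.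
case: (lift_cases hC eC fC fC' ne fe fe' ff') => -[E E'].
- have fP : f = (blk C a, blk C d) by rewrite E Ea Ed.
  have fP' : f' = (blk C b, blk C d) by rewrite E' Eb Ed.
  have h1 : h a = h d by apply: hc2; rewrite fP.
  have h2 : h b < h a by apply: hc3; rewrite /arr -?eP // eq_sym.
  have h3 : h d < h b by apply: hc3; rewrite /arr -?fP' // eq_sym.
  by move: h2; rewrite h1 ltnNge ltnW.
- have fP : f = (blk C b, blk C d) by rewrite E Eb Ed.
  have fP' : f' = (blk C a, blk C d) by rewrite E' Ea Ed.
  have h1 : k a = k d by apply: kc2; rewrite fP'.
  have h2 : k b < k a by apply: kc3; rewrite /arr -?eP // eq_sym.
  have h3 : k d < k b by apply: kc3; rewrite /arr -?fP.
  by move: h2; rewrite h1 ltnNge ltnW.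
- have fP : f = (blk C c, blk C b) by rewrite E Ec Eb.
  have fP' : f' = (blk C c, blk C a) by rewrite E' Ec Ea.
  have h1 : h c = h b by apply: hc2; rewrite fP.
  have h2 : h b < h a by apply: hc3; rewrite /arr -?eP // eq_sym.
  have h3 : h a < h c by apply: hc3; rewrite /arr -?fP' // eq_sym.
  by move: h3; rewrite h1 ltnNge ltnW.
- have fP : f = (blk C c, blk C a) by rewrite E Ec Ea.
  have fP' : f' = (blk C c, blk C b) by rewrite E' Ec Eb.
  have h1 : k c = k b by apply: kc2; rewrite fP'.
  have h2 : k b < k a by apply: kc3; rewrite /arr -?eP // eq_sym.
  have h3 : k a < k c by apply: kc3; rewrite /arr -?fP.
  by move: h3; rewrite h1 ltnNge ltnW.
Qed.

(** * Arrows into the sink part and the choice of contractible arrows *)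

Lemma sink_edge C U : nacyclic A C -> (blk C ord_max, U) \notin C.2.
Proof. by move=> hC; apply/negP => /(sink_out hC); rewrite mem_blk. Qed.

Lemma atom_contractible C m : nacyclic A C -> m \in C.1 -> ord_max \notin m ->
  (forall W, (m, W) \in C.2 -> W = blk C ord_max) ->
  contractible C (m, blk C ord_max).
Proof.
move=> hC mC nm mout; set s := blk C ord_max.
have [W mW] := nonsink_out hC mC nm.
have {}mW : (m, s) \in C.2 by rewrite /s -(mout W mW).
(* Lower [m] to the level of the sink part, keep the ranks elsewhere; the successor places all other
   parts strictly above level 0. *)
pose h u := if (blk C u == m) || (blk C u == s) then 0 else (rank C.2 (blk C u)).+1.
apply: (facet_contractible (h := h) hC mW); split=> /=.
- by move=> u w E; rewrite /h E.
- by move=> u w Eu Ew; rewrite /h Eu Ew !eqxx orbT.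
move=> u w uw ne; rewrite /h.
have -> : (blk C u == m) = false.
  apply/eqP => um; move: ne; rewrite (mout (blk C w)); last by rewrite -um.
  by rewrite um eqxx.
have -> /= : (blk C u == s) = false.
  by apply: contraTF uw => /eqP E; rewrite /arr E sink_edge.
by case: ifP => // _; rewrite ltnS (rank_edge hC).
Qed.

(** Any other arrow leaving [m] would survive as an arrow leaving the merged sink part of C/e. *)
Lemma contractible_atom C m W : nacyclic A C ->
  contractible C (m, blk C ord_max) -> (m, W) \in C.2 -> W = blk C ord_max.
Proof.
move=> hC ce mW; have /andP[eC _] := ce.
apply/eqP/negPn/negP => ne; have hC' := contract_nacyclic hC eC ce.
have /(sink_out hC') : contract_edge (m, blk C ord_max) (m, W) \in
    (contract C (m, blk C ord_max)).2.
  by apply: contract_edge_in => //; apply: contraNneq ne => -[->].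
rewrite merge_ends /ends ?eqxx //=.
by rewrite inE mem_blk // orbT.
Qed.

(** An out-neighbour of highest rank is a suitable choice, because then [U] can be lowered to its
    level without passing any other out-neighbour. *)
Lemma contractible_out C U : nacyclic A C -> U \in C.1 -> ord_max \notin U ->
  exists W, contractible C (U, W).
Proof.
move=> hC UC nU; have [W0 UW0] := nonsink_out hC UC nU.
case: (@arg_maxnP _ W0 (fun W => (U, W) \in C.2) (rank C.2) UW0) => W UW Wmax.
exists W.
(* On doubled ranks the extra unit lifts the merged part above the other out-neighbours of [U]
   having the same rank as [W], yet keeps it below every part of rank larger than that of [W]. *)
pose h u := if (blk C u == U) || (blk C u == W) then (2 * rank C.2 W).+1
            else 2 * rank C.2 (blk C u).
apply: (facet_contractible (h := h) hC UW); split=> /=.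
- by move=> u w E; rewrite /h E.
- by move=> u w Eu Ew; rewrite /h Eu Ew !eqxx orbT.
have UWr := rank_edge hC UW.
have lt2 (i j : nat) : i < j -> (2 * i).+1 < 2 * j by clear; lia.
move=> u w uw ne; have uwr := rank_edge hC uw; rewrite /h.
have [uU|uU] := eqVneq (blk C u) U; rewrite /=.
  have wU : (blk C w == U) = false.
    by apply: contraTF (edge_neq hC uw) => /eqP ->; rewrite negbK uU.
  have wW : (blk C w == W) = false.
    by apply: contraNF ne => /eqP ->; rewrite uU.
  rewrite wU wW /= ltnS leq_mul2l /=; apply: Wmax.
  by move: uw; rewrite /arr uU.
have [uW|uW] := eqVneq (blk C u) W; rewrite /=.
  rewrite uW in uwr.
  have -> : (blk C w == U) = false.
    by apply/eqP => E; rewrite E ltnNge ltnW in uwr.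
  have -> : (blk C w == W) = false.
    by apply/eqP => E; rewrite E ltnn in uwr.
  by rewrite /= ltnS leq_mul2l /= ltnW.
case: ifP => [/orP[]/eqP E|_]; last by rewrite ltn_mul2l.
- by apply: lt2; apply: ltn_trans UWr _; rewrite -E.
- by apply: lt2; rewrite -E.
Qed.

(** The order inherited from [enum {set V}] orders the vertices of the simplex of C and so orients
    its cell. Contracting into the sink part just removes one entry ([parts_atom]), which keeps the
    orientations comparable. *)
Definition parts (C : pdigraph n) : seq {set V} :=
  [seq U <- enum {set V} | (U \in C.1) && (ord_max \notin U)].

Lemma mem_parts C U : (U \in parts C) = (U \in C.1) && (ord_max \notin U).
Proof. by rewrite mem_filter mem_enum andbT. Qed.

Lemma parts_uniq C : uniq (parts C).
Proof. exact/filter_uniq/enum_uniq. Qed.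

Lemma size_parts C : nacyclic A C -> size (parts C) = #|C.1|.-1.
Proof.
move=> hC; rewrite (cardsD1 (blk C ord_max)) blk_in //=.
rewrite cardE; apply/perm_size/uniq_perm; rewrite ?parts_uniq ?enum_uniq //.
move=> U; rewrite mem_parts mem_enum !inE andbC.
have [UC|] := boolP (U \in C.1); rewrite ?andbF // !andbT; congr (~~ _).
by apply/idP/eqP => [/(blk_def hC UC)//|->]; apply: mem_blk.
Qed.

(** A path that ends outside an absorbing set never enters it, so it uses arrows with target outside
    [S] exclusively. *)
Lemma absorbing_connect (E1 E2 : {set edge n}) (S : pred {set V}) U W :
  (forall X Y, (X, Y) \in E1 -> S X -> S Y) ->
  (forall X Y, (X, Y) \in E1 -> ~~ S Y -> (X, Y) \in E2) ->
  ~~ S W -> connect (erel E1) U W -> connect (erel E2) U W.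
Proof.
move=> abs sub nSW /connectP[p pP lW]; rewrite {W}lW in nSW *.
elim: p U pP nSW => [|X p IH] U /=; first by rewrite connect0.
case/andP=> UX pP nSW; apply: connect_trans (connect1 _) (IH X pP nSW).
apply: sub UX _; apply: contra nSW => SX.
elim: p X pP SX {IH} => //= Y p IH X /andP[XY pP] SX.
exact: IH pP (abs _ _ XY SX).
Qed.

Section AtomContraction.
Variables (C : pdigraph n) (m : {set V}).
Hypothesis hC : nacyclic A C.
Let e : edge n := (m, blk C ord_max).
Hypothesis ce : contractible C e.
Let eC : e \in C.2. Proof. by case/andP: ce. Qed.
Let hC' := contract_nacyclic hC eC ce.

Let nm : ord_max \notin m. Proof. exact: sink_out eC. Qed.

Let blk_sink : blk (contract C e) ord_max = m :|: blk C ord_max.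
Proof. by rewrite contract_blk // merge_ends // /ends eqxx orbT. Qed.

Let nends U : U \in C.1 -> ord_max \notin U -> U != m -> ~~ ends e U.
Proof.
move=> UC nU Um; rewrite /ends negb_or Um /=.
by apply: contraNneq nU => ->; apply: mem_blk.
Qed.

Lemma parts_atom : parts (contract C e) = [seq U <- parts C | U != m].
Proof.
rewrite -filter_predI; apply: eq_filter => U /=.
apply/andP/and3P => [[/imsetP[X XC ->]]|[Um UC nU]]; last first.
  by split=> //; rewrite -(merge_id (nends UC nU Um)) imset_f.
have [eX|neX] := boolP (ends e X).
  by rewrite merge_ends // inE mem_blk ?orbT.
by rewrite merge_id // => nX; split=> //; case/norP: neX.
Qed.

(** The two ends of the contracted arrow form an absorbing set of C, as does the merged sink part of
    C/e. Paths to the remaining parts avoid them, so the reachability order on these parts is just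
    restricted. *)
Lemma connect_atom U W : W \in parts (contract C e) ->
  connect (erel C.2) U W = connect (erel (contract C e).2) U W.
Proof.
rewrite parts_atom mem_filter mem_parts => /and3P[Wm WC nW].
have fwd X Y : (X, Y) \in C.2 -> ends e X -> Y = blk C ord_max.
  move=> XY /orP[]/eqP /= EX; first by apply: (contractible_atom hC ce); rewrite -EX.
  by have := sink_edge Y hC; rewrite -EX XY.
have keep X Y : (X, Y) \in C.2 -> ~~ ends e Y -> ~~ ends e X.
  by move=> XY; apply: contra => /(fwd _ _ XY) ->; rewrite /ends eqxx orbT.
apply/idP/idP.
  apply: (@absorbing_connect _ _ (ends e)); last exact: nends.
    by move=> X Y /fwd h /h ->; rewrite /ends eqxx orbT.
  move=> X Y XY neY; have neX := keep X Y XY neY.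
  have -> : (X, Y) = contract_edge e (X, Y) by rewrite /contract_edge /= !merge_id.
  apply: contract_edge_in => //; apply: contraNneq neX => E.
  by rewrite /ends -E eqxx.
pose s' := blk (contract C e) ord_max.
apply: (@absorbing_connect _ _ (pred1 s')) => /=.
- by move=> X Y XY /eqP EX; have := sink_edge Y hC'; rewrite -/s' -EX XY.
- move=> X Y /imsetP[[X0 Y0]]; rewrite !inE /= => /andP[ne XY] [-> ->] nY.
  have neY : ~~ ends e Y0.
    by apply: contra nY => eY; rewrite merge_ends // /s' blk_sink.
  by rewrite !merge_id // (keep X0 Y0).
by apply: contraNneq nW => ->; apply: mem_blk.
Qed.

End AtomContraction.

Lemma sink_nonatom C e : nacyclic A C -> contractible C e ->
  ord_max \notin e.2 -> blk (contract C e) ord_max = blk C ord_max.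
Proof.
move=> hC ce ne2; have /andP[eC _] := ce.
have ne1 : ord_max \notin e.1 by apply: (sink_out (W := e.2) hC); case: (e) eC.
rewrite contract_blk // merge_id //; apply/norP.
by split; [apply: contraNneq ne1|apply: contraNneq ne2] => <-; apply: mem_blk.
Qed.

Lemma edge_atomE C e : nacyclic A C -> e \in C.2 -> ord_max \in e.2 ->
  e = (e.1, blk C ord_max).
Proof.
case: e => U W hC eC /= nW; congr pair.
by rewrite (blk_def hC _ nW) // (edge_r hC eC).
Qed.

(** * Out-degrees read from height functions *)

Lemma outE C u : nacyclic A C -> out A C u = \sum_(w | arr C u w) A u w.
Proof.
move=> hC; rewrite /out.
rewrite [RHS](partition_big (fun w => (blk C u, blk C w))
  (fun f : edge n => (f \in C.2) && (u \in f.1))) /=; last first.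
  by move=> w uw; rewrite [_ \in _]uw mem_blk.
apply: eq_bigr => -[U W] /andP[/= UW uU]; apply: eq_bigl => w.
have eU := blk_def hC (edge_l hC UW) uU.
apply/idP/andP => [wW|[_ /eqP[_ <-]]]; last exact: mem_blk.
by rewrite /arr eU (blk_def hC (edge_r hC UW) wW) UW eqxx.
Qed.

(** This expresses the exponent of a label by a single interior point of the cell, so labels of
    different cells can be compared at a common point. *)
Lemma out_strict d (T : orderType d) C (f : V -> T) u : nacyclic A C ->
  strict_on C f -> out A C u = \sum_(w | (f w < f u)%O) A u w.
Proof.
move=> hC hf; rewrite outE // big_mkcond [RHS]big_mkcond; apply: eq_bigr => w _.
have [->|] := posnP (A u w); first by rewrite !if_same.
by move=> Auw; rewrite (strict_arr hC hf Auw).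
Qed.

Lemma out_contract C e u : nacyclic A C -> contractible C e -> u \notin e.1 ->
  out A C u <= out A (contract C e) u.
Proof.
move=> hC ce ue; have /andP[eC _] := ce; rewrite !outE ?contract_nacyclic //.
rewrite big_mkcond [leqRHS]big_mkcond; apply: leq_sum => w _.
case: ifP => // uw; rewrite ifT // /arr !contract_blk //.
apply: (@contract_edge_in _ e (_, _)) => //; apply: contraNneq ue => <-.
exact: mem_blk.
Qed.

(** * The n-acyclic partition cut out by a height function *)

Section LevelPartition.
Variables (d : Order.disp_t) (T : orderType d) (f : V -> T).

Definition descent : rel V := [rel x y | (0 < A x y) && (f y <= f x)%O].

Hypothesis f_desc : forall u, connect descent u ord_max.

Let lev : rel V := [rel x y | (0 < A x y) && (f x == f y)].
Let P := equivalence_partition (connect lev) [set: V].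
Let E := [set x : edge n | quotient_adj A P x.1 x.2 &&
            [exists u in x.1, exists w in x.2, (f w < f u)%O]].
Let C : pdigraph n := (P, E).

Let lev_sym : connect_sym lev.
Proof. by apply: sym_connect_sym => x y; rewrite /lev /= A_sym eq_sym. Qed.

Let lev_eqv : {in [set: V] & &, equivalence_rel (connect lev)}.
Proof.
move=> x y z _ _ _; split; first exact: connect0.
by move=> xy; apply/same_connect: x y xy z => //.
Qed.

Let mem_lev u w : (w \in blk C u) = connect lev u w.
Proof. by rewrite /blk pblock_equivalence_partition ?inE. Qed.

Let Ppart : partition P [set: V].
Proof. exact: equivalence_partitionP. Qed.

Let lev_val u w : connect lev u w -> f u = f w.
Proof.
case/connectP => p + ->; elim: p u => //= x p IH u /andP[/andP[_ /eqP ->]].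
exact: IH.
Qed.

Let inP u : blk C u \in P.
Proof. by apply: pblock_mem; rewrite (cover_partition Ppart) inE. Qed.

Let inB u : u \in blk C u.
Proof. by rewrite mem_lev. Qed.

Let defB U u : U \in P -> u \in U -> U = blk C u.
Proof. by move=> UP uU; apply/esym/def_pblock => //; case/and3P: Ppart. Qed.

Let val_part U u w : U \in P -> u \in U -> w \in U -> f u = f w.
Proof. by move=> UP uU; rewrite (defB UP uU) mem_lev => /lev_val. Qed.

Let adj_neq U W u w : U \in P -> W \in P -> U != W -> u \in U -> w \in W ->
  0 < A u w -> f u != f w.
Proof.
move=> UP WP + uU wW Auw; apply: contraNneq => fuw; apply/eqP.
rewrite (defB WP wW); apply: defB => //; rewrite (defB UP uU) mem_lev.
by apply: connect1; rewrite /lev /= Auw fuw eqxx.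
Qed.

Let edgeP U W u w : U \in P -> W \in P -> U != W -> u \in U -> w \in W ->
  0 < A u w -> ((U, W) \in E) = (f w < f u)%O.
Proof.
move=> UP WP UW uU wW Auw; rewrite inE /= /quotient_adj UP WP UW /=.
have -> /= : 0 < weight A U W by apply/weight_gt0; exists u, w.
apply/exists_inP/idP => [[u' u'U /exists_inP[w' w'W]]|].
  by rewrite (val_part UP u'U uU) (val_part WP w'W wW).
by move=> fwu; exists u => //; apply/exists_inP; exists w.
Qed.

Let edge_val U W u w : (U, W) \in E -> u \in U -> w \in W -> (f w < f u)%O.
Proof.
rewrite inE => /andP[/and4P[/= UP WP _ _]] /exists_inP[u' u'U /exists_inP[w' w'W]].
by move=> h uU wW; rewrite (val_part UP uU u'U) (val_part WP wW w'W).
Qed.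

Let quotient_sym U W : quotient_adj A P U W -> quotient_adj A P W U.
Proof.
case/and4P => UP WP UW /weight_gt0[u [w [uU wW Auw]]]; apply/and4P; split=> //.
  by rewrite eq_sym.
by apply/weight_gt0; exists w, u; rewrite A_sym.
Qed.

(** The parts are the connected components of the level sets, and arrows point downhill. A
    descending path from a part U to the last vertex supplies, where it first leaves U, an arrow
    leaving U; so no part without the last vertex is a sink. The part of the last vertex is one,
    because [f] is smallest there. *)
Lemma level_nacyclic : nacyclic A C.
Proof.
apply/andP; split; last first.
  apply/forall_inP => U UP; apply/eqP; apply/idP/idP => [sU|nU]; last first.
    apply/forall_inP => -[U' W] UW /=; apply/eqP => eU; subst U'.
    have /and4P[_ WP _ /weight_gt0[u [w [uU wW _]]]] : quotient_adj A P U W.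
      by move: UW; rewrite inE => /andP[].
    have := edge_val UW nU wW; case/connectP: (f_desc w) => p.
    have mono x : path descent x p -> (f (last x p) <= f x)%O.
      elim: p x => //= y p IH x /andP[/andP[_ h] /IH h2]; exact: le_trans h2 h.
    by move/mono => h ->; rewrite ltNge h.
  have [u uU] : exists u, u \in U.
    apply/set0Pn/negP => /eqP U0; case/and3P: Ppart => _ _.
    by rewrite -U0 UP.
  apply/negPn/negP => nU; case/connectP: (f_desc u) => p.
  elim: p u uU => [|x p IH] u uU /=; first by move=> _ e; rewrite e uU in nU.
  case/andP=> /andP[Aux fxu] pP lP; have [xU|xU] := boolP (x \in U).
    exact: IH xU pP lP.
  have ne : U != blk C x by apply: contraNneq xU => ->.
  have : (U, blk C x) \in E.
    rewrite (edgeP (u := u) (w := x)) // lt_neqAle fxu eq_sym andbT.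
    exact: (adj_neq UP (inP x)).
  by move/(forall_inP sU); rewrite eqxx.
apply/and3P; split.
- rewrite /connected_partition Ppart; apply/forall_inP => U UP.
  apply/forall_inP => u uU; apply/forall_inP => w.
  rewrite {1}(defB UP uU) mem_lev => /connectP[p + ->].
  elim: p u uU => [|x p IH] u uU /=; first by rewrite connect0.
  case/andP=> ux; have xU : x \in U.
    by rewrite (defB UP uU) mem_lev connect1.
  move=> /(IH _ xU); apply: connect_trans; apply: connect1.
  by case/andP: ux => /= -> _; rewrite uU xU.
- apply/forallP => U; apply/forallP => W; apply/andP; split; last first.
    apply/negP => /andP[UW WU]; have /and4P[UP WP _ _] : quotient_adj A P U W.
      by move: UW; rewrite inE => /andP[].
    have ex X : X \in P -> exists u, u \in X.
      move=> XP; apply/set0Pn/negP => /eqP X0; case/and3P: Ppart => _ _.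
      by rewrite -X0 XP.
    have [[u uU] [w wW]] := (ex U UP, ex W WP).
    have := edge_val UW uU wW; rewrite ltNge => /negP; apply.
    exact/ltW/(edge_val WU).
  apply/eqP; apply/idP/idP => [/orP[]|].
  + by rewrite inE => /andP[].
  + by rewrite inE => /andP[/quotient_sym].
  case/and4P => UP WP UW /weight_gt0[u [w [uU wW Auw]]].
  have WU : W != U by rewrite eq_sym.
  have Awu : 0 < A w u by rewrite A_sym.
  rewrite (edgeP UP WP UW uU wW Auw) (edgeP WP UP WU wW uU Awu).
  by rewrite orbC -neq_lt (adj_neq UP WP UW uU wW Auw).
- apply: (@acyclic_potential _ T _ (fun U => f (odflt ord0 [pick u in U]))).
  move=> [U W] UW /=; have /and4P[_ _ _ /weight_gt0[u [w [uU wW _]]]] :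
    quotient_adj A P U W by move: UW; rewrite inE => /andP[].
  case: pickP => [x xW|/(_ w)]; last by rewrite wW.
  case: pickP => [y yU|/(_ u)]; last by rewrite uU.
  exact: edge_val UW yU xW.
Qed.

Lemma level_strict : strict_on C f.
Proof.
split=> u w uw; last exact: edge_val uw (inB u) (inB w).
by apply: lev_val; rewrite -mem_lev uw.
Qed.

End LevelPartition.

Lemma strict_ex d (T : orderType d) (f : V -> T) :
  (forall u, connect (descent f) u ord_max) ->
  exists C, nacyclic A C /\ strict_on C f.
Proof. by move=> fd; eexists; split; [exact: level_nacyclic fd|exact: level_strict]. Qed.

(** * Closed cones: weakly descending height functions *)

Definition weak_on d (T : orderType d) (C : pdigraph n) (f : V -> T) :=
  (forall u w, blk C u = blk C w -> f u = f w) /\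
  (forall u w, arr C u w -> (f w <= f u)%O).

Lemma strict_weak d (T : orderType d) C (f : V -> T) :
  strict_on C f -> weak_on C f.
Proof. by case=> fc fs; split=> // u w /fs/ltW. Qed.

(** Inside a part, follow edges of the graph at constant height; between parts, follow arrows
    towards the sink part. *)
Lemma weak_descent d (T : orderType d) C (f : V -> T) u : nacyclic A C ->
  weak_on C f -> connect (descent f) u ord_max.
Proof.
move=> hC [fc fw].
have inside x y : blk C x = blk C y -> connect (descent f) x y.
  move=> xy; have yx : y \in blk C x by rewrite xy mem_blk.
  have /forall_inP/(_ x (mem_blk hC x))/forall_inP/(_ y yx) :=
    nac_connected hC (blk_in hC x).
  apply: connect_sub => a b /= /and3P[ax bx Aab]; apply: connect1.
  rewrite /descent /= Aab /= (fc b a) //; move: ax bx; rewrite -!blk_eq // => /eqP <-.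
  by move/eqP.
have cross U W : connect (erel C.2) U W -> forall x y, U = blk C x ->
    W = blk C y -> connect (descent f) x y.
  case/connectP => p + ->; elim: p U => [|X p IH] U /=.
    by move=> _ x y -> /inside.
  case/andP=> UX pP x y Ux lP; have [a [b [Ua Xb Aab ab]]] := arrP hC UX.
  apply: connect_trans (inside x a _) _; first by rewrite -Ux.
  apply: connect_trans (connect1 _) (IH X pP b y Xb lP).
  by rewrite /descent /= Aab fw.
exact: (cross _ _ (reach_sink hC (blk_in hC u))).
Qed.

(** Parts of C' are unions of parts of C. If their numbers agree, nothing is merged, so no arrow of
    C can be an equality for [f]. This is what places the boundary of a cell in a lower skeleton. *)
Lemma weak_card d (T : orderType d) C C' (f : V -> T) :
  nacyclic A C -> nacyclic A C' -> weak_on C f -> strict_on C' f ->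
  #|C'.1| <= #|C.1| /\ (#|C'.1| = #|C.1| -> strict_on C f).
Proof.
move=> hC hC' [fc fw] fC'.
pose g (U : {set V}) := blk C' (odflt ord0 [pick u in U]).
have sub u := strict_blk_sub u hC hC' fc fC'.
have gE u : g (blk C u) = blk C' u.
  rewrite /g; case: pickP => [x xu|/(_ u)]; last by rewrite mem_blk.
  by apply/esym/eqP; rewrite blk_eq // (subsetP (sub u)).
have im : C'.1 = g @: C.1.
  apply/setP => X; apply/idP/imsetP => [/(part_blk hC')[u ->]|[U UC ->]].
    by exists (blk C u); rewrite ?blk_in ?gE.
  by rewrite blk_in.
split; first by rewrite im leq_imset_card.
move=> eC; have inj : {in C.1 &, injective g}.
  by apply/imset_injP; rewrite -im eC.
split=> // u w uw; rewrite lt_neqAle fw // andbT.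
case: fC' => _ fs'.
have [x [y [ux wy Axy xy]]] := arrP hC uw.
apply/eqP => fwu; have fxy : f x = f y.
  by rewrite -(fc _ _ ux) -(fc _ _ wy).
have /eqP/(inj _ _ (blk_in hC x) (blk_in hC y)) E : g (blk C x) == g (blk C y).
  rewrite !gE; apply/negPn/negP => /(arr_total hC' Axy)/orP[]/fs';
    by rewrite fxy ltxx.
by have := edge_neq hC xy; rewrite E eqxx.
Qed.

Lemma sink_min d (T : orderType d) C (f : V -> T) u : nacyclic A C ->
  weak_on C f -> (f ord_max <= f u)%O.
Proof.
move=> hC hf; case/connectP: (weak_descent u hC hf) => p + ->.
elim: p u => //= x p IH u /andP[/andP[_ h] /IH h2]; exact: le_trans h2 h.
Qed.

Definition one_part : pdigraph n := ([set [set: V]], set0).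

(** This is the level partition of a constant function; connectedness of the graph is the descent
    condition for it. *)
Lemma one_part_nacyclic : connected_graph A -> nacyclic A one_part.
Proof.
move=> conn; have fd u : connect (descent (fun=> 0%N)) u ord_max.
  have /forall_inP/(_ u (in_setT u))/forall_inP/(_ ord_max (in_setT _)) := conn.
  apply: connect_sub => x y /= /and3P[_ _ Axy].
  by apply: connect1; rewrite /descent /= Axy.
have [C [hC fC]] := strict_ex fd; suff -> : one_part = C by [].
have noE : C.2 = set0.
  apply/setP => -[U W]; rewrite inE; apply/negP => UW.
  by have [u [w [_ _ _ /(proj2 fC)]]] := arrP hC UW; rewrite ltxx.
rewrite /one_part (surjective_pairing C) noE; congr pair.
have all1 U : U \in C.1 -> U = blk C ord_max.
  move=> UC; apply/esym/(blk_def hC UC)/negPn/negP => nU.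
  by have [W] := nonsink_out hC UC nU; rewrite noE inE.
apply/setP => U; rewrite inE; apply/eqP/idP => [->|UC]; last first.
  by apply/setP => u; rewrite inE (all1 U UC) -(all1 _ (blk_in hC u)) mem_blk.
suff -> : [set: V] = blk C ord_max by apply: blk_in.
by apply/setP => u; rewrite inE -(all1 _ (blk_in hC u)) mem_blk.
Qed.

Lemma one_part_uniq C : connected_graph A -> nacyclic A C -> #|C.1| = 1 ->
  C = one_part.
Proof.
move=> conn hC /eqP/cards1P[U0 C0].
apply: (@strict_uniq _ nat _ _ (fun=> 0) hC (one_part_nacyclic conn)); split=> //.
  move=> u w; have := blk_in hC u; have := blk_in hC w; rewrite C0 !inE.
  by move=> /eqP ew /eqP eu /(edge_neq hC); rewrite ew eu eqxx.
by move=> u w; rewrite /arr inE.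
Qed.

End Combinatorics.

(** * Chains of finite sequences *)

Section Chains.
Import freeg.
Local Open Scope ring_scope.

Section Linear.
Variables (K : choiceType) (M : lmodType int) (f : K -> M).

Lemma fglift_is_linear : linear (fglift f).
Proof.
have fD : {morph fglift f : u v / u + v}.
  move=> u v; have fB := lift_is_additive f.
  have f0 : fglift f 0 = 0 by rewrite -(subrr 0) fB subrr.
  by rewrite -{1}[v]opprK fB -[- v in LHS]add0r fB f0 sub0r opprK.
have f0 : fglift f 0 = 0 by apply: (addIr (fglift f 0)); rewrite -fD !add0r.
move=> a u v; rewrite fD; congr (_ + _).
have fS (r : seq K) (k : K -> int) :
    fglift f (\sum_(x <- r) << k x *g x >>) = \sum_(x <- r) k x *: f x.
  elim: r => [|x r IH]; first by rewrite !big_nil.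
  by rewrite !big_cons fD IH liftU.
have -> : a *: u = \sum_(x <- dom u) << (a * coeff x u) *g x >> by [].
rewrite -{3}[u]freeg_sumE !fS scaler_sumr.
by apply: eq_bigr => x _; rewrite scalerA.
Qed.

End Linear.
HB.instance Definition _ (K : choiceType) (M : lmodType int) (f : K -> M) :=
  GRing.isLinear.Build int {freeg K / int} M *:%R (fglift f)
    (fglift_is_linear f).
End Chains.

Section ChainTheory.
Import freeg.
Local Open Scope ring_scope.

Lemma gen_scale (K : choiceType) (k : int) (x : K) :
  << k *g x >> = k *: << x >> :> {freeg K / int}.
Proof. by apply/eqP/freeg_eqP => z; rewrite coeffZ !coeffU mul1r. Qed.

(** Induction on a formal sum with generators taken from its support, so that properties of the
    support remain available. *)
Lemma chain_ind_dom (K : choiceType) (Q : {freeg K / int} -> Prop) c :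
  Q 0 -> (forall u v, Q u -> Q v -> Q (u + v)) ->
  (forall (k : int) x, x \in dom c -> Q (k *: << x >>)) -> Q c.
Proof.
move=> Q0 QD Qx; rewrite -[c]freeg_sumE big_seq.
by apply: (big_ind Q) => // x xc; rewrite gen_scale; apply: Qx.
Qed.

Section FgliftLinear.
Variables (K : choiceType) (M : lmodType int) (f : K -> M).

Lemma fglift0 : fglift f 0 = 0. Proof. exact: linear0. Qed.
Lemma fgliftD u v : fglift f (u + v) = fglift f u + fglift f v.
Proof. exact: linearD. Qed.
Lemma fgliftN u : fglift f (- u) = - fglift f u. Proof. exact: linearN. Qed.
Lemma fgliftB u v : fglift f (u - v) = fglift f u - fglift f v.
Proof. exact: linearB. Qed.
Lemma fgliftZ k u : fglift f (k *: u) = k *: fglift f u.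
Proof. exact: linearZ. Qed.

End FgliftLinear.

Lemma fglift_gen (K : choiceType) (M : lmodType int) (f : K -> M) x :
  fglift f << x >> = f x.
Proof. by rewrite liftU scale1r. Qed.

Lemma fglift_eq (K : choiceType) (M : lmodType int) (f g : K -> M) c :
  {in dom c, f =1 g} -> fglift f c = fglift g c.
Proof.
move=> fg; apply: (@chain_ind_dom _ (fun c => fglift f c = fglift g c)).
- by rewrite ?fglift0 ?linear0.
- by move=> u v; rewrite ?fgliftD ?linearD => -> ->.
- by move=> k x /fg xc; rewrite ?fgliftZ ?linearZ /= !fglift_gen xc.
Qed.

Lemma fglift_eq0 (K : choiceType) (M : lmodType int) (f : K -> M) c :
  {in dom c, forall x, f x = 0} -> fglift f c = 0.
Proof.
move=> f0; apply: (@chain_ind_dom _ (fun c => fglift f c = 0)).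
- exact: fglift0.
- by move=> u v; rewrite fgliftD => -> ->; rewrite addr0.
- by move=> k x /f0 xc; rewrite fgliftZ fglift_gen xc scaler0.
Qed.

Lemma fglift_comp (K : choiceType) (M N : lmodType int) (f : K -> M)
    (g : {linear M -> N}) c :
  g (fglift f c) = fglift (g \o f) c.
Proof.
apply: (@chain_ind_dom _ (fun c => g (fglift f c) = fglift (g \o f) c)).
- by rewrite ?fglift0 ?linear0.
- by move=> u v; rewrite ?fgliftD ?linearD => -> ->.
- by move=> k x _; rewrite ?fgliftZ ?linearZ /= !fglift_gen.
Qed.

Lemma fglift_sub (K : choiceType) (M : lmodType int) (f g : K -> M) c :
  fglift (fun x => f x - g x) c = fglift f c - fglift g c.
Proof.
apply: (@chain_ind_dom _
  (fun c => fglift (fun x => f x - g x) c = fglift f c - fglift g c)).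
- by rewrite !fglift0 subr0.
- by move=> u v; rewrite !fgliftD => -> ->; rewrite opprD addrACA.
- by move=> k x _; rewrite !fgliftZ !fglift_gen scalerBr.
Qed.

(** Has the shape of [chain_in] for an arbitrary property of generators; the two are convertible in
    the realization. *)
Definition supp (K : choiceType) (Q : K -> Prop) (c : {freeg K / int}) :=
  forall x, x \in dom c -> Q x.

Section Supp.
Variables (K : choiceType) (Q : K -> Prop).

Lemma supp0 : supp Q 0. Proof. by move=> x; rewrite dom0. Qed.

Lemma supp_gen x : Q x -> supp Q << x >>.
Proof. by move=> Qx y; rewrite domU1 inE => /eqP ->. Qed.

Lemma suppD u v : supp Q u -> supp Q v -> supp Q (u + v).
Proof.
by move=> Qu Qv x /domD_subset; rewrite mem_cat => /orP[/Qu|/Qv].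
Qed.

Lemma suppZ k u : supp Q u -> supp Q (k *: u).
Proof. by move=> Qu x /domZ_subset/Qu. Qed.

Lemma suppN u : supp Q u -> supp Q (- u).
Proof. by move=> Qu; rewrite -scaleN1r; apply: suppZ. Qed.

Lemma suppB u v : supp Q u -> supp Q v -> supp Q (u - v).
Proof. by move=> Qu Qv; apply/suppD/suppN. Qed.

Lemma supp_sum (I : Type) (r : seq I) (P : pred I) (F : I -> {freeg K / int}) :
  (forall i, P i -> supp Q (F i)) -> supp Q (\sum_(i <- r | P i) F i).
Proof. by move=> h; apply: (big_ind (supp Q)) => //; [exact: supp0|exact: suppD]. Qed.

Lemma supp_fglift (K' : choiceType) (f : K' -> {freeg K / int}) c :
  supp (fun x => supp Q (f x)) c -> supp Q (fglift f c).
Proof.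
move=> h; apply: (@chain_ind_dom _ (fun c => supp Q (fglift f c))).
- by rewrite fglift0; apply: supp0.
- by move=> u v Qu Qv; rewrite fgliftD; apply: suppD.
- by move=> k x /h Qx; rewrite fgliftZ fglift_gen; apply: suppZ.
Qed.

End Supp.

Lemma supp_impl (K : choiceType) (Q Q' : K -> Prop) c :
  (forall x, Q x -> Q' x) -> supp Q c -> supp Q' c.
Proof. by move=> h Qc x /Qc/h. Qed.

Section SeqChains.
Variable K : choiceType.
Implicit Types (x : K) (s : seq K) (p q : pred K) (c : {freeg (seq K) / int}).

Definition cone x : {freeg (seq K) / int} -> {freeg (seq K) / int} :=
  fglift (fun s => << x :: s >>).
HB.instance Definition _ x := GRing.Linear.on (cone x).

(* The part of the simplicial boundary that deletes entries satisfying p. *)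
Fixpoint del p s : {freeg (seq K) / int} :=
  if s is x :: s' then (p x)%:Z *: << s' >> - cone x (del p s') else 0.

Definition bd p : {freeg (seq K) / int} -> {freeg (seq K) / int} :=
  fglift (del p).
HB.instance Definition _ p := GRing.Linear.on (bd p).

Lemma cone0 x : cone x 0 = 0. Proof. exact: fglift0. Qed.
Lemma coneD x u v : cone x (u + v) = cone x u + cone x v.
Proof. exact: fgliftD. Qed.
Lemma coneN x u : cone x (- u) = - cone x u. Proof. exact: fgliftN. Qed.
Lemma coneB x u v : cone x (u - v) = cone x u - cone x v.
Proof. exact: fgliftB. Qed.
Lemma coneZ x k u : cone x (k *: u) = k *: cone x u. Proof. exact: fgliftZ. Qed.
Lemma bd0 p : bd p 0 = 0. Proof. exact: fglift0. Qed.
Lemma bdD p u v : bd p (u + v) = bd p u + bd p v. Proof. exact: fgliftD. Qed.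
Lemma bdN p u : bd p (- u) = - bd p u. Proof. exact: fgliftN. Qed.
Lemma bdB p u v : bd p (u - v) = bd p u - bd p v. Proof. exact: fgliftB. Qed.
Lemma bdZ p k u : bd p (k *: u) = k *: bd p u. Proof. exact: fgliftZ. Qed.

Let chainE := (cone0, bd0, coneD, bdD, coneN, bdN, coneB, bdB, coneZ, bdZ).

Lemma cone_gen x s : cone x << s >> = << x :: s >>.
Proof. exact: fglift_gen. Qed.

Lemma bd_gen p s : bd p << s >> = del p s.
Proof. exact: fglift_gen. Qed.

Lemma bd_cone p x c : bd p (cone x c) = (p x)%:Z *: c - cone x (bd p c).
Proof.
apply: (@chain_ind_dom _
  (fun c => bd p (cone x c) = (p x)%:Z *: c - cone x (bd p c))).
- by rewrite !chainE scaler0 subr0.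
- by move=> u v; rewrite !chainE => -> ->; rewrite scalerDr opprD addrACA.
- move=> k s _; rewrite !chainE cone_gen !bd_gen /= scalerBr.
  by rewrite scalerA mulrC -scalerA.
Qed.

(** Deleting two entries in the two possible orders shifts one position by one, whence the sign.
    With [bd_bd] and [bd_split], the boundary becomes the total differential of a double complex
    once the entries are split by a predicate. *)
Lemma bd_anti p q c : bd p (bd q c) + bd q (bd p c) = 0.
Proof.
apply: (@chain_ind_dom _ (fun c => bd p (bd q c) + bd q (bd p c) = 0)).
- by rewrite !chainE addr0.
- by move=> u v hu hv; rewrite !chainE addrACA hu hv addr0.
move=> k s _; rewrite !chainE -scalerDr !bd_gen.
rewrite (_ : _ + _ = 0) ?scaler0 //; elim: s => [|x s IH] /=.
  by rewrite !chainE addr0.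
rewrite !chainE !bd_cone !bd_gen.
have -> : (q x)%:Z *: del p s - ((p x)%:Z *: del q s - cone x (bd p (del q s))) +
    ((p x)%:Z *: del q s - ((q x)%:Z *: del p s - cone x (bd q (del p s)))) =
    cone x (bd p (del q s)) + cone x (bd q (del p s)).
  rewrite !opprB; set a := _ *: del p s; set b := _ *: del q s.
  by rewrite addrACA [X in _ + X]addrACA -opprD [b + a]addrC addrCA subrr addr0.
by rewrite -coneD IH cone0.
Qed.

Lemma bd_bd p c : bd p (bd p c) = 0.
Proof.
apply: (@chain_ind_dom _ (fun c => bd p (bd p c) = 0)).
- by rewrite !chainE.
- by move=> u v hu hv; rewrite !chainE hu hv addr0.
move=> k s _; rewrite !chainE !bd_gen (_ : bd _ _ = 0) ?scaler0 //.
elim: s => [|x s IH] /=; first by rewrite bd0.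
by rewrite bdB bdZ bd_cone !bd_gen IH cone0 subr0 subrr.
Qed.

Lemma bd_split p c : bd p c + bd (predC p) c = bd predT c.
Proof.
apply: (@chain_ind_dom _ (fun c => bd p c + bd (predC p) c = bd predT c)).
- by rewrite !chainE addr0.
- by move=> u v; rewrite !chainE => <- <-; rewrite addrACA.
move=> k s _; rewrite !chainE -scalerDr !bd_gen; congr (_ *: _).
elim: s => [|x s IH] /=; first by rewrite addr0.
rewrite -IH coneD addrACA -opprD -scalerDl; congr (_ *: _ - _).
by case: (p x).
Qed.

Lemma del_eq p q s : {in s, p =1 q} -> del p s = del q s.
Proof.
elim: s => //= x s IH pq; rewrite pq ?mem_head // IH // => y ys.
by apply: pq; rewrite inE ys orbT.
Qed.

Lemma supp_cone Q Q' x c :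
  (forall s, Q s -> Q' (x :: s)) -> supp Q c -> supp Q' (cone x c).
Proof. by move=> h Qc; apply: supp_fglift => s /Qc/h; apply: supp_gen. Qed.

Lemma supp_del p s : supp (fun s' => exists s1 x s2,
  [/\ p x, s = s1 ++ x :: s2 & s' = s1 ++ s2]) (del p s).
Proof.
elim: s => [|x s IH]; first exact: supp0.
apply: suppB.
  case: (boolP (p x)) => px; last by rewrite scale0r; apply: supp0.
  by apply: suppZ; apply: supp_gen; exists [::], x, s.
apply: supp_cone IH => s' [s1 [y [s2 [py -> ->]]]].
by exists (x :: s1), y, s2.
Qed.

Lemma supp_del_size p s : supp (fun s' => size s = (size s').+1) (del p s).
Proof.
apply: (supp_impl _ (@supp_del p s)) => _ [s1 [x [s2 [_ -> ->]]]].
by rewrite !size_cat /= addnS.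
Qed.

Lemma supp_del_sub p s : supp (fun s' => {subset s' <= s}) (del p s).
Proof.
apply: (supp_impl _ (@supp_del p s)) => _ [s1 [x [s2 [_ -> ->]]]] y.
by rewrite !mem_cat inE => /orP[]->; rewrite ?orbT.
Qed.

Lemma del_uniq p s : uniq s ->
  del p s = \sum_(x <- s | p x) (-1) ^+ index x s *: << [seq y <- s | y != x] >>.
Proof.
elim: s => [|x s IH] /=; first by rewrite big_nil.
case/andP => xs us; rewrite big_cons eqxx /= IH // linear_sum /= -sumrN.
have -> : [seq y <- s | y != x] = s.
  by apply/all_filterP/allP => y ys; apply: contraNneq xs => <-.
rewrite [X in _ + X]big_seq_cond [X in _ = if _ then _ + X else X]big_seq_cond.
have -> : \sum_(y <- s | (y \in s) && p y)
      (-1) ^+ (if x == y then 0 else (index y s).+1)%N *: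
        << if x != y then x :: [seq z <- s | z != y] else [seq z <- s | z != y] >> =
    \sum_(y <- s | (y \in s) && p y)
      - cone x ((-1) ^+ index y s *: << [seq z <- s | z != y] >>).
  apply: eq_bigr => y /andP[ys _].
  have -> /= : (x == y) = false by apply: contraNF xs => /eqP ->.
  by rewrite coneZ cone_gen exprS mulN1r scaleNr.
by case: (p x); rewrite ?scale1r ?scale0r ?add0r.
Qed.

Lemma del_predT s : del predT s =
  \sum_(i < size s) (-1) ^+ i *: << take i s ++ drop i.+1 s >>.
Proof.
elim: s => [|x s IH] /=; first by rewrite big_ord0.
rewrite big_ord_recl /= drop0; congr (_ + _).
rewrite IH linear_sum /= -sumrN; apply: eq_bigr => i _.
by rewrite coneZ cone_gen /bump /= add1n exprS mulN1r scaleNr.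
Qed.

End SeqChains.

Definition chain_map (K K' : choiceType) (f : K -> K') :
  {freeg (seq K) / int} -> {freeg (seq K') / int} := fglift (fun s => << map f s >>).

HB.instance Definition _ (K K' : choiceType) (f : K -> K') :=
  GRing.Linear.on (chain_map f).

Lemma map_cone (K K' : choiceType) (f : K -> K') x c :
  chain_map f (cone x c) = cone (f x) (chain_map f c).
Proof.
apply: (@chain_ind_dom _
  (fun c => chain_map f (cone x c) = cone (f x) (chain_map f c))).
- by rewrite cone0 /chain_map !fglift0 cone0.
- by move=> u v; rewrite /chain_map !(coneD, fgliftD) => -> ->.
- by move=> k s _; rewrite /chain_map !(coneZ, fgliftZ, cone_gen, fglift_gen).
Qed.

Lemma map_del (K K' : choiceType) (f : K -> K') (s : seq K) :
  chain_map f (del predT s) = del predT (map f s).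
Proof.
elim: s => [|x s IH] /=; first by rewrite /chain_map fglift0.
by rewrite -IH -map_cone /chain_map fgliftB fgliftZ fglift_gen.
Qed.

(** * The simplex of a poset, its subdivision into flags, and the homotopy between them *)

Section PosetChains.
Variables (K K' : choiceType) (r : rel K) (key : seq K -> K').
Implicit Types (x y : K) (l : seq K).

(** The relation [r x y] is read as: x lies above y. *)
Definition minimal l : pred K := fun x => ~~ has (r x) l.

(* The ordered linear extensions of l, each read as the flag of keys of its
   successive filters; signs come from the positions of the deleted entries. *)
Fixpoint flags_rec m l : {freeg (seq K') / int} :=
  if m is m'.+1 then cone (key l) (fglift (flags_rec m') (del (minimal l) l))
  else << [::] >>.

Definition flags l := flags_rec (size l) l.

Lemma flags_nil : flags [::] = << [::] >>. Proof. by []. Qed.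

Lemma flagsE l : l != [::] ->
  flags l = cone (key l) (fglift flags (del (minimal l) l)).
Proof.
rewrite /flags; case: l => // x l _; rewrite [size _]/=.
congr (cone _ _); apply: fglift_eq => s /supp_del_size /= [sz].
by rewrite sz.
Qed.

Lemma supp_flags (Q : seq K -> seq K' -> Prop) :
  Q [::] [::] ->
  (forall l s1 x s2 s, l = s1 ++ x :: s2 -> minimal l x -> Q (s1 ++ s2) s ->
     Q l (key l :: s)) ->
  forall l, supp (Q l) (flags l).
Proof.
move=> Q0 Qc l; have [m] := ubnP (size l); elim: m l => // m IH l /ltnSE sl.
have [->|l0] := eqVneq l [::]; first by rewrite flags_nil; apply: supp_gen.
rewrite flagsE //.
apply: (@supp_cone _ (fun s => exists s1 x s2,
  [/\ minimal l x, l = s1 ++ x :: s2 & Q (s1 ++ s2) s])).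
  by move=> s [s1 [x [s2 [mx El Qs]]]]; apply: Qc El mx Qs.
apply: supp_fglift => l' l'l; have sz := supp_del_size l'l.
have [s1 [x [s2 [mx El El']]]] := supp_del l'l.
apply: (supp_impl _ (IH l' _)); last by rewrite -ltnS -sz.
by move=> s Qs; exists s1, x, s2; rewrite -El'.
Qed.

Hypothesis r_irr : irreflexive r.
Hypothesis r_trans : transitive r.
Hypothesis key_del : forall s1 x s2, ~~ minimal (s1 ++ x :: s2) x ->
  key (s1 ++ s2) = key (s1 ++ x :: s2).

Lemma minimal_del s1 x s2 : ~~ minimal (s1 ++ x :: s2) x ->
  minimal (s1 ++ s2) =1 minimal (s1 ++ x :: s2).
Proof.
rewrite negbK => /hasP[t tl xt] y; congr (~~ _).
have tx : t != x by apply: contraTneq xt => ->; rewrite r_irr.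
have tl' : t \in s1 ++ s2 by move: tl; rewrite !mem_cat inE (negbTE tx).
apply/hasP/hasP => -[z zl yz].
  by exists z => //; move: zl; rewrite !mem_cat inE => /orP[]->; rewrite ?orbT.
have [E|zx] := eqVneq z x; last first.
  by exists z => //; move: zl; rewrite !mem_cat inE (negbTE zx).
by exists t => //; apply: r_trans xt; rewrite -E.
Qed.

(** The subdivision is a chain map. Write p for minimality in [l]. The base of the cone accounts for
    the deletion of minimal entries. For the side, [bd_anti] and [bd_bd] turn the boundary of the
    p-deletions into minus the p-deletions of the non-p-deletions. Deleting a nonminimal entry
    changes neither the key nor the minimal entries, so the cones over these terms are again the
    flags of the shortened lists. *)
Lemma bd_flags l : bd predT (flags l) = fglift flags (del predT l).
Proof.
have [m] := ubnP (size l); elim: m l => // m IH l /ltnSE sl.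
have [->|l0] := eqVneq l [::].
  by rewrite flags_nil bd_gen /= fglift0.
set p := minimal l.
rewrite flagsE // -/p bd_cone scale1r (fglift_comp flags (bd predT)).
have -> : fglift (bd predT \o flags) (del p l) =
    fglift flags (bd predT (del p l)).
  rewrite (fglift_comp (del predT) (fglift flags)); apply: fglift_eq => l' l'l.
  by apply: IH; rewrite -ltnS -(supp_del_size l'l) in sl *.
have -> : bd predT (del p l) = - bd p (del (predC p) l).
  have := bd_anti p (predC p) << l >>; have := bd_bd p << l >>.
  rewrite -(bd_split p) !bd_gen => ->; rewrite add0r => h.
  by apply/eqP; rewrite -addr_eq0 addrC h.
rewrite fgliftN coneN opprK -bd_gen -[del predT l]bd_gen -(bd_split p) fgliftD.
rewrite !bd_gen; congr (_ + _).
have -> : fglift flags (del (predC p) l) =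
    fglift (fun l' => cone (key l) (fglift flags (del p l'))) (del (predC p) l).
  apply: fglift_eq => l' /supp_del[s1 [x [s2 [px El El']]]].
  have px' : ~~ minimal (s1 ++ x :: s2) x by rewrite -El.
  rewrite flagsE.
    rewrite El' El (key_del px'); congr (cone _ (fglift _ _)).
    by apply: del_eq => y _; rewrite /p El -(minimal_del px').
  (* A nonminimal entry lies above another entry, so the shortened list is not empty and [flagsE]
     applies to it. *)
  move: px'; rewrite El' negbK => /hasP[t]; rewrite mem_cat inE.
  case/or3P => [t1 _|/eqP ->|t2 _]; last 2 first.
  - by rewrite r_irr.
  - by case: (s1) => //; case: (s2) t2.
  by case: (s1) t1.
rewrite -[RHS](fglift_comp (fun l' => fglift flags (del p l')) (cone (key l))).
by congr (cone _ _); rewrite (fglift_comp (del p) (fglift flags)).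
Qed.

(** The undivided simplex on the entries of [l], as opposed to its subdivision [flags]. *)
Definition vertices l : {freeg (seq K') / int} :=
  << [seq key [:: x] | x <- l] >>.

Lemma bd_vertices l : bd predT (vertices l) = fglift vertices (del predT l).
Proof.
rewrite bd_gen (map_comp key (fun x => [:: x])) -map_del /chain_map.
rewrite -map_del /chain_map (fglift_comp _ (fglift _)).
by apply: fglift_eq => s _ /=; rewrite fglift_gen -map_comp.
Qed.

(* Cone construction of a chain homotopy between the simplex and its
   subdivision into flags; both are carried by the faces of the simplex. *)
Fixpoint homotopy_rec m l : {freeg (seq K') / int} :=
  if m is m'.+1 then
    cone (key l) (vertices l - flags l - fglift (homotopy_rec m') (del predT l))
  else 0.

Definition homotopy l := homotopy_rec (size l) l.

Lemma homotopyE l : l != [::] -> homotopy l =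
  cone (key l) (vertices l - flags l - fglift homotopy (del predT l)).
Proof.
rewrite /homotopy; case: l => // x l _; rewrite [size _]/=.
congr (cone _ (_ - _)); apply: fglift_eq => s /supp_del_size /= [sz].
by rewrite sz.
Qed.

(** The chain under the cone is a cycle, by induction on the length and because [vertices] and
    [flags] are both chain maps; therefore its cone bounds it. *)
Lemma bd_homotopy l : bd predT (homotopy l) =
  vertices l - flags l - fglift homotopy (del predT l).
Proof.
have [m] := ubnP (size l); elim: m l => // m IH l /ltnSE sl.
have [->|l0] := eqVneq l [::].
  by rewrite /homotopy /= bd0 fglift0 subr0 subrr.
rewrite homotopyE // bd_cone scale1r -[RHS]subr0; congr (_ - _).
rewrite !bdB bd_vertices bd_flags (fglift_comp homotopy (bd predT)).
have -> : fglift (bd predT \o homotopy) (del predT l) =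
    fglift vertices (del predT l) - fglift flags (del predT l) -
    fglift homotopy (bd predT (del predT l)).
  rewrite (fglift_comp (del predT) (fglift homotopy)) -!fglift_sub.
  apply: fglift_eq => l' l'l /=.
  by rewrite IH // -ltnS -(supp_del_size l'l).
by rewrite -bd_gen bd_bd fglift0 subr0 subrr cone0.
Qed.

Lemma supp_homotopy (Q : K' -> Prop) l :
  (forall l', l' != [::] -> {subset l' <= l} -> Q (key l')) ->
  supp (fun s : seq K' => forall F, F \in s -> Q F) (homotopy l).
Proof.
have [m] := ubnP (size l); elim: m l => // m IH l /ltnSE sl Ql.
have [->|l0] := eqVneq l [::]; first exact: supp0.
have Qcons (s : seq K') : (forall F, F \in s -> Q F) -> forall F, F \in key l :: s -> Q F.
  by move=> Qs F; rewrite inE => /orP[/eqP ->|/Qs//]; apply: Ql.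
rewrite homotopyE //; apply: (supp_cone Qcons); apply: suppB; first apply: suppB.
- apply: supp_gen => F /mapP[x xl ->]; apply: Ql => // y.
  by rewrite inE => /eqP ->.
- pose P l' (s : seq K') := {subset l' <= l} -> forall F : K', F \in s -> Q F.
  apply: (supp_impl (Q := P l)); first by move=> s; apply.
  apply: supp_flags => // {}l' s1 x s2 s El _ Ps l'l F.
  rewrite inE => /orP[/eqP ->|]; first by apply: Ql; rewrite // El; case: (s1).
  apply: Ps => y yl; apply: l'l; rewrite El.
  by move: yl; rewrite !mem_cat inE => /orP[]->; rewrite ?orbT.
- apply: supp_fglift => l' l'l; apply: IH.
    by rewrite -ltnS -(supp_del_size l'l).
  by move=> l'' l''0 l''l'; apply: Ql => // y /l''l'; apply: supp_del_sub l'l _.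
Qed.

End PosetChains.

Lemma flags_eq (K K' : choiceType) (r r' : rel K) (key : seq K -> K') l :
  {in l &, r =2 r'} -> flags r key l = flags r' key l.
Proof.
have [m] := ubnP (size l); elim: m l => // m IH l /ltnSE sl rr'.
have [->//|l0] := eqVneq l [::]; rewrite !flagsE //; congr (cone _ _).
have -> : del (minimal r l) l = del (minimal r' l) l.
  apply: del_eq => x xl; congr (~~ _); apply: eq_in_has => y yl; exact: rr'.
apply: fglift_eq => l' l'l; apply: IH.
  by rewrite -ltnS -(supp_del_size l'l).
by move=> x y xl yl; apply: rr'; apply: (supp_del_sub l'l).
Qed.

(** Taken with [key1 = id], the flags record the filters themselves, so two different keys can be
    compared flag by flag. *)
Lemma flags_map (K K1 K2 : choiceType) (r : rel K) (key1 : seq K -> K1)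
    (f : K1 -> K2) l :
  flags r (f \o key1) l = chain_map f (flags r key1 l).
Proof.
have [m] := ubnP (size l); elim: m l => // m IH l /ltnSE sl.
have [->|l0] := eqVneq l [::]; first by rewrite /chain_map fglift_gen.
rewrite !flagsE // map_cone; congr (cone _ _).
rewrite (fglift_comp _ (chain_map f)); apply: fglift_eq => l' l'l /=; apply: IH.
by rewrite -ltnS -(supp_del_size l'l).
Qed.

(** Integral chains have no 2-torsion; this closes the sign-reversing pairing in [bd_sflag]. *)
Lemma opp_chain_eq0 (K : choiceType) (c : {freeg K / int}) : c = - c -> c = 0.
Proof.
move=> cN; apply/eqP/freeg_eqP => x; rewrite coeff0.
have : coeff x c = - coeff x c by rewrite {1}cN coeffN.
by clear; move: (coeff x c) => k; lia.
Qed.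

(** * Flags weighted by a sign function *)

Section SignChains.
Variable n : nat.
Local Notation V := 'I_n.+1.
Local Notation merge := Defs.merge.
Variable A : 'M[nat]_n.+1.
Hypothesis A_sym : forall i j, A i j = A j i.
Variable sign : pdigraph n -> edge n -> int.
Hypothesis sign_ok : sign_function A sign.

Implicit Types (C : pdigraph n) (e f : edge n).

(** The sources of these arrows are the minimal nonsink parts ([minimal_parts]), so contracting
    atoms one after another runs through the linear extensions. *)
Definition atom (C : pdigraph n) (e : edge n) : bool :=
  contractible C e && (ord_max \in e.2).

(** Counterpart of [flags_rec] with the given signs in place of the positional ones. The apex is the
    union of the nonsink parts, a set of vertices that can be compared across different
    partitions. *)
Fixpoint sflag_rec m (C : pdigraph n) : {freeg (seq {set V}) / int} :=
  if m is m'.+1 then cone (~: blk C ord_max)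
    (\sum_(e | atom C e) sign C e *: sflag_rec m' (contract C e))
  else << [::] >>.

Definition sflag C := sflag_rec #|C.1|.-1 C.

Lemma contr_nac C e : nacyclic A C -> contractible C e ->
  nacyclic A (contract C e).
Proof. by move=> hC ce; apply: contract_nacyclic => //; case/andP: ce. Qed.

Lemma contr_card C e : nacyclic A C -> contractible C e ->
  #|(contract C e).1| = #|C.1|.-1.
Proof. by move=> hC /andP[eC _]; apply: contract_card hC eC. Qed.

Lemma sflagE C : nacyclic A C -> (1 < #|C.1|)%N -> sflag C =
  cone (~: blk C ord_max) (\sum_(e | atom C e) sign C e *: sflag (contract C e)).
Proof.
move=> hC; rewrite /sflag; case E: #|C.1| => [|[|k]] // _ /=.
congr (cone _ _); apply: eq_bigr => e /andP[ce _].
by rewrite (contr_card hC ce) E.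
Qed.

Lemma sflag1 C : #|C.1| = 1%N -> sflag C = << [::] >>.
Proof. by rewrite /sflag => ->. Qed.

(** Pairs of facets of the cell of C that meet in a face of codimension two. *)
Definition commuting C : rel (edge n) := fun e f =>
  [&& contractible C e, contractible C f, f != e &
      contractible (contract C e) (contract_edge e f)].

(** [diamond] lifts f/e to some contractible arrow that can be exchanged with [e]; by uniqueness of
    contractible lifts it is [f]. *)
Lemma commuting_sym C e f : nacyclic A C -> commuting C e f -> commuting C f e.
Proof.
move=> hC /and4P[ce cf /eqP fe cg].
have [f' [cf' f'e Ef' cg' _]] := diamond A_sym hC ce cg.
have E := contractible_lift_uniq A_sym hC ce cf' cf f'e fe Ef'; rewrite E in cg'.
by rewrite /commuting cf ce cg' andbT; apply/eqP => /esym.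
Qed.

Lemma commuting_contract C e f : nacyclic A C -> commuting C e f ->
  contract (contract C e) (contract_edge e f) =
  contract (contract C f) (contract_edge f e).
Proof.
move=> hC /and4P[ce cf /eqP fe cg].
have [f' [cf' f'e Ef' cg' ->]] := diamond A_sym hC ce cg.
by rewrite (contractible_lift_uniq A_sym hC ce cf' cf f'e fe Ef').
Qed.

Lemma commuting_sign C e f : nacyclic A C -> commuting C e f ->
  sign C e * sign (contract C e) (contract_edge e f) =
  - (sign C f * sign (contract C f) (contract_edge f e)).
Proof.
move=> hC ef; have /and4P[_ _ _ cg'] := commuting_sym hC ef.
have /and4P[ce cf /eqP fe cg] := ef.
by apply: (proj2 sign_ok) => //; apply/nesym.
Qed.

(** The map sending [f] to f/e is a bijection from the arrows commuting with [e] onto the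
    contractible arrows of C/e: [diamond] gives surjectivity, [contractible_lift_uniq]
    injectivity. *)
Lemma sum_contract (M : nmodType) C e (Q : pred (edge n)) (G : edge n -> M) :
  nacyclic A C -> contractible C e ->
  \sum_(g | contractible (contract C e) g && Q g) G g =
  \sum_(f | commuting C e f && Q (contract_edge e f)) G (contract_edge e f).
Proof.
move=> hC ce.
pose h' g := odflt g [pick f | [&& contractible C f, f != e & contract_edge e f == g]].
have h'P g : contractible (contract C e) g ->
    [/\ contractible C (h' g), h' g != e & contract_edge e (h' g) = g].
  move=> cg; rewrite /h'; case: pickP => [f /and3P[? ? /eqP]//|].
  have [f [cf fe Ef _ _]] := diamond A_sym hC ce cg.
  by move/(_ f); rewrite cf Ef eqxx andbT; move/negbFE/eqP.
rewrite (reindex_onto (contract_edge e) h') /=; last first.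
  by move=> g /andP[/h'P[]].
apply: eq_bigl => f; apply/andP/andP => [[/andP[cg Qf] /eqP Ef]|[]].
  by have [cf fe _] := h'P _ cg; rewrite Ef in cf fe; rewrite /commuting ce cf fe cg.
case/and4P => _ cf /eqP fe cg Qf; rewrite cg Qf; split=> //; apply/eqP.
have [cf' /eqP f'e Ef'] := h'P _ cg.
exact: (contractible_lift_uniq A_sym hC ce cf' cf f'e fe).
Qed.

Lemma two_parts_atom C e : nacyclic A C -> #|C.1| = 2%N -> contractible C e ->
  ord_max \in e.2.
Proof.
move=> hC C2 /andP[eC _]; apply/negPn/negP => ne2.
have [e1C e2C e12] : [/\ e.1 \in C.1, e.2 \in C.1 & e.1 != e.2].
  case: (e) eC => U W UW; split;
    [exact: (edge_l hC UW)|exact: (edge_r hC UW)|exact: (edge_neq hC UW)].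
have ne1 : ord_max \notin e.1 by apply: (sink_out (W := e.2) hC); case: (e) eC.
have u : uniq [:: e.1; e.2] by rewrite /= inE e12.
have sub : {subset [:: e.1; e.2] <= parts C}.
  by move=> U; rewrite !inE mem_parts => /orP[]/eqP ->; rewrite ?e1C ?e2C.
by have := uniq_leq_size u sub; rewrite (size_parts hC) C2.
Qed.

(** The base of the cone yields the atoms. For a contractible [e] that is not an atom, C/e has the
    same sink part, so [sflag] of C/e is a cone with the same apex over the atoms of C/e. Everything
    left lies under one cone, and is a sum over ordered commuting pairs with at least one atom.
    Swapping a pair keeps the double contraction and reverses the sign, so this sum vanishes. *)
Lemma bd_sflag C : nacyclic A C -> (1 < #|C.1|)%N -> bd predT (sflag C) =
  \sum_(e | contractible C e) sign C e *: sflag (contract C e).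
Proof.
have [m] := ubnP #|C.1|; elim: m C => // m IH C /ltnSE Cm hC C1.
rewrite sflagE // bd_cone scale1r [RHS](bigID (fun e : edge n => ord_max \in e.2)) /=.
congr (_ + _); apply/eqP; rewrite -sub0r subr_eq; apply/eqP/esym.
(* With two parts, C/e has a single part and neither [sflagE] nor the induction hypothesis covers
   it; every contractible arrow is then an atom. *)
have [C2|C2] := eqVneq #|C.1| 2%N.
  rewrite big1 ?add0r => [|e /andP[ce /negP[]]]; last exact: two_parts_atom ce.
  rewrite linear_sum big1 ?cone0 // => e /andP[ce _] /=.
  by rewrite bdZ sflag1 ?(contr_card hC ce) ?C2 // bd_gen /= scaler0.
have {C1 C2} C3 : (2 < #|C.1|)%N by rewrite ltn_neqAle eq_sym C2.
pose T e f := (sign C e * sign (contract C e) (contract_edge e f)) *: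
  sflag (contract (contract C e) (contract_edge e f)).
have -> : \sum_(e | contractible C e && (ord_max \notin e.2))
      sign C e *: sflag (contract C e) =
    cone (~: blk C ord_max) (\sum_(e | contractible C e && (ord_max \notin e.2))
      \sum_(f | commuting C e f && (ord_max \in f.2)) T e f).
  rewrite linear_sum; apply: eq_bigr => e /andP[ce ne2] /=.
  have /andP[eC _] := ce.
  have ne1 : ord_max \notin e.1 by apply: (sink_out (W := e.2) hC); case: (e) eC.
  rewrite sflagE ?contr_nac ?(contr_card hC ce) //; last first.
    by case: #|C.1| C3 => [|[|[|]]].
  rewrite (sink_nonatom hC ce ne2) -coneZ; congr (cone _ _).
  rewrite scaler_sumr /atom (sum_contract _ _ hC ce).
  apply: eq_big => [f|f _]; last by rewrite scalerA.
  congr (_ && _); rewrite /=; case: (boolP (ends e f.2)) => [ef|nef]; last first.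
    by rewrite merge_id.
  rewrite merge_ends // inE (negbTE ne1) (negbTE ne2).
  by case/orP: ef => /eqP ->; rewrite ?(negbTE ne1) ?(negbTE ne2).
have -> : bd predT (\sum_(e | atom C e) sign C e *: sflag (contract C e)) =
    \sum_(e | atom C e) \sum_(f | commuting C e f) T e f.
  rewrite linear_sum; apply: eq_bigr => e /andP[ce _] /=.
  rewrite bdZ IH ?contr_nac ?(contr_card hC ce) //; first last.
  - by case: #|C.1| C3 => [|[|[|]]].
  - by case: #|C.1| C3 Cm => [|k].
  have := @sum_contract _ C e predT (fun g => sign (contract C e) g *:
    sflag (contract (contract C e) g)) hC ce.
  rewrite (eq_bigl (contractible (contract C e))) => [->|g]; last by rewrite andbT.
  rewrite scaler_sumr; apply: eq_big => [f|f _]; first by rewrite andbT.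
  by rewrite scalerA.
(* The condition is symmetric in [e] and [f], which lets the two double sums be merged and then
   exchanged. *)
pose G e f := if commuting C e f && ((ord_max \in e.2) || (ord_max \in f.2))
  then T e f else 0.
rewrite -coneD -[RHS](cone0 (~: blk C ord_max)); congr (cone _ _).
have -> : \sum_(e | contractible C e && (ord_max \notin e.2))
      \sum_(f | commuting C e f && (ord_max \in f.2)) T e f +
    \sum_(e | atom C e) \sum_(f | commuting C e f) T e f = \sum_e \sum_f G e f.
  have GE e : \sum_f G e f =
      \sum_(f | commuting C e f && ((ord_max \in e.2) || (ord_max \in f.2))) T e f.
    by rewrite [RHS]big_mkcond.
  have G0 e : ~~ contractible C e -> \sum_f G e f = 0.
    by move=> nc; rewrite big1 // => f _; rewrite /G /commuting (negbTE nc).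
  rewrite [RHS](bigID (fun e : edge n => ord_max \in e.2)) /= [LHS]addrC.
  congr (_ + _); rewrite [RHS](bigID (contractible C)) /=;
    rewrite [X in _ = _ + X]big1 ?addr0; try by move=> e /andP[_ /G0].
  - apply: eq_big => [e|e /andP[_ ne]]; first by rewrite andbC.
    by rewrite GE; apply: eq_bigl => f; rewrite ne andbT.
  - apply: eq_big => [e|e /andP[_ ne]]; first by rewrite andbC.
    by rewrite GE; apply: eq_bigl => f; rewrite (negbTE ne).
apply: opp_chain_eq0; rewrite {1}exchange_big -sumrN; apply: eq_bigr => e _.
rewrite -sumrN; apply: eq_bigr => f _; rewrite /G orbC.
have -> : commuting C f e = commuting C e f by apply/idP/idP; apply: commuting_sym.
case: ifP => [/andP[ef _]|_]; last by rewrite oppr0.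
by rewrite /T (commuting_contract hC ef) (commuting_sign hC ef) scaleNr opprK.
Qed.

Definition reach (C : pdigraph n) : rel {set V} :=
  fun U W => (U != W) && connect (erel C.2) U W.

Lemma reach_rank C U W : nacyclic A C -> reach C U W ->
  (rank C.2 W < rank C.2 U)%N.
Proof.
move=> hC /andP[+ /connectP[p + lp]]; case: p lp => [->|X p ->] /=.
  by rewrite eqxx.
move=> _ /andP[UX pP]; apply: leq_ltn_trans (rank_edge hC UX).
apply: (@connect_potential _ _ nat C.2 (rank C.2)) => [[Y Z] YZ|].
  exact: (rank_edge hC YZ).
by apply/connectP; exists p.
Qed.

Lemma reach_irr C : irreflexive (reach C).
Proof. by move=> U; rewrite /reach eqxx. Qed.

Lemma reach_trans C : nacyclic A C -> transitive (reach C).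
Proof.
move=> hC W U X UW WX; have := ltn_trans (reach_rank hC WX) (reach_rank hC UW).
case/andP: UW => _ UW; case/andP: WX => _ WX UX.
apply/andP; split; last exact: connect_trans WX.
by apply: contraTneq UX => ->; rewrite ltnn.
Qed.

Lemma minimal_parts C m : nacyclic A C -> m \in parts C ->
  minimal (reach C) (parts C) m = contractible C (m, blk C ord_max).
Proof.
move=> hC; rewrite mem_parts => /andP[mC nm]; apply/idP/idP.
  move/hasPn => minm; apply: (atom_contractible hC mC nm) => W mW.
  apply/eqP/negPn/negP => Wn; have WC := edge_r hC mW.
  have /minm/negP : W \in parts C.
    by rewrite mem_parts WC; apply: contra Wn => /(blk_def hC WC) ->.
  by rewrite /reach (edge_neq hC mW) connect1.
move=> cm; apply/hasPn => t; rewrite mem_parts => /andP[_ nt].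
apply/negP => /andP[mt /connectP[[|X p] /= + lt]].
  by move=> _; rewrite lt eqxx in mt.
case/andP => /(contractible_atom A_sym hC cm) EX.
case: p lt => [|Y p] /= lt; first by move=> _; move: nt; rewrite lt EX (mem_blk hC).
by case/andP => XY _; have := sink_edge Y hC; rewrite -EX [_ \in _]XY.
Qed.

(** Positional signs anticommute exactly as a sign function does, so the ratio of the two does not
    depend on the order of two contractions. *)
Lemma index_filter_sign (K : eqType) (l : seq K) x y : uniq l -> x != y ->
  x \in l -> y \in l ->
  (-1) ^+ (index x l + index y [seq z <- l | z != x]) =
  - (-1) ^+ (index y l + index x [seq z <- l | z != y]) :> int.
Proof.
elim: l => //= z l IH /andP[zl ul] xy; rewrite !inE.
have fl : [seq t <- l | t != z] = l.
  by apply/all_filterP/allP => t tl; apply: contraNneq zl => <-.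
have [E|zx] := eqVneq z x.
  rewrite -E in xy *; rewrite fl (negbTE xy) /= eqxx => _.
  by rewrite eq_sym (negbTE xy) => yl; rewrite add0n addn0 exprS mulN1r opprK.
have [E|zy] := eqVneq z y.
  by rewrite -E in xy *; rewrite fl /= eqxx addn0 add0n exprS mulN1r.
move=> /= xl yl; rewrite ?(negbTE zx) ?(negbTE zy).
by rewrite !addSn !addnS !exprS !mulN1r !opprK; apply: IH.
Qed.

(** Multiplies the ratios of positional and given signs along one chosen sequence of atom
    contractions. The value 1 without an atom is a fallback. *)
Fixpoint eps_rec m (C : pdigraph n) : int :=
  if m is m'.+1 then
    if [pick e | atom C e] is Some e then
      (-1) ^+ index e.1 (parts C) * sign C e * eps_rec m' (contract C e)
    else 1
  else 1.

Definition eps C := eps_rec #|C.1|.-1 C.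

Lemma eps1 C : #|C.1| = 1%N -> eps C = 1.
Proof. by rewrite /eps => ->. Qed.

Lemma card_contractible C e : nacyclic A C -> contractible C e -> (1 < #|C.1|)%N.
Proof.
move=> hC /andP[eC _]; have [e1C e2C e12] :
    [/\ e.1 \in C.1, e.2 \in C.1 & e.1 != e.2].
  case: (e) eC => U W UW; split;
    [exact: (edge_l hC UW)|exact: (edge_r hC UW)|exact: (edge_neq hC UW)].
rewrite (cardD1 e.1) (cardD1 e.2) e1C /= inE /= eq_sym e12.
by rewrite [in_mem _ _]e2C.
Qed.

Lemma atomE C e : nacyclic A C -> atom C e -> e = (e.1, blk C ord_max).
Proof. by move=> hC /andP[/andP[eC _] ne]; apply: (edge_atomE hC eC ne). Qed.

Lemma atom_part C e : nacyclic A C -> atom C e -> e.1 \in parts C.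
Proof.
move=> hC ae; have /andP[/andP[eC _] _] := ae.
by rewrite mem_parts; case: (e) eC => U W UW; rewrite (edge_l hC UW) (sink_out hC UW).
Qed.

(** Contracting one atom leaves the source of another untouched, and the arrows leaving that source
    still end in the sink part. *)
Lemma atom_commuting C e f : nacyclic A C -> atom C e -> atom C f -> e != f ->
  [/\ commuting C e f, atom (contract C e) (contract_edge e f) &
      (contract_edge e f).1 = f.1].
Proof.
move=> hC ae af ef; have /andP[ce ne] := ae; have /andP[cf nf] := af.
have hCe := contr_nac hC ce.
have Ee := atomE hC ae; have Ef := atomE hC af.
have := atom_part hC af; rewrite mem_parts => /andP[fC nf1].
have ne12 : e.1 != f.1 by apply: contraNneq ef => E; rewrite Ee Ef E.
have nends : ~~ ends e f.1.
  apply/norP; split; first by rewrite eq_sym.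
  by apply: contraNneq nf1 => ->.
have E1 : merge e f.1 = f.1 by rewrite merge_id.
have E2 : merge e f.2 = blk (contract C e) ord_max.
  rewrite (contract_blk hC (proj1 (andP ce))).
  by rewrite {1}Ef.
have af' : atom (contract C e) (contract_edge e f).
  rewrite /atom /contract_edge /= E2 (mem_blk hCe) andbT E1.
  apply: (atom_contractible hCe) => //; first by rewrite -E1 imset_f.
  move=> W /imsetP[[X Y]]; rewrite !inE => /andP[/= XYe XY] [EX ->].
  have {}EX : X = f.1.
    have XC := edge_l hC XY; have eC : e \in C.2 by case/andP: ce.
    have : merge e X = merge e f.1 by rewrite E1.
    case/(merge_inj hC eC XC fC) => // -[_ ef1].
    by rewrite ef1 in nends.
  rewrite (contract_blk hC (proj1 (andP ce))).
  have cf' : contractible C (f.1, blk C ord_max) by rewrite -Ef.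
  by rewrite EX in XY; rewrite (contractible_atom A_sym hC cf' XY).
split=> //; case/andP: (af') => cg _.
by rewrite /commuting ce cf cg eq_sym ef.
Qed.

Lemma sign_sq C e : nacyclic A C -> contractible C e -> sign C e * sign C e = 1.
Proof. by move=> hC ce; case: (proj1 sign_ok C e hC ce) => ->. Qed.

Lemma mul_anti (a b a' b' s t s' t' D : int) :
  a * b = - (a' * b') -> s * t = - (s' * t') ->
  a * s * (b * t * D) = a' * s' * (b' * t' * D).
Proof.
move=> ab st; have R (x y z w : int) : x * y * (z * w * D) = (x * z) * (y * w) * D.
  by rewrite mulrA mulrACA.
by rewrite !R ab st mulrNN.
Qed.

(* Independence of the atom chosen by eps_rec. *)
Lemma eps_atom C e : nacyclic A C -> atom C e ->
  eps C = (-1) ^+ index e.1 (parts C) * sign C e * eps (contract C e).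
Proof.
have [m] := ubnP #|C.1|; elim: m C e => // m IH C e /ltnSE Cm hC ae.
have /andP[ce ne] := ae; have C1 := card_contractible hC ce.
have [e0 ae0 ->] : exists2 e0, atom C e0 & eps C =
    (-1) ^+ index e0.1 (parts C) * sign C e0 * eps (contract C e0).
  rewrite {1}/eps; case E: #|C.1| C1 => [|[|k]] // _ /=.
  case: pickP => [e0 ae0|/(_ e)]; last by rewrite ae.
  exists e0 => //; rewrite /eps; have /andP[ce0 _] := ae0.
  by rewrite (contr_card hC ce0) E.
have [->//|ne0] := eqVneq e0 e; have /andP[ce0 _] := ae0.
have ne0' : e != e0 by rewrite eq_sym.
have [cef af E1] := atom_commuting hC ae0 ae ne0.
have [_ af0 E10] := atom_commuting hC ae ae0 ne0'.
have lt e1 : contractible C e1 -> (#|(contract C e1).1| < m)%N.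
  by move=> ce1; rewrite (contr_card hC ce1); case: #|C.1| C1 Cm => [|k].
(* Expand each side once more along the other atom. Both reach the same double contraction, and the
   two anticommutations, positional and given, cancel. *)
rewrite (IH _ _ (lt _ ce0) (contr_nac hC ce0) af).
rewrite (IH _ _ (lt _ ce) (contr_nac hC ce) af0).
rewrite E1 E10 -(commuting_contract hC cef).
have Ee0 := atomE hC ae0; have Ee := atomE hC ae.
have P0 : parts (contract C e0) = [seq U <- parts C | U != e0.1].
  by rewrite {1}Ee0 (parts_atom _ hC).
have P1 : parts (contract C e) = [seq U <- parts C | U != e.1].
  by rewrite {1}Ee (parts_atom _ hC).
rewrite P0 P1; set D := eps _.
have e01 : e0.1 != e.1 by apply: contraNneq ne0 => E; rewrite Ee0 Ee E.
have := index_filter_sign (parts_uniq C) e01 (atom_part hC ae0) (atom_part hC ae).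
rewrite !exprD => hs; have hsg := commuting_sign hC cef.
exact: mul_anti hs hsg.
Qed.

Lemma eps_sq C : nacyclic A C -> eps C * eps C = 1.
Proof.
have [m] := ubnP #|C.1|; elim: m C => // m IH C /ltnSE Cm hC.
case: (pickP (atom C)) => [e ae|na].
  have /andP[ce _] := ae; have C1 := card_contractible hC ce.
  rewrite (eps_atom hC ae) mulrACA IH ?contr_nac ?(contr_card hC ce) //; last first.
    by case: #|C.1| C1 Cm => [|k].
  by rewrite mulr1 mulrACA -expr2 sqrr_sign sign_sq // mul1r.
suff -> : eps C = 1 by rewrite mulr1.
rewrite /eps; case: #|C.1| => [|[|k]] //=.
by case: pickP => // e; rewrite na.
Qed.

Definition union_key (l : seq {set V}) : {set V} := \bigcup_(U <- l) U.

Lemma union_parts C : nacyclic A C -> union_key (parts C) = ~: blk C ord_max.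
Proof.
move=> hC; apply/setP => u; rewrite /union_key bigcup_seq inE.
apply/bigcupP/idP => [[U]|].
  rewrite mem_parts => /andP[UC nU] uU; apply: contra nU => us.
  have <- : blk C ord_max = U.
    by rewrite -(blk_def hC UC uU) (blk_def hC (blk_in hC ord_max) us).
  exact: (mem_blk hC).
move=> us; exists (blk C u); last exact: (mem_blk hC).
rewrite mem_parts (blk_in hC) /=; apply: contra us => nu.
by rewrite (blk_def hC (blk_in hC u) nu) (mem_blk hC).
Qed.

(** Both sides are cones with the same apex over sums indexed by the minimal parts, that is, by the
    atoms. Contracting an atom restricts the reachability order, and [eps_atom] absorbs the ratio of
    the signs. *)
Lemma flags_sflag C : nacyclic A C ->
  flags (reach C) union_key (parts C) = eps C *: sflag C.
Proof.
have [m] := ubnP #|C.1|; elim: m C => // m IH C /ltnSE Cm hC.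
have C0 : (0 < #|C.1|)%N by rewrite (cardD1 (blk C ord_max)) (blk_in hC).
have [C1|C1] := eqVneq #|C.1| 1%N.
  have P0 : parts C = [::] by apply/size0nil; rewrite (size_parts hC) C1.
  by rewrite P0 flags_nil eps1 // sflag1 // scale1r.
have {C0}C1 : (1 < #|C.1|)%N by rewrite ltn_neqAle eq_sym C1.
have P0 : parts C != [::].
  by rewrite -size_eq0 (size_parts hC); case: #|C.1| C1 => [|[|]].
rewrite flagsE // sflagE // -coneZ (union_parts hC); congr (cone _ _).
rewrite (del_uniq _ (parts_uniq C)) linear_sum scaler_sumr /=.
rewrite -[LHS]big_filter big_uniq ?(filter_uniq _ (parts_uniq C)) //=.
rewrite [RHS](reindex_onto (fun m => (m, blk C ord_max)) fst) /=; last first.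
  by move=> e /(atomE hC).
have atomP m0 : (m0 \in [seq x <- parts C | minimal (reach C) (parts C) x]) =
    atom C (m0, blk C ord_max).
  rewrite mem_filter; apply/andP/idP => [[]|ae].
    by move=> + mP; rewrite minimal_parts // => cm; rewrite /atom cm (mem_blk hC).
  have mP := atom_part hC ae; split=> //.
  by rewrite minimal_parts //; case/andP: ae.
apply: eq_big => [m0|m0]; first by rewrite eqxx andbT atomP.
rewrite atomP => ae; have /andP[ce _] := ae.
rewrite fgliftZ fglift_gen -(parts_atom _ hC).
rewrite (flags_eq (r' := reach (contract C (m0, blk C ord_max)))); last first.
  by move=> U W _ WP; rewrite /reach (connect_atom A_sym hC ce _ WP).
rewrite IH ?contr_nac // ?(contr_card hC ce); last first.
  by case: #|C.1| C1 Cm => [|k].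
rewrite !scalerA (eps_atom hC ae) /=; congr (_ *: _).
by rewrite mulrAC -[_ * sign _ _ * sign _ _]mulrA sign_sq // mulr1.
Qed.
End SignChains.

End ChainTheory.

(** * Two sets attached to a filter: its minimal parts and its union *)

Section FilterKeys.
Variable n : nat.
Local Notation V := 'I_n.+1.
Variable A : 'M[nat]_n.+1.
Implicit Types (C : pdigraph n) (l : seq {set V}).

(** Chosen for two properties: on a single part it returns that part, so [vertices] is the original
    simplex; and the longest path map carries its indicator to that of [union_key] on filters. *)
Definition min_key C l : {set V} :=
  [set u | has (fun U : {set V} => minimal (reach C) l U && (u \in U)) l].

Lemma mem_min_key C l u :
  reflect (exists U : {set V}, [/\ U \in l, minimal (reach C) l U & u \in U])
          (u \in min_key C l).
Proof.
rewrite inE; apply: (iffP hasP) => [[U Ul /andP[]]|[U [Ul mU uU]]].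
  by exists U.
by exists U; rewrite // mU.
Qed.

Lemma mem_union_key l u :
  reflect (exists2 U : {set V}, U \in l & u \in U) (u \in union_key l).
Proof. by rewrite /union_key bigcup_seq; apply: bigcupP. Qed.

Lemma min_key1 C (U : {set V}) : min_key C [:: U] = U.
Proof.
apply/setP => u; apply/mem_min_key/idP => [[W [+ _]]|uU].
  by rewrite inE => /eqP ->.
by exists U; rewrite mem_head /minimal /= reach_irr.
Qed.

Section Nacyclic.
Variable C : pdigraph n.
Hypothesis hC : nacyclic A C.

Lemma min_key_del s1 U s2 : ~~ minimal (reach C) (s1 ++ U :: s2) U ->
  min_key C (s1 ++ s2) = min_key C (s1 ++ U :: s2).
Proof.
move=> nU; have eqm := minimal_del (@reach_irr _ C) (reach_trans hC) nU.
apply/setP => u; apply/mem_min_key/mem_min_key => -[W [Wl mW uW]]; exists W.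
  rewrite -eqm; split=> //; move: Wl; rewrite !mem_cat inE.
  by case/orP => ->; rewrite ?orbT.
rewrite eqm; split=> //; move: Wl; rewrite !mem_cat inE.
by case/or3P => [->//|/eqP EW|->]; rewrite ?orbT //; rewrite EW (negbTE nU) in mW.
Qed.

Lemma ex_minimal l : l != [::] -> exists2 U, U \in l & minimal (reach C) l U.
Proof.
case: l => // U0 l _; set l' := U0 :: l.
case: (@arg_minnP _ U0 (mem l') (rank C.2)); first exact: mem_head.
move=> U Ul Umin; exists U => //; apply/hasPn => W /Umin /=.
by rewrite leqNgt; apply: contra => /(reach_rank hC).
Qed.

Lemma min_key_neq0 l : l != [::] -> {subset l <= C.1} -> min_key C l != set0.
Proof.
move=> /ex_minimal[U Ul mU] lC; have [u uU] := part_ex hC (lC U Ul).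
by apply/set0Pn; exists u; apply/mem_min_key; exists U.
Qed.

Lemma min_key_sub l u : {subset l <= C.1} -> u \in min_key C l -> blk C u \in l.
Proof.
move=> lC /mem_min_key[U [Ul _ uU]].
by rewrite (blk_def hC (lC U Ul) uU).
Qed.

Lemma min_key_blk l u w : {subset l <= C.1} -> blk C u = blk C w ->
  (u \in min_key C l) = (w \in min_key C l).
Proof.
move=> lC; have sub x y : blk C x = blk C y -> x \in min_key C l -> y \in min_key C l.
  move=> xy /mem_min_key[U [Ul mU xU]]; apply/mem_min_key; exists U; split=> //.
  by rewrite -(blk_def hC (lC U Ul) xU) xy (mem_blk hC).
by move=> uw; apply/idP/idP; apply: sub.
Qed.

Definition filter_list l :=
  {subset l <= parts C} /\ forall U X, U \in l -> (X, U) \in C.2 -> X \in l.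

Lemma parts_filter : filter_list (parts C).
Proof.
split=> // U X; rewrite !mem_parts => /andP[UC nU] XU.
by rewrite (edge_l hC XU) (sink_out hC XU).
Qed.

Lemma filter_del s1 U s2 : minimal (reach C) (s1 ++ U :: s2) U ->
  filter_list (s1 ++ U :: s2) -> filter_list (s1 ++ s2).
Proof.
move=> mU [lP lup]; have sub X : X \in s1 ++ s2 -> X \in s1 ++ U :: s2.
  by rewrite !mem_cat inE => /orP[]->; rewrite ?orbT.
split=> [X /sub/lP//|W X Wl XW]; have := lup W X (sub W Wl) XW.
have XU : X != U.
  apply/eqP => EX; move/hasPn: mU => /(_ W (sub W Wl)) /negP; apply.
  by rewrite /reach -EX (edge_neq hC XW) connect1.
by rewrite !mem_cat inE (negbTE XU).
Qed.

Lemma union_key_arr l u w : filter_list l -> arr C u w -> w \in union_key l ->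
  u \in union_key l.
Proof.
move=> [lP lup] uw /mem_union_key[U Ul wU]; apply/mem_union_key.
have /andP[UC _] : (U \in C.1) && (ord_max \notin U) by rewrite -mem_parts lP.
exists (blk C u); last exact: (mem_blk hC).
by apply: lup Ul _; rewrite -(blk_def hC UC wU).
Qed.

(** In an upward closed list minimality can be tested on direct out-neighbours: the first part after
    U on a path into the list lies above its end, hence in the list. This is the form that [lp_flag]
    asks for. *)
Lemma min_key_filter l u : filter_list l -> (u \in min_key C l) =
  (u \in union_key l) && [forall w, arr C u w ==> (w \notin union_key l)].
Proof.
move=> [lP lup]; have lC U : U \in l -> U \in C.1.
  by move=> /lP; rewrite mem_parts => /andP[].
apply/mem_min_key/andP => [[U [Ul mU uU]]|[/mem_union_key[U Ul uU] /forallP h]].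
  have Eu := blk_def hC (lC U Ul) uU.
  split; first by apply/mem_union_key; exists U.
  apply/forallP => w; apply/implyP => uw; apply/mem_union_key => -[W Wl wW].
  move/hasPn: mU => /(_ W Wl)/negP; apply.
  have UW : (U, W) \in C.2 by rewrite -Eu -(blk_def hC (lC W Wl) wW).
  by rewrite /reach (edge_neq hC UW) connect1.
exists U; split=> //; apply/hasPn => T Tl; apply/negP => /andP[UT].
have Eu := blk_def hC (lC U Ul) uU.
case/connectP => -[|X p] /= ; first by move=> _ E; rewrite E eqxx in UT.
case/andP=> UX pP ET; have Xl : X \in l.
  elim: p X pP ET {UX} => [|Y p IH] X /=; first by move=> _ <-.
  by case/andP=> XY pP ET; apply: lup XY; apply: IH.
have [x xX] := part_ex hC (lC X Xl).
have := h x; rewrite /arr Eu (blk_def hC (lC X Xl) xX) [(U, X) \in _]UX /=.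
by move/mem_union_key; apply; exists X.
Qed.

(* Consecutive filters of a linear extension, read off the chain of flags. *)
Lemma supp_parts_flags : supp (fun s : seq (seq {set V}) =>
    (forall l, l \in s -> filter_list l) /\
    (forall i j, (i <= j < size s)%N ->
       {subset nth [::] s j <= nth [::] s i}))
  (flags (reach C) id (parts C)).
Proof.
pose Q l (s : seq (seq {set V})) := filter_list l ->
  [/\ forall l', l' \in s -> filter_list l',
      forall l', l' \in s -> {subset l' <= l} &
      forall i j, (i <= j < size s)%N -> {subset nth [::] s j <= nth [::] s i}].
apply: (supp_impl (Q := Q (parts C))).
  by move=> s /(_ parts_filter)[].
apply: supp_flags => [_|l s1 U s2 s El mU Qs fl]; first by split=> // i j; rewrite andbF.
have fl' : filter_list (s1 ++ s2) by apply: (filter_del (U := U)); rewrite -El.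
have [h1 h2 h3] := Qs fl'.
have sub : {subset s1 ++ s2 <= l}.
  by move=> X; rewrite El !mem_cat inE => /orP[]->; rewrite ?orbT.
split=> [l'|l'|i j].
- by rewrite inE => /orP[/eqP ->|/h1].
- by rewrite inE => /orP[/eqP ->//|/h2 h] X /h/sub.
case: j => [|j]; first by rewrite leqn0 => /andP[/eqP -> _] X.
case: i => [|i] /=; last by rewrite !ltnS => /h3.
by rewrite ltnS => js X Xj; apply/sub/(h2 (nth [::] s j)); rewrite ?mem_nth.
Qed.

End Nacyclic.
End FilterKeys.

(** * Cells, incidence numbers and labels in combinatorial form *)

(** A d-cell has d+2 parts, the d+1 nonsink ones being the vertices of its simplex; the one-part
    partition in degree 0 plays the empty cell. *)
Definition gcell (n : nat) (A : 'M[nat]_n.+1) (d : nat) : finType :=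
  F0_basis A d.+1.

Section Cells.
Variables (n : nat) (A : 'M[nat]_n.+1).
Implicit Types (C : pdigraph n) (e : edge n).

Lemma gcell_nac d (c : gcell A d) : nacyclic A (val c).
Proof. by case/andP: (valP c). Qed.

Lemma gcell_card d (c : gcell A d) : #|(val c).1| = d.+2.
Proof. by case/andP: (valP c) => _ /eqP. Qed.

Lemma gcell_ex d C : nacyclic A C -> #|C.1| = d.+2 ->
  exists c : gcell A d, val c = C.
Proof.
move=> hC dC; have cP : nacyclic A C && (#|C.1| == d.+2) by rewrite hC dC eqxx.
by exists (exist _ C cP).
Qed.

Variable sign : pdigraph n -> edge n -> int.

Definition ginc d (s : gcell A d.+1) (t : gcell A d) : int :=
  (eps sign (val s) * eps sign (val t) *
  \sum_(e | contractible (val s) e && (Defs.contract (val s) e == val t))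
    sign (val s) e)%R.

Section Lcm.
Import mpoly.

Lemma outdegE C u : outdeg A C u = out A C u.
Proof. by rewrite mnmE. Qed.

Lemma is_mlcm_out (L : 'X_{1..n.+1} -> Prop) C :
  (forall l, L l -> forall u, (l u <= out A C u)%N) ->
  (forall u, exists2 l, L l & (out A C u <= l u)%N) -> is_mlcm L (outdeg A C).
Proof.
move=> le ge; split=> [l Ll|m h].
  by apply/mnm_lepP => u; rewrite outdegE le.
apply/mnm_lepP => u; rewrite outdegE; have [l Ll /leq_trans] := ge u; apply.
by have /mnm_lepP := h l Ll.
Qed.

End Lcm.
End Cells.

(** * Isomorphisms that relabel a basis and rescale it by signs *)

Module Diagonal.
Section DiagonalIso.
Import mpoly.
Local Open Scope ring_scope.
Variables (K : fieldType) (n : nat) (F G : gcomplex K n).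
Variable f : forall k, gbasis G k -> gbasis F k.
Variable e : forall k, gbasis G k -> int.

Definition diag_map k (v : gmod F k) : gmod G k :=
  [ffun j => (e j)%:~R * v (f j)].

Lemma diag_map_is_linear k : linear (@diag_map k).
Proof.
move=> a u v; apply/ffunP => j; rewrite !ffunE mulrDr; congr (_ + _).
by rewrite -![_ *: _]/(_ * _) mulrCA.
Qed.

HB.instance Definition _ k := GRing.isLinear.Build {mpoly K[n]} (gmod F k)
  (gmod G k) *:%R (@diag_map k) (@diag_map_is_linear k).

Hypothesis f_bij : forall k, bijective (@f k).
Hypothesis e_sign : forall k (j : gbasis G k), e j * e j = 1.
Hypothesis f_deg : forall k (j : gbasis G k), gdeg (f j) = gdeg j.
Hypothesis f_coef : forall k (i : gbasis G k.+1) (j : gbasis G k),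
  gcoef i j = (e i * e j)%:~R * gcoef (f i) (f j).

Lemma diag_giso : giso F G.
Proof.
exists (fun k => (@diag_map k : {linear _ -> _})); split.
- move=> k; have [g fK gK] := f_bij k.
  exists (fun w : gmod G k => [ffun i => (e (g i))%:~R * w (g i)] : gmod F k).
    move=> v; apply/ffunP => i; rewrite !ffunE gK mulrA -intrM e_sign.
    by rewrite mul1r.
  move=> w; apply/ffunP => j; rewrite !ffunE fK mulrA -intrM e_sign.
  by rewrite mul1r.
- move=> k a v hv j m; rewrite ffunE -f_deg => mj; apply: hv.
  have : e j = 1 \/ e j = -1.
    by have := e_sign j; clear; move: (e j) => x; nia.
  case=> E; rewrite E in mj; first by rewrite mul1r in mj.
  by rewrite mulrN1z mulNr mul1r (perm_mem (msuppN _)) in mj.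
- move=> k v; apply/ffunP => j; rewrite !ffunE mulr_sumr.
  rewrite (reindex (@f k.+1)) /=; last by apply: onW_bij.
  apply: eq_bigr => i _; rewrite ffunE f_coef intrM.
  rewrite [RHS]mulrACA; congr (_ * _).
  by rewrite mulrA -intrM e_sign mul1r.
Qed.

End DiagonalIso.
End Diagonal.

(** * The resolution as a cellular complex *)

Section F0Iso.
Import mpoly.
Local Open Scope ring_scope.
Variables (K : fieldType) (n : nat) (A : 'M[nat]_n.+1).
Hypothesis A_sym : forall i j, A i j = A j i.
Hypothesis A_conn : connected_graph A.
Variable sign : pdigraph n -> edge n -> int.
Hypothesis sign_ok : sign_function A sign.

Lemma outdeg_one_part : outdeg A (one_part n) = 0%MM.
Proof.
by apply/mnmP => u; rewrite outdegE mnm0E /out big_pred0 // => f; rewrite inE.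
Qed.

Lemma one_part_basis : exists i : F0_basis A 0, val i = one_part n.
Proof.
have iP : nacyclic A (one_part n) && (#|(one_part n).1| == 1%N).
  by rewrite one_part_nacyclic // cards1.
by exists (exist _ (one_part n) iP).
Qed.

Lemma F0_basis0 (i : F0_basis A 0) : val i = one_part n.
Proof. by case/andP: (valP i) => hC /eqP; apply: one_part_uniq. Qed.

(** A partition with two parts has exactly one contractible arrow, and its sign is [eps]. After
    rescaling, the coefficient at the empty cell is therefore 1 times the label, as [ainc]
    prescribes. *)
Lemma F0_coef_edge (c : gcell A 0) (i : F0_basis A 0) :
  F0_coef K sign c i = (eps sign (val c))%:~R * 'X_[outdeg A (val c)].
Proof.
set C := val c; have hC : nacyclic A C := gcell_nac c.
have dC : #|C.1| = 2%N := gcell_card c.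
have [m Em] : exists m, parts C = [:: m].
  by have := size_parts hC; rewrite dC; case: (parts C) => [|m []] // _; exists m.
have mP : m \in parts C by rewrite Em mem_head.
have := mP; rewrite mem_parts => /andP[mC nm].
have [W ce] := contractible_out hC mC nm.
have ae : atom C (m, W) by rewrite /atom ce; apply: (two_parts_atom hC dC ce).
have one e : contractible C e -> Defs.contract C e = one_part n.
  move=> cx; apply: (one_part_uniq A_sym A_conn (contr_nac A_sym hC cx)).
  by rewrite (contr_card hC cx) dC.
have uniq_e e : contractible C e -> e = (m, W).
  move=> cx; have ax : atom C e by rewrite /atom cx; apply: (two_parts_atom hC dC cx).
  rewrite (atomE hC ax) (atomE hC ae) /=; congr pair.
  by have := atom_part hC ax; rewrite Em inE => /eqP.
rewrite /F0_coef -/C (big_pred1 (m, W)) => [|e].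
  rewrite (one _ ce) outdeg_one_part subm0; congr (_%:~R * _).
  rewrite (eps_atom A_sym sign_ok hC ae) (one _ ce) Em /= eqxx expr0 mul1r.
  by rewrite eps1 ?mulr1 // cards1.
rewrite /=; apply/and3P/eqP => [[_ cx _]|->]; first exact: uniq_e.
by rewrite ce (one _ ce) (F0_basis0 i) eqxx; split=> //; case/andP: ce.
Qed.

Lemma F0_giso :
  giso (F0 K A sign)
    (@cellular_complex K n.+1 (gcell A) (fun d c => outdeg A (val c))
      (ginc (A := A) sign)).
Proof.
have [o Eo] := one_part_basis; set G := cellular_complex _ _ _.
pose f k : acell (gcell A) k -> F0_basis A k :=
  match k with d.+1 => fun c => c | 0%N => fun _ => o end.
apply: (@Diagonal.diag_giso K n.+1 (F0 K A sign) G f (fun k j => eps sign (val (f k j)))).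
- case=> [|d]; last by exists id.
  exists (fun=> tt) => [[]//|i]; apply: val_inj.
  by rewrite /= Eo (F0_basis0 i).
- move=> k j; apply: (eps_sq A_sym sign_ok (A := A)).
  by case/andP: (valP (f k j)).
- case=> [[]|d j] //=; by rewrite Eo outdeg_one_part.
case=> [c []|d s t] /=.
  have e1 : eps sign (one_part n) = 1 by apply: eps1; rewrite cards1.
  rewrite F0_coef_edge Eo e1 mulr1 subm0 mulrA -intrM.
  by rewrite (eps_sq A_sym sign_ok (gcell_nac c)).
rewrite /F0_coef /ginc intrM -mulrA; congr (_ * _).
rewrite rmorph_sum mulr_suml /=; apply: eq_big => [e|e /andP[_ /eqP ->] //].
by rewrite andbA; congr (_ && _); rewrite /contractible andbA andbb.
Qed.

End F0Iso.

From mathcomp Require Import all_classical all_reals topology normedtype.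
Import numFieldNormedType.Exports.

(** * The longest path map *)

Section LongestPath.
Local Open Scope ring_scope.
Variable R : realType.
Variable n : nat.
Local Notation V := 'I_n.+1.
Variable A : 'M[nat]_n.+1.
Hypothesis A_sym : forall i j, A i j = A j i.
Implicit Types (C : pdigraph n) (u w : V) (y f : V -> R).

(** The base value 0 is the height of the sink part; for nonnegative heights it matters in the empty
    case, which occurs at the sink. *)
Definition arr_max C f u : R := \big[Num.max/0]_(w | arr C u w) f w.

Definition lp_step C y f u : R := y u + arr_max C f u.

(* lp C y u is the largest total weight of a directed path of parts starting
   at the part of u; it inverts the map f |-> (u |-> f u - arr_max C f u). *)
Definition lp C y : V -> R := iter #|{set V}| (lp_step C y) (fun=> 0).

Lemma arr_max_ge0 C f u : 0 <= arr_max C f u.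
Proof. exact: bigmax_ge_id. Qed.

Lemma le_arr_max C f u w : arr C u w -> f w <= arr_max C f u.
Proof. by move=> uw; apply: le_bigmax_cond. Qed.

Lemma arr_max_le C f u (c : R) : 0 <= c -> (forall w, arr C u w -> f w <= c) ->
  arr_max C f u <= c.
Proof. by move=> c0 h; apply/bigmax_leP. Qed.

Lemma arr_max_lt C f u (c : R) : 0 < c -> (forall w, arr C u w -> f w < c) ->
  arr_max C f u < c.
Proof. by move=> c0 h; apply/bigmax_ltP. Qed.

Lemma eq_arr_max C f f' u : (forall w, arr C u w -> f w = f' w) ->
  arr_max C f u = arr_max C f' u.
Proof. by move=> h; apply: eq_bigr. Qed.

Lemma arr_max_blk C f u w : blk C u = blk C w -> arr_max C f u = arr_max C f w.
Proof. by move=> uw; rewrite /arr_max /arr uw. Qed.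

Lemma arr_max_scale C f u (c : R) : 0 <= c ->
  arr_max C (fun w => c * f w) u = c * arr_max C f u.
Proof.
move=> c0; rewrite /arr_max (big_morph ( *%R c) (id1 := 0) (op1 := Num.max)) //.
  by move=> a b; apply: maxr_pMr.
by rewrite mulr0.
Qed.

Section Fixed.
Variable C : pdigraph n.
Hypothesis hC : nacyclic A C.

(** The value at a part is stable after as many iterations as its rank, and ranks are bounded by the
    number of sets of vertices. *)
Lemma lp_fix y u : lp C y u = lp_step C y (lp C y) u.
Proof.
have stab k w : (rank C.2 (blk C w) <= k)%N ->
    iter k.+1 (lp_step C y) (fun=> 0) w = iter k (lp_step C y) (fun=> 0) w.
  elim: k w => [|k IH] w rk.
    have := rk; rewrite leqn0 cards_eq0 => /eqP/setP/(_ (blk C w)).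
    by rewrite !inE connect0.
  rewrite iterS [in RHS]iterS /lp_step; congr (_ + _).
  apply: eq_arr_max => v wv; apply: IH.
  by rewrite -ltnS; apply: leq_trans rk; exact: (rank_edge hC wv).
by rewrite /lp -[in RHS]iterS stab // max_card.
Qed.

Lemma lp_uniq y f : (forall u, f u = lp_step C y f u) -> f =1 lp C y.
Proof.
move=> fE u; have [m] := ubnP (rank C.2 (blk C u)).
elim: m u => // m IH u /ltnSE ru; rewrite fE lp_fix; congr (_ + _).
apply: eq_arr_max => w uw; apply: IH.
by apply: leq_trans ru; exact: (rank_edge hC uw).
Qed.

Lemma lp_scale y (c : R) u : 0 <= c -> lp C (fun v => c * y v) u = c * lp C y u.
Proof.
move=> c0; apply/esym; apply: (lp_uniq (f := fun v => c * lp C y v)) => v.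
by rewrite lp_fix /lp_step mulrDr -arr_max_scale.
Qed.

Lemma lp_gap y u : y u = lp C y u - arr_max C (lp C y) u.
Proof. by rewrite {1}lp_fix addrK. Qed.

Lemma eq_lp y y' : y =1 y' -> lp C y =1 lp C y'.
Proof. by move=> yy' u; apply: lp_uniq => v; rewrite lp_fix /lp_step yy'. Qed.

Lemma lp_of_gap f : lp C (fun v => f v - arr_max C f v) =1 f.
Proof. by move=> u; apply/esym/lp_uniq => v; rewrite /lp_step subrK. Qed.

Section Pos.
Variable y : V -> R.
Hypothesis y0 : forall u, 0 <= y u.

Lemma lp_ge u : y u <= lp C y u.
Proof. by rewrite lp_fix lerDl arr_max_ge0. Qed.

Lemma lp_ge0 u : 0 <= lp C y u.
Proof. exact: le_trans (y0 u) (lp_ge u). Qed.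

Lemma lp_arr u w : arr C u w -> y u + lp C y w <= lp C y u.
Proof. by move=> uw; rewrite [leRHS]lp_fix lerD2l le_arr_max. Qed.

Hypothesis yblk : forall u w, blk C u = blk C w -> y u = y w.

Lemma lp_weak : weak_on C (lp C y).
Proof.
split=> u w uw; last by apply: le_trans (lp_arr uw); rewrite lerDr.
by rewrite lp_fix [RHS]lp_fix /lp_step (yblk uw) (arr_max_blk _ uw).
Qed.

Lemma lp_sink : y ord_max = 0 -> lp C y ord_max = 0.
Proof.
move=> ym; rewrite lp_fix /lp_step ym add0r /arr_max big_pred0 // => w.
exact: (negbTE (sink_edge _ hC)).
Qed.

Lemma lp_strict : (forall u, ord_max \notin blk C u -> 0 < y u) ->
  strict_on C (lp C y).
Proof.
move=> yp; split=> u w uw; first exact: (proj1 lp_weak).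
by apply: lt_le_trans (lp_arr uw); rewrite ltrDr yp // (sink_out hC uw).
Qed.

Lemma lp_nstrict u : ord_max \notin blk C u -> y u = 0 -> ~ strict_on C (lp C y).
Proof.
move=> nu yu [_ fs]; have E : lp C y u = arr_max C (lp C y) u.
  by rewrite {1}lp_fix /lp_step yu add0r.
suff : arr_max C (lp C y) u < lp C y u by rewrite -E ltxx.
have [W /(arrP hC)] := nonsink_out hC (blk_in hC u) nu.
case=> u' [w' [Eu _ _ uw']].
have uw : arr C u w' by rewrite /arr Eu.
apply: arr_max_lt => [|w]; last exact: fs.
exact: le_lt_trans (lp_ge0 w') (fs _ _ uw).
Qed.

End Pos.

Lemma gap_ge0 f u : weak_on C f -> 0 <= f ord_max -> 0 <= f u - arr_max C f u.
Proof.
move=> hf f0; have fp v : 0 <= f v by apply: le_trans f0 (sink_min v hC hf).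
by rewrite subr_ge0; apply: arr_max_le => // w; case: hf => _; apply.
Qed.

Lemma gap_blk f u w : weak_on C f -> blk C u = blk C w ->
  f u - arr_max C f u = f w - arr_max C f w.
Proof. by case=> fc _ uw; rewrite (fc _ _ uw) (arr_max_blk _ uw). Qed.

Lemma gap_sink f u : weak_on C f -> f ord_max = 0 -> ord_max \in blk C u ->
  f u - arr_max C f u = 0.
Proof.
move=> hf fm; rewrite -(blk_eq hC) => /eqP E; rewrite (gap_blk hf E) fm sub0r.
rewrite /arr_max big_pred0 ?oppr0 // => w; exact: (negbTE (sink_edge _ hC)).
Qed.

End Fixed.

(* Along a flag of filters the longest path map is linear, and it takes the
   indicator of the minimal parts of a filter to the indicator of the filter. *)
Lemma lp_flag C (k : nat) (F G : nat -> {set V}) (t : nat -> R) :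
  nacyclic A C -> (forall i, 0 <= t i) ->
  (forall i j, (i <= j < k)%N -> F j \subset F i) ->
  (forall i u, (i < k)%N ->
     (u \in G i) = (u \in F i) && [forall w, arr C u w ==> (w \notin F i)]) ->
  (forall i u w, (i < k)%N -> arr C u w -> w \in F i -> u \in F i) ->
  lp C (fun u => \sum_(i < k) t i * (u \in G i)%:R) =1
    (fun u => \sum_(i < k) t i * (u \in F i)%:R).
Proof.
move=> hC t0 Fnest GF Fup u; apply/esym; move: u; apply: (lp_uniq hC) => u.
rewrite /lp_step.
(* Here nonlinearity disappears: since the filters are nested, an out-neighbour lying in as many of
   them as possible lies in every filter that contains some out-neighbour, and so attains all the
   maxima at once. *)
have -> : arr_max C (fun u => \sum_(i < k) t i * (u \in F i)%:R) u =
    \sum_(i < k) t i * [exists w, arr C u w && (w \in F i)]%:R.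
  apply/eqP; rewrite eq_le; apply/andP; split.
    apply: arr_max_le => [|w uw].
      by apply: sumr_ge0 => i _; rewrite mulr_ge0 ?ler0n.
    apply: ler_sum => i _; rewrite ler_wpM2l // ler_nat.
    case: (boolP (w \in F i)) => // wF; case: existsP => // -[].
    by exists w; rewrite uw.
  have [W0|] := pickP (fun w => arr C u w); last first.
    move=> no; rewrite big1 ?arr_max_ge0 // => i _.
    by case: existsP => [[w]|_]; rewrite ?no ?mulr0.
  move=> uW0.
  case: (@arg_maxnP _ W0 (fun w => arr C u w)
    (fun w => #|[set i : 'I_k | w \in F i]|) uW0).
  move=> w uw wmax; apply: le_trans (le_arr_max _ uw).
  apply: ler_sum => i _; rewrite ler_wpM2l // ler_nat.
  case: existsP => // -[v /andP[uv vF]].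
  suff -> : w \in F i by [].
  apply/negPn/negP => wF; have := wmax v uv; rewrite /= leqNgt => /negP; apply.
  apply: proper_card; rewrite properE; apply/andP; split; apply/fintype.subsetP.
    move=> j; rewrite !inE => wFj; have ji : (j < i)%N.
      rewrite ltnNge; apply: contra wF => ij.
      by apply: (fintype.subsetP (Fnest i j _)) => //; rewrite ij ltn_ord.
    by apply: (fintype.subsetP (Fnest j i _)) => //; rewrite ltnW // ltn_ord.
  by move/(_ i); rewrite !inE vF => /(_ isT); rewrite (negbTE wF).
(* For each filter, a vertex in it is either in [G i] or has an out-neighbour in [F i], and not
   both. *)
rewrite -big_split /=; apply: eq_bigr => i _; rewrite -mulrDr; congr (_ * _).
rewrite GF //; have [e|ne] := boolP [exists w, arr C u w && (w \in F i)].
  have -> : u \in F i.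
    by case/existsP: e => w /andP[uw]; apply: Fup (ltn_ord i) uw.
  have -> : [forall w, arr C u w ==> (w \notin F i)] = false.
    apply/negP => /forallP h; case/existsP: e => w /andP[uw wF].
    by have := h w; rewrite uw wF.
  by rewrite andbF add0r.
have -> : [forall w, arr C u w ==> (w \notin F i)].
  apply/forallP => w; apply/implyP => uw; apply: contra ne => wF.
  by apply/existsP; exists w; rewrite uw.
by rewrite andbT addr0.
Qed.

End LongestPath.

(** * Continuity of finite sums, maxima and row-valued maps *)

Section Continuity.
Local Open Scope ring_scope.
Local Open Scope classical_set_scope.
Variables (R : realType) (T : topologicalType).

Lemma continuous_sum (I : Type) (r : seq I) (F : I -> T -> R) :
  (forall i, continuous (F i)) -> continuous (fun t => \sum_(i <- r) F i t).
Proof.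
move=> cF x; elim: r => [|i r IH].
  under eq_fun do rewrite big_nil; exact: cvg_cst.
under eq_fun do rewrite big_cons.
by apply: cvgD IH; apply: cF.
Qed.

Lemma continuous_bigmax (I : Type) (r : seq I) (P : pred I) (F : I -> T -> R) :
  (forall i, continuous (F i)) ->
  continuous (fun t => \big[Num.max/0]_(i <- r | P i) F i t).
Proof.
move=> cF x; elim: r => [|i r IH].
  under eq_fun do rewrite big_nil; exact: cvg_cst.
under eq_fun do rewrite big_cons.
case: (P i) IH => // IH.
apply: (@continuous_max R T (F i) (fun t => \big[Num.max/0]_(i <- r | P i) F i t)).
  exact: cF.
exact: IH.
Qed.

Lemma continuous_mul (f g : T -> R) : continuous f -> continuous g ->
  continuous (fun t => f t * g t).
Proof. by move=> cf cg x; apply: cvgM; [apply: cf|apply: cg]. Qed.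

Lemma continuous_add (f g : T -> R) : continuous f -> continuous g ->
  continuous (fun t => f t + g t).
Proof. by move=> cf cg x; apply: cvgD; [apply: cf|apply: cg]. Qed.

Lemma continuous_inv (f : T -> R) : (forall t, f t != 0) -> continuous f ->
  continuous (fun t => (f t)^-1).
Proof. by move=> f0 cf x; apply: cvgV; [apply: f0|apply: cf]. Qed.

Lemma continuous_const (a : R) : continuous (fun _ : T => a).
Proof. by move=> x; apply: cvg_cst. Qed.

Lemma continuous_row (m : nat) (g : T -> 'rV[R]_m) :
  (forall j, continuous (fun t => g t ord0 j)) -> continuous g.
Proof.
move=> cg x; apply/cvg_ballP => e e0.
have h : \forall t \near x, forall j, ball (g x ord0 j) e (g t ord0 j).
  apply: filter_forall => j.
  by have /cvg_ballP/(_ e e0) := cg j x.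
apply: filterS h => t ht; split=> // i j; rewrite (ord1 i); exact: ht.
Qed.

End Continuity.

(** * The space of normalized heights and the parametrization of closed cells *)

Section Space.
Local Open Scope ring_scope.
Local Open Scope classical_set_scope.
Variable R : realType.
Variable n : nat.
Local Notation V := 'I_n.+1.
Variable A : 'M[nat]_n.+1.
Hypothesis A_sym : forall i j, A i j = A j i.
Implicit Types (C : pdigraph n) (u w : V) (y : V -> R).

Definition slice : set 'rV[R]_n.+1 := [set f | [/\ f ord0 ord_max = 0,
  \sum_u f ord0 u = 1 & forall u, connect (descent A (f ord0)) u ord_max]].

Definition pt C y : 'rV[R]_n.+1 := \row_u (lp C y u / \sum_v lp C y v).

Definition good C y := [/\ forall u, 0 <= y u,
  forall u w, blk C u = blk C w -> y u = y w, y ord_max = 0 & exists u, 0 < y u].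

Lemma strict_scale C (f g : V -> R) (c : R) : 0 < c ->
  (forall u, g u = f u / c) -> strict_on C g <-> strict_on C f.
Proof.
move=> c0 gf; split=> -[fc fs]; split=> u w uw.
- by have := fc u w uw; rewrite !gf => /(mulIf (invr_neq0 (lt0r_neq0 c0))).
- by have := fs u w uw; rewrite !gf ltr_pM2r ?invr_gt0.
- by rewrite !gf (fc u w uw).
- by rewrite !gf ltr_pM2r ?invr_gt0 //; apply: fs.
Qed.

Lemma weak_scale C (f g : V -> R) (c : R) : 0 < c ->
  (forall u, g u = f u / c) -> weak_on C f -> weak_on C g.
Proof.
move=> c0 gf -[fc fs]; split=> u w uw; first by rewrite !gf (fc u w uw).
by rewrite !gf ler_pM2r ?invr_gt0 //; apply: fs.
Qed.

Section Point.
Variables (C : pdigraph n) (y : V -> R).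
Hypothesis hC : nacyclic A C.
Hypothesis gy : good C y.

Let y0 u : 0 <= y u. Proof. by case: gy. Qed.
Let yb u w : blk C u = blk C w -> y u = y w. Proof. by case: gy => _ h _ _ /h. Qed.
Let ym : y ord_max = 0. Proof. by case: gy. Qed.

Lemma lp_sum_gt0 : 0 < \sum_v lp C y v.
Proof.
case: gy => _ _ _ [u yu]; rewrite (bigD1 u) //=; apply: ltr_wpDr.
  by apply: sumr_ge0 => v _; apply: (lp_ge0 hC).
exact: (lt_le_trans yu (lp_ge hC y u)).
Qed.

Lemma pt_weak : weak_on C (pt C y ord0).
Proof.
apply: (weak_scale (f := lp C y) lp_sum_gt0); last exact: (lp_weak hC y0 yb).
by move=> u; rewrite mxE.
Qed.

Lemma pt_slice : slice (pt C y).
Proof.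
split; first by rewrite mxE (lp_sink hC ym) mul0r.
  under eq_bigr do rewrite mxE.
  by rewrite -mulr_suml divff // lt0r_neq0 // lp_sum_gt0.
by move=> u; apply: (weak_descent _ hC pt_weak).
Qed.

Lemma pt_strictE : strict_on C (pt C y ord0) <-> strict_on C (lp C y).
Proof. by apply: strict_scale lp_sum_gt0 _ => u; rewrite mxE. Qed.

Lemma pt_strict : (forall u, ord_max \notin blk C u -> 0 < y u) ->
  strict_on C (pt C y ord0).
Proof. by move=> yp; apply/pt_strictE; apply: (lp_strict hC y0 yb yp). Qed.

Lemma pt_nstrict u : ord_max \notin blk C u -> y u = 0 ->
  ~ strict_on C (pt C y ord0).
Proof. by move=> nu yu /pt_strictE; apply: (lp_nstrict hC y0 nu yu). Qed.

End Point.

(** The normalization rules out the one-part partition, on which every height would equal that of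
    the last vertex, 0. *)
Lemma slice_cell (f : 'rV[R]_n.+1) : slice f ->
  exists C, [/\ nacyclic A C, (1 < #|C.1|)%N & strict_on C (f ord0)].
Proof.
case=> f0 f1 fd; have [C [hC fC]] := strict_ex A_sym fd; exists C; split=> //.
have [] := ltnP 1 #|C.1| => //; rewrite leq_eqVlt => /orP[/cards1P[U C1]|]; last first.
  by rewrite ltnS leqn0 cards_eq0 => /eqP C0; have := blk_in hC ord_max; rewrite C0 inE.
have : \sum_u f ord0 u = 0.
  apply: big1 => u _; rewrite -f0; apply: (proj1 fC).
  have := blk_in hC u; have := blk_in hC ord_max.
  by rewrite C1 !inE => /eqP -> /eqP.
by rewrite f1 => /eqP; rewrite oner_eq0.
Qed.

Section Barycentric.
Variable d : nat.
Implicit Types (s : seq {set V}) (t : std_simplex R d).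

Definition bary (t : std_simplex R d) (i : 'I_d.+1) : R :=
  (val t : 'rV[R]_d.+1) ord0 i.

Lemma bary_ge0 t i : 0 <= bary t i.
Proof. by have [h _] := set_valP t; apply: h. Qed.

Lemma bary_sum t : \sum_i bary t i = 1.
Proof. by have [_ h] := set_valP t. Qed.

Lemma bary_inj t t' : (forall i, bary t i = bary t' i) -> t = t'.
Proof. by move=> h; apply/val_inj/rowP => i; apply: h. Qed.

Lemma bary_pos t : exists i, 0 < bary t i.
Proof.
apply: contrapT => /forallNP h; have := bary_sum t; rewrite big1.
  by move/esym/eqP; rewrite oner_eq0.
move=> i _; apply/eqP; rewrite eq_le bary_ge0 andbT leNgt.
exact/negP/h.
Qed.

Lemma bary_mk (b : 'I_d.+1 -> R) : (forall i, 0 <= b i) -> \sum_i b i = 1 ->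
  exists t, forall i, bary t i = b i.
Proof.
move=> b0 b1; have bP : \row_i b i \in std_simplex R d.
  apply/mem_set; split=> [i|]; first by rewrite mxE.
  by under eq_bigr do rewrite mxE.
by exists (SigSub bP) => i; rewrite /bary /= mxE.
Qed.

Lemma bary_continuous i : continuous (fun t => bary t i).
Proof.
move=> t; apply: (@continuous_comp _ _ _ (val : std_simplex R d -> 'rV[R]_d.+1)
  (fun M : 'rV[R]_d.+1 => M ord0 i)).
  exact: initial_continuous.
exact: coord_continuous.
Qed.

(** Barycentric coordinates on the indicator functions of the sets in [s], giving a simplex of
    weights. *)
Definition comb s t : V -> R :=
  fun u => \sum_(i < d.+1) bary t i * (u \in nth finset.set0 s i)%:R.

Lemma comb_continuous s u : continuous (fun t => comb s t u).
Proof.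
apply: continuous_sum => i; apply: continuous_mul; first exact: bary_continuous.
exact: continuous_const.
Qed.

Definition valid C (F : {set V}) := [/\ F != finset.set0, ord_max \notin F &
  forall u w, blk C u = blk C w -> (u \in F) = (w \in F)].

Lemma good_comb C s t : size s = d.+1 -> (forall F, F \in s -> valid C F) ->
  good C (comb s t).
Proof.
move=> sz vs; have vi (i : 'I_d.+1) : valid C (nth finset.set0 s i).
  by apply: vs; rewrite mem_nth // sz.
split.
- by move=> u; apply: sumr_ge0 => i _; rewrite mulr_ge0 ?bary_ge0.
- by move=> u w uw; apply: eq_bigr => i _; have [_ _ h] := vi i; rewrite (h u w uw).
- rewrite /comb big1 // => i _; have [_ /negbTE -> _] := vi i.
  by rewrite mulr0.
- have [i ti] := bary_pos t; have [/set0Pn[u uF] _ _] := vi i; exists u.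
  rewrite /comb (bigD1 i) //= uF mulr1; apply: ltr_wpDr => //.
  by apply: sumr_ge0 => j _; rewrite mulr_ge0 ?bary_ge0.
Qed.

Lemma lp_continuous C (y : std_simplex R d -> V -> R) :
  (forall u, continuous (fun t => y t u)) ->
  forall u, continuous (fun t => lp C (y t) u).
Proof.
rewrite /lp => cy; elim: #|{set V}| => [|k IH] u /=; first exact: continuous_const.
by apply: continuous_add; [exact: cy|exact: continuous_bigmax].
Qed.

Lemma pt_continuous C s : nacyclic A C -> size s = d.+1 ->
  (forall F, F \in s -> valid C F) -> continuous (fun t => pt C (comb s t)).
Proof.
move=> hC sz vs; apply: continuous_row => u.
under eq_fun do rewrite mxE.
have cl v : continuous (fun t => lp C (comb s t) v).
  by apply: lp_continuous => w; apply: comb_continuous.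
apply: continuous_mul; first exact: cl.
apply: continuous_inv => [t|]; last exact: continuous_sum.
exact/lt0r_neq0/(lp_sum_gt0 hC)/good_comb.
Qed.

Section PartCoordinates.
Variable C : pdigraph n.
Hypothesis hC : nacyclic A C.
Hypothesis dC : #|C.1| = d.+2.

Let sz : size (parts C) = d.+1. Proof. by rewrite (size_parts hC) dC. Qed.

Lemma valid_part F : F \in parts C -> valid C F.
Proof.
rewrite mem_parts => /andP[FC nF]; split=> //.
  by have [u uF] := part_ex hC FC; apply/set0Pn; exists u.
move=> u w uw; apply/idP/idP => h; rewrite -(blk_def hC FC h).
  by rewrite uw (mem_blk hC).
by rewrite -uw (mem_blk hC).
Qed.

Let part_nth (i : 'I_d.+1) : nth finset.set0 (parts C) i \in parts C.
Proof. by rewrite mem_nth // sz. Qed.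

Lemma comb_part t (i : 'I_d.+1) u : u \in nth finset.set0 (parts C) i ->
  comb (parts C) t u = bary t i.
Proof.
move=> ui; rewrite /comb (bigD1 i) //= ui mulr1 big1 ?addr0 // => j ji.
suff -> : (u \in nth finset.set0 (parts C) j) = false by rewrite mulr0.
apply: contraNF ji => uj; apply/eqP/val_inj/eqP.
rewrite -(nth_uniq finset.set0 _ _ (parts_uniq C)) ?sz ?ltn_ord //; apply/eqP.
have := part_nth i; have := part_nth j; rewrite !mem_parts.
by move=> /andP[jC _] /andP[iC _]; apply: (eq_part hC jC iC uj ui).
Qed.

Lemma part_index u : ord_max \notin blk C u ->
  exists i : 'I_d.+1, u \in nth finset.set0 (parts C) i.
Proof.
move=> nu; have uP : blk C u \in parts C by rewrite mem_parts (blk_in hC).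
have lt : (index (blk C u) (parts C) < d.+1)%N by rewrite -sz index_mem.
by exists (Ordinal lt); rewrite nth_index // (mem_blk hC).
Qed.

Lemma good_parts t : good C (comb (parts C) t).
Proof. by apply: good_comb => // F; apply: valid_part. Qed.

Lemma int_strict t : simplex_int t -> strict_on C (pt C (comb (parts C) t) ord0).
Proof.
move=> tint; apply: (pt_strict hC (good_parts t)) => u /part_index[i ui].
by rewrite (comb_part t ui); apply: tint.
Qed.

Lemma strict_int t : strict_on C (pt C (comb (parts C) t) ord0) -> simplex_int t.
Proof.
move=> st i; have := part_nth i; rewrite mem_parts => /andP[iC ni].
have [u ui] := part_ex hC iC; have Eu := blk_def hC iC ui.
rewrite lt0r -/(bary t i) bary_ge0 andbT; apply/negP => /eqP ti.
apply: (pt_nstrict hC (good_parts t) (u := u)) st; first by rewrite Eu.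
by rewrite (comb_part t ui).
Qed.

(** Equal points have proportional longest path functions. These are homogeneous in the weights and
    determine them through the gaps, so the weights are proportional; since the coordinates sum to
    1, the factor is 1. *)
Lemma pt_inj t t' : pt C (comb (parts C) t) = pt C (comb (parts C) t') -> t = t'.
Proof.
move=> /rowP E; have S0 := lp_sum_gt0 hC (good_parts t).
have S0' := lp_sum_gt0 hC (good_parts t').
set y := comb _ t in E S0; set y' := comb _ t' in E S0'.
pose c := (\sum_v lp C y v) / (\sum_v lp C y' v).
have c0 : 0 <= c by rewrite divr_ge0 // ltW.
have El u : lp C y u = lp C (fun v => c * y' v) u.
  rewrite (lp_scale hC) //; have := E u; rewrite !mxE => /(canRL (divfK _)) ->.
    by rewrite /c mulrAC [RHS]mulrC mulrA.
  exact: lt0r_neq0.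
have yc u : y u = c * y' u.
  rewrite (lp_gap hC y u) (lp_gap hC (fun v => c * y' v) u) El.
  by congr (_ - _); apply: eq_arr_max => w _; apply: El.
have bc i : bary t i = c * bary t' i.
  have [u ui] : exists u, u \in nth finset.set0 (parts C) i.
    by have := part_nth i; rewrite mem_parts => /andP[/(part_ex hC)].
  by rewrite -(comb_part t ui) -(comb_part t' ui) -yc.
have c1 : c = 1.
  have : \sum_i bary t i = c * \sum_i bary t' i.
    by rewrite mulr_sumr; apply: eq_bigr.
  by rewrite !bary_sum mulr1.
by apply: bary_inj => i; rewrite bc c1 mul1r.
Qed.

(** The gaps of [f] are nonnegative weights whose longest path function is [f]. Dividing by their
    total over the nonsink parts gives barycentric coordinates; that total is positive because
    otherwise [f] would vanish. *)
Lemma pt_surj (f : 'rV[R]_n.+1) : slice f -> weak_on C (f ord0) ->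
  exists t, pt C (comb (parts C) t) = f.
Proof.
move=> fs hf; have [f0 f1 _] := fs.
pose y u := f ord0 u - arr_max C (f ord0) u.
have y0 u : 0 <= y u by apply: (gap_ge0 hC u hf); rewrite f0.
have yb u w : blk C u = blk C w -> y u = y w by apply: gap_blk hf.
have lpy : lp C y =1 f ord0 by apply: (lp_of_gap hC).
pose r (i : 'I_d.+1) : V := odflt ord0 [pick u in nth finset.set0 (parts C) i].
have rP i : r i \in nth finset.set0 (parts C) i.
  rewrite /r; case: pickP => //= no; have := part_nth i.
  by rewrite mem_parts => /andP[/(part_ex hC)[u ui] _]; have := no u; rewrite ui.
pose S := \sum_i y (r i).
have yS u : y u = \sum_(i < d.+1) y (r i) * (u \in nth finset.set0 (parts C) i)%:R.
  have [nu|nu] := boolP (ord_max \in blk C u).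
    rewrite [y u](gap_sink hC hf f0 nu) big1 // => i _.
    have := part_nth i; rewrite mem_parts => /andP[iC ni].
    suff -> : (u \in nth finset.set0 (parts C) i) = false by rewrite mulr0.
    by apply: contraNF ni => /(blk_def hC iC) <-.
  have [i ui] := part_index nu; rewrite (bigD1 i) //= ui mulr1 big1 ?addr0.
    apply: yb; have := part_nth i; rewrite mem_parts => /andP[iC _].
    by rewrite (blk_def hC iC ui) (blk_def hC iC (rP i)).
  move=> j ji.
  suff -> : (u \in nth finset.set0 (parts C) j) = false by rewrite mulr0.
  apply: contraNF ji => uj; apply/eqP/val_inj/eqP.
  rewrite -(nth_uniq finset.set0 _ _ (parts_uniq C)) ?sz ?ltn_ord //; apply/eqP.
  have := part_nth i; have := part_nth j; rewrite !mem_parts.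
  by move=> /andP[jC _] /andP[iC _]; apply: (eq_part hC jC iC uj ui).
have S0 : 0 < S.
  rewrite lt0r sumr_ge0 // andbT; apply/eqP => S0.
  have yr i : y (r i) = 0.
    by move/eqP: S0; rewrite psumr_eq0 // => /allP/(_ i (mem_index_enum i))/eqP.
  have yz : y =1 fun=> 0.
    by move=> u; rewrite yS big1 // => i _; rewrite yr mul0r.
  have : \sum_u f ord0 u = 0.
    apply: big1 => u _; rewrite -lpy (eq_lp hC yz).
    apply/esym; apply: (lp_uniq hC (f := fun=> 0)) => v.
    rewrite /lp_step add0r /arr_max; apply/esym.
    by apply: (big_ind (fun x => x = 0)) => // a b -> ->; rewrite maxxx.
  by rewrite f1 => /eqP; rewrite oner_eq0.
have [t tE] : exists t : std_simplex R d, forall i, bary t i = y (r i) / S.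
  apply: bary_mk => [i|]; first by rewrite divr_ge0 // ltW.
  by rewrite -mulr_suml divff // lt0r_neq0.
exists t; apply/rowP => u; rewrite mxE.
have ct v : comb (parts C) t v = S^-1 * y v.
  rewrite /comb yS mulr_sumr; apply: eq_bigr => i _.
  by rewrite tE mulrAC mulrC.
have Sge : 0 <= S^-1 by rewrite invr_ge0 ltW.
have lc v : lp C (comb (parts C) t) v = S^-1 * f ord0 v.
  by rewrite (eq_lp hC ct) (lp_scale hC) // lpy.
rewrite lc; under eq_bigr do rewrite lc.
by rewrite -mulr_sumr f1 mulr1 mulrAC divff ?mul1r // invr_neq0 // lt0r_neq0.
Qed.

End PartCoordinates.
End Barycentric.

End Space.

(** * The CW complex and its incidence numbers *)

Section CWComplex.
Local Open Scope ring_scope.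
Local Open Scope classical_set_scope.
Variable R : realType.
Variable n : nat.
Local Notation V := 'I_n.+1.
Variable A : 'M[nat]_n.+1.
Hypothesis A_sym : forall i j, A i j = A j i.
Implicit Types (C : pdigraph n) (u w : V).

Local Notation gspace := (@slice R n A).

Definition gmap d (c : gcell A d) (t : std_simplex R d) : gspace :=
  SigSub (mem_set (pt_slice (gcell_nac c)
    (good_parts (gcell_nac c) (gcell_card c) t))).

Lemma gmap_continuous d (c : gcell A d) : continuous (gmap c).
Proof.
apply: continuous_comp_initial.
apply: (pt_continuous (gcell_nac c)) => [|F]; last exact: (valid_part (gcell_nac c)).
by rewrite (size_parts (gcell_nac c)) gcell_card.
Qed.

Lemma gmap_inj d (c : gcell A d) t t' : gmap c t = gmap c t' -> t = t'.
Proof.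
by move/(congr1 set_val); apply: (pt_inj (gcell_nac c) (gcell_card c)).
Qed.

Lemma gmap_int d (c : gcell A d) t :
  simplex_int t <-> strict_on (val c) (set_val (gmap c t) ord0).
Proof.
split; first exact: (int_strict (gcell_nac c) (gcell_card c)).
exact: (strict_int (gcell_nac c) (gcell_card c)).
Qed.

Lemma gmap_surj d (c : gcell A d) (x : gspace) :
  weak_on (val c) (set_val x ord0) -> exists t, gmap c t = x.
Proof.
move=> wx; have [t tx] := pt_surj (gcell_nac c) (gcell_card c) (set_valP x) wx.
by exists t; apply: val_inj.
Qed.

Lemma gmap_open d (c : gcell A d) (x : gspace) :
  (gmap c @` @simplex_int R d) x <-> strict_on (val c) (set_val x ord0).
Proof.
split=> [[t /gmap_int tint <-]//|sx].
have [t tx] := gmap_surj (strict_weak sx); exists t => //.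
by apply/(gmap_int c); rewrite tx.
Qed.

Lemma gmap_closed d (c : gcell A d) t : weak_on (val c) (set_val (gmap c t) ord0).
Proof.
exact: (pt_weak (gcell_nac c) (good_parts (gcell_nac c) (gcell_card c) t)).
Qed.

Definition gopen (s : {d & gcell A d}) : set gspace :=
  gmap (projT2 s) @` @simplex_int R (projT1 s).

Lemma gopen_trivIset : trivIset [set: {d & gcell A d}] gopen.
Proof.
move=> [d c] [d' c'] _ _ [x [/gmap_open /= h /gmap_open /= h']].
have E : val c = val c' by apply: strict_uniq (gcell_nac c) (gcell_nac c') h h'.
have ed : d = d'.
  by apply/eqP; rewrite -2!eqSS -(gcell_card c) -(gcell_card c') E.
by subst d'; congr existT; apply: val_inj.
Qed.

Lemma slice_gcell (x : gspace) :
  exists d (c : gcell A d), strict_on (val c) (set_val x ord0).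
Proof.
have [C [hC C1 sC]] := slice_cell A_sym (set_valP x).
have dC : #|C.1| = (#|C.1| - 2).+2 by case: #|C.1| C1 => [|[|k]] //=; rewrite subn2.
have [c Ec] := gcell_ex hC dC.
by exists (#|C.1| - 2)%N, c; rewrite Ec.
Qed.

Lemma gopen_cover : \bigcup_s gopen s = [set: gspace].
Proof.
apply/seteqP; split=> // x _; have [d [c sc]] := slice_gcell x.
by exists (existT _ d c) => //; apply/gmap_open.
Qed.

Lemma below_weak (x : gspace) C d : nacyclic A C -> (#|C.1| <= d.+1)%N ->
  weak_on C (set_val x ord0) ->
  (\bigcup_(s in [set s : {d & gcell A d} | (projT1 s < d)%N]) gopen s) x.
Proof.
move=> hC Cd wx; have [k [c sc]] := slice_gcell x.
exists (existT _ k c); last exact/gmap_open.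
have [le _] := weak_card hC (gcell_nac c) wx sc.
by rewrite /= -2!ltnS -(gcell_card c) ltnS; apply: leq_trans le Cd.
Qed.

(** By [weak_card] the point lies in the open cell of a partition with strictly fewer parts; this
    gains one dimension over [below_weak]. *)
Lemma below_nstrict (x : gspace) C d : nacyclic A C -> (#|C.1| <= d.+2)%N ->
  weak_on C (set_val x ord0) -> ~ strict_on C (set_val x ord0) ->
  (\bigcup_(s in [set s : {d & gcell A d} | (projT1 s < d)%N]) gopen s) x.
Proof.
move=> hC Cd wx nsx; have [k [c sc]] := slice_gcell x.
exists (existT _ k c); last exact/gmap_open.
have [le eq] := weak_card hC (gcell_nac c) wx sc.
have lt : (#|(val c).1| < #|C.1|)%N.
  by rewrite ltn_neqAle le andbT; apply/eqP => /eq.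
rewrite /= -2!ltnS -(gcell_card c); exact: leq_trans lt Cd.
Qed.

Lemma gmap_bd d (c : gcell A d) : gmap c @` @simplex_bd R d `<=`
  \bigcup_(s in [set s : {d & gcell A d} | (projT1 s < d)%N]) gopen s.
Proof.
move=> _ [t tbd <-]; apply: (below_nstrict (gcell_nac c)).
- by rewrite gcell_card.
- exact: gmap_closed.
- by move/gmap_int.
Qed.

Lemma slice_hausdorff : hausdorff_space gspace.
Proof.
move=> p q pq; apply: val_inj.
apply: (@norm_hausdorff _ 'rV[R]_n.+1) => P Q Pp Qq.
have [x [Px Qx]] := pq (set_val @^-1` P) (set_val @^-1` Q)
  (initial_continuous Pp) (initial_continuous Qq).
by exists (set_val x).
Qed.

Lemma gcell_finite : exists N : nat, forall d, (N <= d)%N -> #|gcell A d| = 0%N.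
Proof.
exists #|{set V}| => d dN; apply: eq_card0 => c; rewrite inE.
have := max_card (mem (val c).1); rewrite gcell_card => /ltnW h.
by have := leq_trans h dN; rewrite ltnn.
Qed.

Definition gcw : finCW R := @FinCW R gspace (gcell A) gmap slice_hausdorff
  gcell_finite gmap_continuous (fun d c x y _ _ => @gmap_inj d c x y)
  gopen_trivIset gopen_cover gmap_bd.

End CWComplex.

(** * From formal chains of vertex sets to singular chains *)

Section Realization.
Import freeg.
Local Open Scope ring_scope.
Local Open Scope classical_set_scope.
Variable R : realType.
Variable n : nat.
Local Notation V := 'I_n.+1.
Variable A : 'M[nat]_n.+1.
Hypothesis A_sym : forall i j, A i j = A j i.
Local Notation gspace := (@slice R n A).
Implicit Types (C : pdigraph n) (u w : V).
Variable x0 : gspace.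

(** [insubd] makes this total, so that every sequence of sets can be realized; for [pt C] and valid
    sets the default [x0] is not taken ([real_val]). *)
Definition real (g : (V -> R) -> 'rV[R]_n.+1) d (s : seq {set V})
  (t : std_simplex R d) : gspace := insubd x0 (g (comb s t)).

(** Formal chains are not graded by length, so sequences of the wrong length are sent to 0. *)
Definition realize (g : (V -> R) -> 'rV[R]_n.+1) d :
    {freeg (seq {set V}) / int} -> chain R gspace d :=
  fglift (fun s => if size s == d.+1 then gen (@real g d s) else 0).
HB.instance Definition _ g d := GRing.Linear.on (@realize g d).

Lemma realize_gen g d s : realize g d << s >> =
  if size s == d.+1 then gen (@real g d s) else 0.
Proof. exact: fglift_gen. Qed.

Lemma comb_face d (s : seq {set V}) (i : 'I_d.+2) (t : std_simplex R d) :
  (i < size s)%N -> comb s (face i t) = comb (take i s ++ drop i.+1 s) t.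
Proof.
move=> si; apply/funext => u; rewrite /comb (bigD1_ord i) //= /bary /= mxE.
rewrite unlift_none /= mul0r add0r; apply: eq_bigr => k _.
rewrite mxE liftK /=; congr (_ * (u \in _)%:R).
rewrite nth_cat size_take si nth_drop /bump.
case: ltnP => [ki|ik]; first by rewrite nth_take // add0n.
by rewrite addSn subnKC.
Qed.

Lemma real_face g d (s : seq {set V}) (i : 'I_d.+2) : (i < size s)%N ->
  @real g d.+1 s \o @face R d i = @real g d (take i s ++ drop i.+1 s).
Proof. by move=> si; apply/funext => t; rewrite /= /real comb_face. Qed.

Definition chain_bd_lin d : chain R gspace d.+1 -> chain R gspace d :=
  @chain_bd R gspace d.
HB.instance Definition _ d := GRing.Linear.copy (@chain_bd_lin d)
  (fglift (fun s : std_simplex R d.+1 -> gspace =>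
    \sum_(i < d.+2) (-1) ^+ i *: gen (s \o @face R d i))).

Lemma chain_bd_realize g d c :
  chain_bd (realize g d.+1 c) = realize g d (bd predT c).
Proof.
rewrite -[LHS]/(chain_bd_lin _) (fglift_comp _ (@chain_bd_lin d)).
rewrite (fglift_comp _ (@realize g d)); apply: fglift_eq => s _ /=.
case: ifP => [/eqP sz|sz]; last first.
  rewrite linear0; apply/esym/fglift_eq0 => s' /supp_del_size /= ss'.
  by rewrite -eqSS -ss' sz.
rewrite /chain_bd_lin /chain_bd fglift_gen del_predT linear_sum sz /=.
apply: eq_bigr => i _; rewrite linearZ /= realize_gen.
rewrite real_face ?sz // ifT // size_cat size_take size_drop sz ltn_ord subSS.
by rewrite subnKC // -ltnS ltn_ord.
Qed.

Definition cont_in (Y : set gspace) d (f : std_simplex R d -> gspace) :=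
  continuous f /\ range f `<=` Y.

Lemma chain_in_supp (Y : set gspace) d (c : chain R gspace d) :
  chain_in Y c <-> supp (cont_in Y (d := d)) c.
Proof. by []. Qed.

Lemma realize_supp g d (Y : set gspace) (Q : seq {set V} -> Prop) c :
  supp Q c ->
  (forall s, Q s -> size s = d.+1 -> cont_in Y (@real g d s)) ->
  chain_in Y (realize g d c).
Proof.
move=> Qc h; apply/chain_in_supp; apply: supp_fglift => s /Qc Qs.
by case: ifP => [/eqP sz|_]; [apply: supp_gen; apply: h|exact: supp0].
Qed.

Section Cell.
Variable C : pdigraph n.
Hypothesis hC : nacyclic A C.

Lemma real_val d (s : seq {set V}) t : size s = d.+1 ->
  (forall F, F \in s -> valid C F) ->
  set_val (@real (pt C) d s t) = pt C (comb s t).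
Proof.
move=> sz vs; rewrite /real /insubd insubT //=.
exact/mem_set/(pt_slice hC)/good_comb.
Qed.

Lemma real_continuous d (s : seq {set V}) : size s = d.+1 ->
  (forall F, F \in s -> valid C F) -> continuous (@real (pt C) d s).
Proof.
move=> sz vs; apply: continuous_comp_initial.
rewrite (_ : _ \o _ = fun t => pt C (comb s t)); first exact: pt_continuous hC sz vs.
by apply/funext => t; rewrite /= -(real_val t sz vs).
Qed.

Lemma real_weak d (s : seq {set V}) t : size s = d.+1 ->
  (forall F, F \in s -> valid C F) ->
  weak_on C (set_val (@real (pt C) d s t) ord0).
Proof.
by move=> sz vs; rewrite real_val //; apply: (pt_weak hC); apply: good_comb.
Qed.

Lemma real_nstrict d (s : seq {set V}) t u : size s = d.+1 ->
  (forall F, F \in s -> valid C F) -> ord_max \notin blk C u ->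
  (forall F, F \in s -> u \notin F) ->
  ~ strict_on C (set_val (@real (pt C) d s t) ord0).
Proof.
move=> sz vs nu us; rewrite real_val //.
apply: (pt_nstrict hC (good_comb t sz vs) nu).
rewrite /comb big1 // => i _; rewrite (_ : (u \in _) = false) ?mulr0 //.
by apply/negbTE/us; rewrite mem_nth // sz.
Qed.

Lemma valid_min_key l : l != [::] -> {subset l <= parts C} ->
  valid C (min_key C l).
Proof.
move=> l0 lP; have lC : {subset l <= C.1}.
  by move=> U /lP; rewrite mem_parts => /andP[].
split; first exact: (min_key_neq0 hC l0 lC).
- apply/negP => /(min_key_sub hC lC)/lP; rewrite mem_parts.
  by rewrite (mem_blk hC) andbF.
- by move=> u w; apply: (min_key_blk hC lC).
Qed.

Local Notation cells d :=
  (\bigcup_(s in [set s : {d & gcell A d} | (projT1 s < d)%N]) @gopen R n A s).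

Definition flagsC := flags (reach C) (min_key C).
Definition verticesC := vertices (min_key C).
Definition homotopyC := homotopy (reach C) (min_key C).

Lemma homotopy_below d k (l : seq {set V}) : {subset l <= parts C} ->
  (#|C.1| <= d.+1)%N -> chain_in (cells d) (realize (pt C) k (homotopyC l)).
Proof.
move=> lP dC; pose Q (F : {set V}) := valid C F.
apply: (realize_supp (Q := fun s => forall F, F \in s -> Q F)).
  apply: supp_homotopy => l' l'0 l'l; apply: valid_min_key => // U /l'l/lP.
  by [].
move=> s vs sz; split; first exact: real_continuous.
by move=> _ [t _ <-]; apply: (below_weak A_sym hC dC); apply: real_weak.
Qed.

(** On a face that omits the part U, all keys avoid U. The weight vanishes there, so the points are
    not strict on C and lie one dimension lower than in [homotopy_below]. *)
Lemma homotopy_face_below d k : (#|C.1| <= d.+2)%N ->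
  chain_in (cells d)
    (realize (pt C) k (fglift homotopyC (del predT (parts C)))).
Proof.
move=> dC; apply: (realize_supp (Q := fun s => exists u,
  [/\ ord_max \notin blk C u, forall F, F \in s -> valid C F &
      forall F, F \in s -> u \notin F])); last first.
  move=> s [u [nu vs us]] sz; split; first exact: real_continuous.
  move=> _ [t _ <-]; apply: (below_nstrict A_sym hC dC); first exact: real_weak.
  exact: (@real_nstrict _ _ _ u).
apply: supp_fglift => l' /supp_del[s1 [U [s2 [_ El El']]]].
have UP : U \in parts C by rewrite El mem_cat mem_head orbT.
have l'P : {subset l' <= parts C}.
  by move=> W; rewrite El El' !mem_cat inE => /orP[]->; rewrite ?orbT.
have Ul' : U \notin l'.
  have := parts_uniq C; rewrite El' El cat_uniq /= => /and3P[_].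
  rewrite negb_or => /andP[U1 _] /andP[U2 _].
  by rewrite mem_cat negb_or U1.
have := UP; rewrite mem_parts => /andP[UC nU]; have [u uU] := part_ex hC UC.
have Eu := blk_def hC UC uU.
have S : supp (fun s : seq {set V} => forall F, F \in s ->
    valid C F /\ u \notin F) (homotopyC l').
  apply: supp_homotopy => l'' l''0 l''l; split.
    by apply: valid_min_key => // W /l''l/l'P.
  apply/negP => /(min_key_sub hC); rewrite Eu => h.
  move/negP: Ul'; apply; apply/l''l/h => W /l''l/l'P.
  by rewrite mem_parts => /andP[].
apply: supp_impl S => s h; exists u; rewrite Eu.
by split=> // F /h[].
Qed.

Lemma bd_homotopyC l : bd predT (homotopyC l) =
  verticesC l - flagsC l - fglift homotopyC (del predT l).
Proof.
apply: bd_homotopy; [exact: reach_irr|exact: (reach_trans hC)|].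
by move=> s1 U s2; apply: (min_key_del hC).
Qed.

Lemma verticesC_parts : verticesC (parts C) = << parts C >>.
Proof.
rewrite /verticesC /vertices; congr (<< _ >>).
by rewrite -[RHS]map_id; apply: eq_map => U; apply: min_key1.
Qed.

Definition normalized (y : V -> R) : 'rV[R]_n.+1 := \row_u (y u / \sum_v y v).

(** By [lp_flag], realizing a flag through C with its minimal parts amounts to normalizing the
    indicators of the filters. The right-hand realization no longer mentions C, which is what allows
    C and its contractions to be compared. *)
Lemma realize_flags d : realize (pt C) d (flagsC (parts C)) =
  realize normalized d (flags (reach C) (@union_key n) (parts C)).
Proof.
have fm (key : seq {set V} -> {set V}) : flags (reach C) key (parts C) =
    chain_map key (flags (reach C) id (parts C)).
  exact: (flags_map (reach C) id key (parts C)).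
rewrite /flagsC !fm.
rewrite (fglift_comp _ (@realize (pt C) d)) (fglift_comp _ (@realize normalized d)).
apply: fglift_eq => s /(supp_parts_flags hC)[fs ns] /=.
rewrite !realize_gen !size_map; case: ifP => // /eqP sz.
congr gen; apply/funext => t; rewrite /real; congr insubd.
have E : lp C (comb (map (min_key C) s) t) =1 comb (map (@union_key n) s) t.
  pose F i := union_key (nth [::] s i); pose G i := min_key C (nth [::] s i).
  pose b i := bary t (inord i).
  have fn i : (i < d.+1)%N -> filter_list C (nth [::] s i).
    by move=> id; apply: fs; rewrite mem_nth // sz.
  have := @lp_flag R n A C d.+1 F G b hC.
  have cE (key : seq {set V} -> {set V}) : comb (map key s) t =1
      fun u => \sum_(i < d.+1) b i * (u \in key (nth [::] s i))%:R.
    move=> u; apply: eq_bigr => i _; rewrite /b inord_val.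
    by rewrite (nth_map [::]) // sz.
  move=> h u; rewrite (eq_lp hC (cE _)) cE; apply: h =>
    [i|i j /andP[ij jd]|i v id|i v w id].
  - exact: bary_ge0.
  - apply/fintype.subsetP => v /mem_union_key[U Uj vU]; apply/mem_union_key.
    by exists U => //; apply: (ns i j) => //; rewrite ij sz.
  - exact: (min_key_filter hC v (fn i id)).
  - exact: (union_key_arr hC (fn i id)).
by apply/rowP => u; rewrite !mxE E; congr (_ / _); apply: eq_bigr => v _.
Qed.

End Cell.
End Realization.

(** * The cellular boundary *)

Section Incidence.
Import freeg.
Local Open Scope ring_scope.
Local Open Scope classical_set_scope.
Variable R : realType.
Variable n : nat.
Local Notation V := 'I_n.+1.
Local Notation contract := Defs.contract.
Variable A : 'M[nat]_n.+1.
Hypothesis A_sym : forall i j, A i j = A j i.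
Variable sign : pdigraph n -> edge n -> int.
Hypothesis sign_ok : sign_function A sign.
Implicit Types (C : pdigraph n) (u w : V) (e : edge n).

Lemma std_simplex_int d : exists t : std_simplex R d, simplex_int t.
Proof.
have [t tE] : exists t : std_simplex R d, forall i, bary t i = d.+1%:R^-1.
  apply: bary_mk => [i|]; first by rewrite invr_ge0.
  by rewrite sumr_const card_ord -[_ *+ _]mulr_natl divff // pnatr_eq0.
by exists t => i; rewrite -[X in 0 < X]/(bary t i) tE invr_gt0.
Qed.

Lemma chain_bdD d (u v : chain R (@slice R n A) d.+1) :
  chain_bd (u + v) = chain_bd u + chain_bd v.
Proof. exact: (linearD (@chain_bd_lin R n A d)). Qed.

Lemma chain_bdB d (u v : chain R (@slice R n A) d.+1) :
  chain_bd (u - v) = chain_bd u - chain_bd v.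
Proof. exact: (linearB (@chain_bd_lin R n A d)). Qed.

Lemma chain_bdZ d k (u : chain R (@slice R n A) d.+1) :
  chain_bd (k *: u) = k *: chain_bd u.
Proof. by rewrite -[LHS]/(chain_bd_lin _) linearZ. Qed.

Lemma chain_bd_sum d (I : finType) (P : pred I)
    (F : I -> chain R (@slice R n A) d.+1) :
  chain_bd (\sum_(i | P i) F i) = \sum_(i | P i) chain_bd (F i).
Proof. exact: (linear_sum (@chain_bd_lin R n A d)). Qed.

Section Fixed.
Variable x0 : @slice R n A.

Lemma gmap_vertices d (c : gcell A d) : gen (gmap c) =
  realize x0 (pt (val c)) d (verticesC (val c) (parts (val c))).
Proof.
have hC := gcell_nac c.
have sz : size (parts (val c)) = d.+1 by rewrite (size_parts hC) gcell_card.
rewrite verticesC_parts realize_gen sz eqxx; congr gen; apply/funext => t.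
apply: val_inj; rewrite -[RHS]/(set_val _) real_val // => F.
exact: (valid_part hC).
Qed.

Definition face_homotopy C : {freeg (seq {set V}) / int} :=
  fglift (homotopyC C) (del predT (parts C)).

(** The homotopy formula solved for the flags. It is applied to the facets C/e, to return from
    sign-weighted flags to characteristic maps. *)
Lemma realize_sflag d C : nacyclic A C ->
  realize x0 (@normalized R n) d (sflag sign C) =
  eps sign C *: (realize x0 (pt C) d (verticesC C (parts C)) -
    realize x0 (pt C) d (bd predT (homotopyC C (parts C))) -
    realize x0 (pt C) d (face_homotopy C)).
Proof.
move=> hC; have E : realize x0 (pt C) d (flagsC C (parts C)) =
    eps sign C *: realize x0 (@normalized R n) d (sflag sign C).
  by rewrite (realize_flags x0 hC) (flags_sflag A_sym sign_ok hC) linearZ.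
rewrite (bd_homotopyC hC) !linearB /= -/(face_homotopy C).
rewrite !opprK addrA addrK addrA subrr add0r E scalerA (eps_sq A_sym sign_ok hC).
by rewrite scale1r.
Qed.

(** Replace the characteristic map of C by its flags, a boundary, and the homotopy on its faces. The
    boundary dies under the next boundary; [bd_sflag] turns the flags into those of the facets, and
    [realize_sflag] turns these back into characteristic maps. The chain [b] collects the homotopy
    on the faces of C and the homotopies of the facets; [c] collects the homotopies on the faces of
    the facets, one dimension lower. *)
Lemma gincidence_at d (s : gcell A d.+1) :
  exists (b : chain R (@slice R n A) d.+1) (c : chain R (@slice R n A) d),
    [/\ chain_in (\bigcup_(t in [set t : {d & gcell A d} | (projT1 t < d.+1)%N])
          @gopen R n A t) b,
        chain_in (\bigcup_(t in [set t : {d & gcell A d} | (projT1 t < d)%N])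
          @gopen R n A t) c
      & chain_bd (gen (gmap s)) =
        \sum_t ginc sign s t *: gen (gmap t) + chain_bd b + c].
Proof.
set C := val s; have hC := gcell_nac s; have dC := gcell_card s.
pose k e := eps sign C * sign C e * eps sign (contract C e).
pose H e := realize x0 (pt (contract C e)) d.+1
  (homotopyC (contract C e) (parts (contract C e))).
pose Y e := realize x0 (pt (contract C e)) d (face_homotopy (contract C e)).
pose G C' := realize x0 (pt C') d (verticesC C' (parts C')).
pose Z := realize x0 (pt C) d.+1 (face_homotopy C).
have nac e : contractible C e -> nacyclic A (contract C e).
  exact: (contr_nac A_sym hC).
have card e : contractible C e -> #|(contract C e).1| = d.+2.
  by move=> ce; rewrite (contr_card hC ce) dC.
exists (Z - \sum_(e | contractible C e) k e *: H e),
  (- \sum_(e | contractible C e) k e *: Y e); split.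
- apply/chain_in_supp; apply: suppB.
    have le : (#|C.1| <= d.+3)%N by rewrite dC.
    exact: (@homotopy_face_below _ _ _ A_sym x0 _ hC d.+1 d.+1 le).
  apply: supp_sum => e ce; apply: suppZ.
  have le : (#|(contract C e).1| <= d.+2)%N by rewrite card.
  exact: (@homotopy_below _ _ _ A_sym x0 _ (nac e ce) d.+1 d.+1 _ (fun _ h => h) le).
- apply/chain_in_supp; apply: suppN; apply: supp_sum => e ce; apply: suppZ.
  have le : (#|(contract C e).1| <= d.+2)%N by rewrite card.
  exact: (@homotopy_face_below _ _ _ A_sym x0 _ (nac e ce) d d le).
have -> : \sum_t ginc sign s t *: gen (gmap t) =
    \sum_(e | contractible C e) k e *: G (contract C e).
  transitivity (\sum_(t : gcell A d) \sum_(e | contractible C e)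
      if contract C e == val t then k e *: G (contract C e) else 0).
    apply: eq_bigr => t _; rewrite /ginc mulr_sumr scaler_suml -big_mkcondr.
    apply: eq_bigr => e /andP[ce /eqP Et].
    by rewrite (gmap_vertices t) -Et /k mulrAC.
  rewrite exchange_big; apply: eq_bigr => e ce /=.
  have [c Ec] := gcell_ex (nac e ce) (card e ce).
  rewrite -big_mkcond (big_pred1 c) // => t; rewrite -Ec.
  by rewrite eq_sym; apply/eqP/eqP => [/val_inj|->].
rewrite chain_bdB chain_bd_sum.
under [X in _ = _ + (_ - X) - _]eq_bigr do rewrite chain_bdZ.
rewrite (gmap_vertices s) -/C.
have V1 : verticesC C (parts C) = bd predT (homotopyC C (parts C)) +
    (flagsC C (parts C) + face_homotopy C).
  rewrite (bd_homotopyC hC) -/(face_homotopy C).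
  by rewrite addrACA subrK addNr addr0.
rewrite V1 !linearD /= !chain_bdD chain_bd_realize bd_bd linear0 add0r.
rewrite (realize_flags x0 hC) (flags_sflag A_sym sign_ok hC) linearZ /=.
rewrite chain_bdZ chain_bd_realize (bd_sflag A_sym sign_ok hC); last by rewrite dC.
have -> : eps sign C *: realize x0 (@normalized R n) d
      (\sum_(e | contractible C e) sign C e *: sflag sign (contract C e)) =
    \sum_(e | contractible C e) k e *: G (contract C e) -
    \sum_(e | contractible C e) k e *: chain_bd (H e) -
    \sum_(e | contractible C e) k e *: Y e.
  rewrite linear_sum scaler_sumr -!sumrB; apply: eq_bigr => e ce.
  rewrite linearZ /= (realize_sflag _ (nac e ce)) /H chain_bd_realize.
  by rewrite -!scalerBr !scalerA.
by rewrite -/Z addrAC [_ + chain_bd Z]addrAC addrA.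
Qed.
End Fixed.

End Incidence.

(** * Labels are least common multiples over the boundary *)

Section Labels.
Local Open Scope ring_scope.
Local Open Scope classical_set_scope.
Variable R : realType.
Variable n : nat.
Local Notation V := 'I_n.+1.
Local Notation contract := Defs.contract.
Variable A : 'M[nat]_n.+1.
Hypothesis A_sym : forall i j, A i j = A j i.
Implicit Types (C : pdigraph n) (u w : V) (e : edge n).

Lemma out_weak C (f : V -> R) u : nacyclic A C -> weak_on C f ->
  (\sum_(w | (f w < f u)%O) A u w <= out A C u)%N.
Proof.
move=> hC [fc fw]; rewrite (outE u hC) big_mkcond [leqRHS]big_mkcond.
apply: leq_sum => w _; case: ifP => // fwu.
have [->|Auw] := posnP (A u w); first by case: ifP.
have ne : blk C u != blk C w by apply: contraTneq fwu => /fc ->; rewrite ltxx.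
case/orP: (arr_total hC Auw ne) => [->//|/fw].
by rewrite leNgt fwu.
Qed.

(** A strict function on C/e is weak on C, so it has a preimage in the simplex. An interior preimage
    would make it strict on C as well and force C = C/e, against the numbers of parts. *)
Lemma facet_in_bd d (s : gcell A d.+1) (t : gcell A d) e :
  contractible (val s) e -> val t = contract (val s) e ->
  @gopen R n A (existT _ d t) `<=` gmap s @` @simplex_bd R d.+1.
Proof.
move=> ce Et x /gmap_open /=; rewrite Et => -[fc fs].
have hC := gcell_nac s; have /andP[eC _] := ce.
have wx : weak_on (val s) (set_val x ord0).
  split=> u w uw; first by apply: fc; rewrite !(contract_blk hC eC) uw.
  have [E|ne] := eqVneq (blk (val s) u, blk (val s) w) e.
    rewrite (fc w u) // !(contract_blk hC eC).
    by rewrite !(merge_ends (e := e)) // /ends -E eqxx ?orbT.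
  apply/ltW/fs; rewrite /arr !(contract_blk hC eC).
  exact: (contract_edge_in uw ne).
have [y yx] := gmap_surj wx; exists y => // yint.
have sx : strict_on (val s) (set_val x ord0) by rewrite -yx; apply/gmap_int.
have E : val s = val t.
  apply: (strict_uniq hC (gcell_nac t) sx); rewrite Et; by split.
by have := gcell_card s; rewrite E gcell_card => /eqP; rewrite eqSS ltn_eqF.
Qed.

(** For the bound, read the label of a boundary cell at an interior point: it is a weak point of the
    large cell, and by [out_weak] its strict descents along graph edges are all arrows of that cell.
    For attainment at u, contract an arrow leaving a nonsink part that does not contain u; the
    exponent at u cannot drop. *)
Lemma gcw_lcm_labels :
  @lcm_labels R n.+1 (gcw R A_sym) (fun d (c : gcell A d) => outdeg A (val c)).
Proof.
case=> // d s _; have hC := gcell_nac s; have dC := gcell_card s.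
apply: is_mlcm_out => [_ [j [t [ts ->]]] u|u].
  rewrite outdegE; have [y yint] := std_simplex_int R j.
  have st : strict_on (val t) (set_val (@gmap R n A j t y) ord0) by apply/gmap_int.
  have [y' _ yy'] : (gmap s @` @simplex_bd R d.+1) (gmap t y).
    by apply: ts; exists y.
  rewrite (out_strict u (gcell_nac t) st); apply: out_weak => //.
  by rewrite -yy'; apply: gmap_closed.
(* Positive dimension provides two nonsink parts, one of which does not contain u. *)
have [U UP Uu] : exists2 U, U \in parts (val s) & U != blk (val s) u.
  have sz : (1 < size (parts (val s)))%N by rewrite (size_parts hC) dC.
  have [E|ne] := eqVneq (nth finset.set0 (parts (val s)) 0) (blk (val s) u).
    exists (nth finset.set0 (parts (val s)) 1); first exact: mem_nth.
    by rewrite -E nth_uniq // ?parts_uniq // ltnW.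
  by exists (nth finset.set0 (parts (val s)) 0) => //; rewrite mem_nth // ltnW.
move: UP; rewrite mem_parts => /andP[UC nU].
have [W ce] := contractible_out hC UC nU.
have hC' := contr_nac A_sym hC ce.
have dC' : #|(contract (val s) (U, W)).1| = d.+2 by rewrite (contr_card hC ce) dC.
have [t Et] := gcell_ex hC' dC'.
exists (outdeg A (val t)); first by exists d, t; split=> //; exact: facet_in_bd ce Et.
rewrite outdegE Et; apply: (out_contract A_sym hC ce) => /=.
by apply: contra Uu => uU; rewrite (blk_def hC UC uU).
Qed.

End Labels.

Theorem theorem7p1 (R : realType) (K : fieldType) (n : nat)
    (A : 'M[nat]_n.+1)
    (A_sym : forall i j, A i j = A j i)
    (A_conn : connected_graph A)
    (sign : pdigraph n -> edge n -> int)
    (sign_ok : sign_function A sign) :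
  supported_on_CW R (F0 K A sign).
Proof.
exists (gcw R A_sym), (fun d (c : gcell A d) => outdeg A (val c)),
  (fun d => @ginc n A sign d); split.
- exact: gcw_lcm_labels.
(* Any point of the space can serve as the default value of the realization; here one in the cell of
   [s]. *)
- move=> d s; have [t _] := std_simplex_int R d.+1.
  exact: (gincidence_at A_sym sign_ok (gmap s t) s).
- exact: F0_giso.
Qed.
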